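(* Let $k\in[0,1)$, $\lambda\in(-\pi/2,\pi/2)$ and $f\in\mathcal{R}(\lambda)$. (i) If $0<\cos\lambda\le k/2$, then $f\in\mathcal{S}(k)$. (ii) If $f''(0)=0$ and $0<\cos\lambda\le k$, then $f\in\mathcal{S}(k)$.
   Context: $\mathbb{D}=\{z\in\mathbb{C}:|z|<1\}$. $\mathcal{A}$ is the family of functions $f$ analytic in $\mathbb{D}$ with $f(0)=0$ and $f'(0)=1$. For $\lambda\in(-\pi/2,\pi/2)$, $\mathcal{R}(\lambda)$ is the set of $\lambda$-Robertson functions, i.e. of those $f\in\mathcal{A}$ with $$\operatorname{Re}\left\{e^{-i\lambda}\left(1+\frac{zf''(z)}{f'(z)}\right)\right\}>0\quad\text{for all } z\in\mathbb{D}$$ (in particular $f'(z)\neq 0$ for all $z\in\mathbb{D}$, so that the expression is defined). $\mathcal{S}$ is the subclass of $\mathcal{A}$ consisting of functions univalent (injective) in $\mathbb{D}$. For $k\in[0,1)$, $\mathcal{S}(k)$ is the family of functions $f\in\mathcal{S}$ that can be extended to a quasiconformal automorphism of $\mathbb{C}$ (again denoted $f$) whose complex dilatation $\mu_f=(\partial f/\partial\bar z)/(\partial f/\partial z)$ satisfies $|\mu_f(z)|\le k$ for almost every $z\in\mathbb{C}$. *)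

(* Defs.v *)
From mathcomp Require Import all_boot all_order all_algebra.
From mathcomp Require Import all_classical all_reals all_analysis.
From mathcomp Require Export complex.

Set Implicit Arguments.
Unset Strict Implicit.
Unset Printing Implicit Defensive.

Import Order.TTheory GRing.Theory Num.Theory.
Import numFieldNormedType.Exports.

Local Open Scope complex_scope.
Local Open Scope ring_scope.
Local Open Scope classical_set_scope.

(* The norm of [R[i]] takes values in [R[i]]; an inequality [`|z| <= c%:C]
   with [c : R] is the usual inequality between real numbers. *)
Definition unit_disc (R : realType) : set R[i] := [set z | `|z| < 1].
Arguments unit_disc R : clear implicits.

(* Local power series expansions. *)
Definition analytic_on (R : realType) (U : set R[i]) (f : R[i]^o -> R[i]^o) :
    Prop :=
  forall z0 : R[i], U z0 -> exists (r : R) (a : nat -> R[i]), 0 < r /\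
    forall z : R[i], `|z - z0| < r%:C ->
      series (fun n => a n * (z - z0) ^+ n : R[i]^o) @ \oo --> f z.

(* Functions on the disc are total functions on [R[i]] whose values outside the
   disc are irrelevant; [f^`()] is the complex derivative. *)
Definition classA (R : realType) (f : R[i]^o -> R[i]^o) : Prop :=
  [/\ analytic_on (unit_disc R) f, f 0 = 0 & f^`() 0 = 1].

Definition expi (R : realType) (t : R) : R[i] := cos t +i* sin t.

(* [f^`() z != 0] is explicit because division by zero is total. *)
Definition robertson (R : realType) (lam : R) (f : R[i]^o -> R[i]^o) : Prop :=
  classA f /\
  forall z : R[i], unit_disc R z ->
    f^`() z != 0 /\
    0 < complex.Re (expi (- lam) * (1 + z * f^`(2)%classic z / f^`()%classic z)).

Definition classS (R : realType) (f : R[i]^o -> R[i]^o) : Prop :=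
  classA f /\ {in unit_disc R &, injective f}.

Definition abs_continuous (R : realType) (a b : R) (u : R -> R) : Prop :=
  forall e : R, 0 < e -> exists2 d : R, 0 < d &
    forall (n : nat) (s t : 'I_n -> R),
      (forall i, a <= s i <= t i /\ t i <= b) ->
      trivIset setT (fun i => `]s i, t i[%classic) ->
      \sum_(i < n) (t i - s i) < d ->
      \sum_(i < n) `|u (t i) - u (s i)| < e.

(* Absolute continuity on lines: on every closed rectangle [a, b] x [c, d], the
   real and imaginary parts of [g] are absolutely continuous on almost every
   horizontal and almost every vertical segment. *)
Definition ACL (R : realType) (g : R[i]^o -> R[i]^o) : Prop :=
  forall a b c d : R, a < b -> c < d ->
    {ae lebesgue_measure, forall y : R, c <= y <= d ->
       abs_continuous a b (fun x => complex.Re (g (x +i* y))) /\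
       abs_continuous a b (fun x => complex.Im (g (x +i* y)))} /\
    {ae lebesgue_measure, forall x : R, a <= x <= b ->
       abs_continuous c d (fun y => complex.Re (g (x +i* y))) /\
       abs_continuous c d (fun y => complex.Im (g (x +i* y)))}.

Definition partial_x (R : realType) (g : R[i]^o -> R[i]^o) (x y : R) : R[i] :=
  (fun t : R => complex.Re (g (t +i* y)))^`() x +i*
  (fun t : R => complex.Im (g (t +i* y)))^`() x.

Definition partial_y (R : realType) (g : R[i]^o -> R[i]^o) (x y : R) : R[i] :=
  (fun t : R => complex.Re (g (x +i* t)))^`() y +i*
  (fun t : R => complex.Im (g (x +i* t)))^`() y.

Definition dz (R : realType) (g : R[i]^o -> R[i]^o) (x y : R) : R[i] :=
  (partial_x g x y - 'i%C * partial_y g x y) / 2.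

Definition dzbar (R : realType) (g : R[i]^o -> R[i]^o) (x y : R) : R[i] :=
  (partial_x g x y + 'i%C * partial_y g x y) / 2.

Definition dilatation (R : realType) (g : R[i]^o -> R[i]^o) (x y : R) : R[i] :=
  dzbar g x y / dz g x y.

Definition homeomorphism (R : realType) (g : R[i]^o -> R[i]^o) : Prop :=
  continuous g /\
  exists h : R[i]^o -> R[i]^o, [/\ continuous h, cancel g h & cancel h g].

(* Almost everywhere for the Lebesgue measure of the plane. *)
Definition plane_ae (R : realType) (P : R -> R -> Prop) : Prop :=
  {ae (@lebesgue_measure R \x @lebesgue_measure R)%E,
     forall p : R * R, P p.1 p.2}.

(* Analytic definition of quasiconformality: an ACL homeomorphism with
   |g_zbar| <= q |g_z| almost everywhere, for some constant q < 1.  The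
   inequality is in product form, so that it forces g_zbar = 0 where g_z = 0;
   it also forces [g] to preserve orientation. *)
Definition qc_automorphism (R : realType) (g : R[i]^o -> R[i]^o) : Prop :=
  [/\ homeomorphism g, ACL g &
    exists2 q : R, 0 <= q < 1 &
      plane_ae (fun x y => `|dzbar g x y| <= q%:C * `|dz g x y|)].

Definition classSk (R : realType) (k : R) (f : R[i]^o -> R[i]^o) : Prop :=
  classS f /\
  exists g : R[i]^o -> R[i]^o,
    [/\ qc_automorphism g, (forall z : R[i], unit_disc R z -> g z = f z) &
        plane_ae (fun x y => `|dilatation g x y| <= k%:C)].

(* Main.v *)
Require Import Defs.
From mathcomp Require Import all_boot all_order all_algebra.
From mathcomp Require Import all_classical all_reals all_analysis measurable_realfun.
From mathcomp Require Import ring lra.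

(** The theorem follows from Ahlfors' criterion for quasiconformal extension
    ([ahlfors_extension]): let [f] be locally univalent in the disc with derivatives
    [f1], [f2] and [f 0 = 0], [f1 0 = 1], let [|c| <= k < 1], and suppose that
    [|c f1 u + (s - 1) u f2 u| <= k s |f1 u|] whenever [s >= 1] and [|u|^2 s <= 1].
    If also [|f2 u| (1 - |u|) <= k |f1 u|], then [f] is injective, and
    [F z = f u + (z - u) f1 u / (1 + c)], [u = 1 / z^*], extends it to a
    [k]-quasiconformal automorphism of the plane.

    The criterion applies to a Robertson function for the following reason. With
    [E = e^(i lam) cos lam], the half plane condition says that
    [omega = z f2 / (z f2 + 2 E f1)] maps the disc to the disc
    ([half_plane_disc]), and [omega 0 = 0]. Hence [|omega z| <= |z|] by the
    Schwarz lemma, and [|omega z| <= |z|^2] if [f2 0 = 0] ([schwarz_quotient],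
    [schwarz_quotient0]). Ahlfors' condition holds with [c = - 2 E] in the first
    case and with [c = - E] in the second, by an elementary inequality between
    moduli ([scaled_difference_le], [scaled_difference_le2]); as [|E| = cos lam],
    the two hypotheses on [cos lam] are just what makes [|c| <= k]. The Schwarz
    lemma rests on the maximum principle for quotients of power series
    ([local_max_constant]).

    That [F] is a homeomorphism is proved by following preimages in time. The
    condition says that [lG s u = f u + (s - 1) / (1 + c) u f1 u] is a Loewner chain
    on the shrinking discs [|u|^2 s <= 1]: a solution [u] of [lG s u = w] moves as
    [s] grows with bounded speed and strictly into the interior of these discs
    ([Sol_push], [Sol_push_strict]). For large [s] the map [lG s] is nearly a
    multiple of the identity, so that it has at most one solution; since distinct
    solutions cannot merge, there is at most one at every time ([Sol_unique]).
    Every point [z] of the plane starts such a solution, from the boundary circle of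
    the moving disc if [|z| > 1]. Therefore two points with the same image coincide
    ([F_inj]), and the first time at which [w] is covered gives a preimage of [w]
    ([F_surj]). The motion is followed by continuous induction ([real_induction])
    from one local solution of the equation to the next ([param_solve]), rather than
    by a differential equation.

    Outside the unit circle, Ahlfors' condition with [|u|^2 s = 1] is the bound
    [|F_zbar| <= k |F_z|] ([F_rder_out]). The growth of [f1], at most
    [(1 - |u|)^(- k)] ([f1_growth]), gives [f] continuous boundary values
    ([fbar_tends]). It also bounds the differential of [F] by a multiple of
    [||z|^2 - 1|^(- k)], which along horizontal and vertical lines not tangent to the
    unit circle has an absolutely continuous majorant ([abs_continuous_majorant]);
    so [F] is absolutely continuous on these lines ([F_line_abs_continuous]). *)
Import Order.TTheory GRing.Theory Num.Theory.
Import numFieldNormedType.Exports.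

Set Implicit Arguments.
Unset Strict Implicit.
Unset Printing Implicit Defensive.

Local Open Scope complex_scope.
Local Open Scope ring_scope.
Local Open Scope classical_set_scope.

Local Notation Re := complex.Re.
Local Notation Im := complex.Im.

(** * The modulus and convergence of complex sequences *)

Section Modulus.
Variable R : realType.
Implicit Types (x y : R) (z w : R[i]).

(** The modulus as an element of [R], so that estimates are inequalities between
    real numbers. *)
Definition cmod z : R := ComplexField.Normc.normc z.

Lemma normcmod z : `|z| = (cmod z)%:C. Proof. by []. Qed.

Lemma cmod_ge0 z : 0 <= cmod z.
Proof. by case: z => a b; exact: sqrtr_ge0. Qed.

End Modulus.

Ltac nonneg := first [ done | exact: cmod_ge0 | exact: ltW |
  lazymatch goal with
  | |- is_true (0 <= _ ^+ _) => apply: exprn_ge0; nonneg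
  | |- is_true (0 <= _ `^ _) => exact: powR_ge0
  | |- is_true (0 <= _^-1) => rewrite invr_ge0; nonneg
  | |- is_true (0 <= _ * _) => apply: mulr_ge0; nonneg
  | |- is_true (0 <= _ + _) => apply: addr_ge0; nonneg
  end ].

Section ModulusTheory.
Variable R : realType.
Implicit Types (x y : R) (z w : R[i]).

Lemma cmod0 : cmod (0 : R[i]) = 0. Proof. exact: ComplexField.Normc.normc0. Qed.
Lemma cmod1 : cmod (1 : R[i]) = 1. Proof. exact: ComplexField.Normc.normc1. Qed.

Lemma cmodM z w : cmod (z * w) = cmod z * cmod w.
Proof. exact: ComplexField.Normc.normcM. Qed.

Lemma cmodV z : cmod z^-1 = (cmod z)^-1.
Proof. exact: ComplexField.Normc.normcV. Qed.

Lemma cmodN z : cmod (- z) = cmod z. Proof. exact: normcN. Qed.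

Lemma cmodD z w : cmod (z + w) <= cmod z + cmod w.
Proof. exact: le_normcD. Qed.

Lemma cmodD3 (v z w : R[i]) : cmod (v + z + w) <= cmod v + cmod z + cmod w.
Proof. by apply: le_trans (cmodD _ _) _; rewrite lerD2r cmodD. Qed.

Lemma cmodX z n : cmod (z ^+ n) = cmod z ^+ n.
Proof. by elim: n => [|n IH]; rewrite ?expr0 ?cmod1// !exprS cmodM IH. Qed.

Lemma cmod_real x : cmod x%:C = `|x|.
Proof. by rewrite /cmod /= expr0n addr0 sqrtr_sqr. Qed.

Lemma cmod_sqr z : cmod z ^+ 2 = Re z ^+ 2 + Im z ^+ 2.
Proof. by case: z => a b; rewrite sqr_sqrtr// addr_ge0// sqr_ge0. Qed.

Lemma cmodJ z : cmod z^* = cmod z.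
Proof. by case: z => a b; rewrite /cmod/= sqrrN. Qed.

Lemma cmodi : cmod ('i : R[i]) = 1.
Proof. by rewrite /cmod /= expr0n expr1n add0r sqrtr1. Qed.

Lemma cmod_eq0 z : (cmod z == 0) = (z == 0).
Proof.
apply/eqP/eqP => [|->]; [exact: ComplexField.Normc.eq0_normc | exact: cmod0].
Qed.

Lemma cmod_gt0 z : (0 < cmod z) = (z != 0).
Proof. by rewrite lt_def cmod_ge0 andbT cmod_eq0. Qed.

Lemma cmodB z w : cmod (z - w) <= cmod z + cmod w.
Proof. by rewrite -(cmodN w) cmodD. Qed.

Lemma cmodC z w : cmod (z - w) = cmod (w - z).
Proof. by rewrite -cmodN opprB. Qed.

Lemma cmod_tri v z w : cmod (z - w) <= cmod (z - v) + cmod (v - w).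
Proof. by rewrite (_ : z - w = (z - v) + (v - w)) ?cmodD// addrA subrK. Qed.

Lemma cmod_subl z w : cmod z - cmod w <= cmod (z - w).
Proof. by rewrite lerBlDr -{1}(subrK w z) cmodD. Qed.

Lemma Re_cmod z : `|Re z| <= cmod z.
Proof.
by rewrite -[leLHS]ger0_norm// -ler_sqr ?nnegrE ?cmod_ge0// normr_id
  real_normK ?num_real// cmod_sqr lerDl sqr_ge0.
Qed.

Lemma Im_cmod z : `|Im z| <= cmod z.
Proof.
by rewrite -ler_sqr ?nnegrE ?cmod_ge0// real_normK ?num_real// cmod_sqr lerDr
  sqr_ge0.
Qed.

Lemma cmod_ReIm z : cmod z <= `|Re z| + `|Im z|.
Proof.
rewrite {1}[z]complexE; apply: le_trans (cmodD _ _) _.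
by rewrite cmodM !cmod_real cmodi mul1r.
Qed.

Lemma re_sub z w : Re (z - w) = Re z - Re w.
Proof. by case: z w => a b [c d]. Qed.
Lemma im_sub z w : Im (z - w) = Im z - Im w.
Proof. by case: z w => a b [c d]. Qed.
Lemma re_add z w : Re (z + w) = Re z + Re w.
Proof. by case: z w => a b [c d]. Qed.
Lemma im_add z w : Im (z + w) = Im z + Im w.
Proof. by case: z w => a b [c d]. Qed.
Lemma re_mul z w : Re (z * w) = Re z * Re w - Im z * Im w.
Proof. by case: z w => a b [c d]. Qed.
Lemma im_mul z w : Im (z * w) = Re z * Im w + Im z * Re w.
Proof. by case: z w => a b [c d]. Qed.

Lemma ltc_cmod z x : (`|z| < x%:C) = (cmod z < x).
Proof. by rewrite normcmod ltcR. Qed.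

Lemma unit_discE z : unit_disc R z <-> cmod z < 1.
Proof. by rewrite /unit_disc /= -ltc_cmod. Qed.

(** The topology of [R[i]^o] has tolerances in [R[i]]; with tolerances in [R] the
    estimates remain inequalities between real numbers. *)
Definition tends (u : nat -> R[i]) (l : R[i]) :=
  forall e : R, 0 < e -> exists N, forall n, (N <= n)%N -> cmod (u n - l) < e.

(** Elements of [R[i]] are comparable only when their imaginary parts agree. *)
Lemma cpos_real (e : R[i]) : 0 < e -> 0 < Re e /\ e = (Re e)%:C.
Proof. by case: e => a b; rewrite ltcE/= => /andP[/eqP -> ?]. Qed.

Lemma tendsP (u : nat -> R[i]^o) (l : R[i]^o) :
  (u @ \oo --> l) <-> tends u l.
Proof.
split=> [/cvgrPdist_lt h e e0|h].
  have /h [N _ hN] : 0 < e%:C by rewrite ltcR.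
  exists N => n Nn; have := hN _ Nn.
  by rewrite /= normcmod cmodC ltcR.
apply/cvgrPdist_lt => e /cpos_real [e0 ->].
have [N hN] := h _ e0; exists N => // n /= Nn.
by rewrite normcmod cmodC ltcR; exact: hN.
Qed.

Lemma tends_eq u v l : u =1 v -> tends u l -> tends v l.
Proof. by move=> /funext ->. Qed.

Lemma tends_cst z : tends (fun=> z) z.
Proof. by move=> e e0; exists 0 => n _; rewrite subrr cmod0. Qed.

Lemma tendsD u v a b : tends u a -> tends v b -> tends (fun n => u n + v n) (a + b).
Proof.
move=> hu hv e e0; have e2 : 0 < e / 2 by lra.
have [N hN] := hu _ e2; have [M hM] := hv _ e2.
exists (maxn N M) => n; rewrite geq_max => /andP[/hN h1 /hM h2].
rewrite (_ : u n + v n - (a + b) = (u n - a) + (v n - b)); last by ring.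
by apply: le_lt_trans (cmodD _ _) _; lra.
Qed.

Lemma tendsZ u c a : tends u a -> tends (fun n => c * u n) (c * a).
Proof.
move=> hu e e0; have d0 : 0 < e / (cmod c + 1).
  by rewrite divr_gt0// ltr_wpDl ?cmod_ge0.
have [N hN] := hu _ d0; exists N => n /hN h.
rewrite -mulrBr cmodM.
have c0 : 0 < cmod c + 1 by rewrite ltr_wpDl ?cmod_ge0.
move: h; rewrite ltr_pdivlMr// => h; apply: le_lt_trans h.
by rewrite mulrC ler_wpM2l ?cmod_ge0// lerDl.
Qed.

Lemma tendsB u v a b : tends u a -> tends v b -> tends (fun n => u n - v n) (a - b).
Proof.
move=> hu hv; apply: tendsD => //.
apply: (@tends_eq (fun n => -1 * v n)) => [n|]; first by rewrite mulN1r.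
by rewrite -(mulN1r b); exact: tendsZ.
Qed.

Lemma tends_le u l z x : tends u l -> (forall n, cmod (u n - z) <= x) ->
  cmod (l - z) <= x.
Proof.
move=> hu h; apply/ler_addgt0Pr => e e0; have [N hN] := hu _ e0.
have := hN N (leqnn _); have := h N.
have := cmod_tri (u N) l z; rewrite (cmodC l (u N)); lra.
Qed.

Lemma tends_mod_le u l x : tends u l -> (forall n, cmod (u n) <= x) -> cmod l <= x.
Proof.
move=> hu h; rewrite -[l]subr0; apply: tends_le hu _ => n.
by rewrite subr0.
Qed.

Lemma tends_unique u l l' : tends u l -> tends u l' -> l = l'.
Proof.
move=> h h'; apply/eqP; rewrite -subr_eq0 -cmod_eq0 eq_le cmod_ge0 andbT.
apply/ler_addgt0Pr => e e0; have e2 : 0 < e / 2 by lra.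
have [N hN] := h _ e2; have [M hM] := h' _ e2.
have := hN (maxn N M) (leq_maxl _ _); have := hM (maxn N M) (leq_maxr _ _).
have := cmod_tri (u (maxn N M)) l l'; rewrite (cmodC l (u _)); lra.
Qed.

Lemma tends_sub u l (phi : nat -> nat) : (forall n, (n <= phi n)%N) ->
  tends u l -> tends (u \o phi) l.
Proof.
move=> hphi hu e /hu[N hN]; exists N => n Nn; apply: hN.
exact: leq_trans (hphi n).
Qed.

Lemma tends_ReIm u l :
  (fun n => Re (u n)) @ \oo --> Re l -> (fun n => Im (u n)) @ \oo --> Im l ->
  tends u l.
Proof.
move=> /cvgrPdist_lt hr /cvgrPdist_lt hi e e0; have e2 : 0 < e / 2 by lra.
have [N _ hN] := hr _ e2; have [M _ hM] := hi _ e2.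
exists (maxn N M) => n; rewrite geq_max => /andP[/hN /= h1 /hM /= h2].
apply: le_lt_trans (cmod_ReIm _) _; rewrite re_sub im_sub.
by rewrite distrC (distrC (Im _)); lra.
Qed.

Lemma increasing_ge (phi : nat -> nat) :
  increasing_seq phi -> forall n, (n <= phi n)%N.
Proof.
move=> /increasing_seqP h; elim=> // n IH; apply: leq_ltn_trans IH _.
exact: h.
Qed.

Lemma bounded_real_subseq (u : nat -> R) (M : R) : (forall n, `|u n| <= M) ->
  exists2 phi : nat -> nat, (forall n, (n <= phi n)%N) & exists l : R, (u \o phi) @ \oo --> l.
Proof.
move=> h; have [|phi iphi cphi] := @bolzano_weierstrass R u.
  exists M; split; first exact: num_real.
  by move=> x Mx n _; apply: le_trans (h n) (ltW Mx).
exists phi; first exact: increasing_ge.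
by exists (lim (u \o phi @ \oo)).
Qed.

(** Bolzano-Weierstrass. Extractions [phi] are only required to satisfy
    [n <= phi n]: this passes to compositions and preserves limits. *)
Lemma bounded_subseq u M : (forall n, cmod (u n) <= M) ->
  exists2 phi : nat -> nat, (forall n, (n <= phi n)%N) & exists l, tends (u \o phi) l.
Proof.
move=> h.
have [|p hp [a ha]] := @bounded_real_subseq (fun n => Re (u n)) M.
  by move=> n; exact: le_trans (Re_cmod _) (h n).
have [|q hq [b hb]] := @bounded_real_subseq (fun n => Im (u (p n))) M.
  by move=> n; exact: le_trans (Im_cmod _) (h _).
exists (p \o q) => [n|]; first exact: leq_trans (hq n) (hp _).
exists (a +i* b); apply: tends_ReIm => //=.
have hq' : q @ \oo --> \oo by apply/cvgnyPge => A; near=> n; apply: leq_trans (hq n);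
  near: n; exact: nbhs_infty_ge.
exact: (cvg_comp _ _ hq' ha).
Unshelve. all: by end_near. Qed.

Lemma cauchy_tends u :
  (forall e : R, 0 < e -> exists N, forall n m, (N <= n)%N -> (N <= m)%N ->
     cmod (u n - u m) < e) -> exists l, tends u l.
Proof.
move=> h; have [N0 hN0] := h _ ltr01.
have [|phi hphi [l hl]] := @bounded_subseq (fun n => u (N0 + n)%N) (cmod (u N0) + 1).
  move=> n; have := hN0 _ N0 (leq_addr n _) (leqnn _).
  by have := cmod_subl (u (N0 + n)%N) (u N0); lra.
exists l => e e0; have e2 : 0 < e / 2 by lra.
have [N hN] := h _ e2; have [M hM] := hl _ e2.
exists N => n Nn; set m := maxn N M.
have := hM m (leq_maxr _ _).
have := hN n (N0 + phi m)%N Nn (leq_trans (leq_maxl _ _) (leq_trans (hphi m) (leq_addl _ _))).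
have := cmod_tri (u (N0 + phi m)%N) (u n) l; rewrite /=; lra.
Qed.

Lemma geometric_series_tends (c : nat -> R[i]) M :
  (forall n, cmod (c n) <= M * 2^-1 ^+ n) -> exists l, tends (series c) l.
Proof.
move=> h; have M0 : 0 <= M.
  by have := le_trans (cmod_ge0 _) (h 0%N); rewrite expr0 mulr1.
have key n p : cmod (series c (n + p)%N - series c n) <= M * 2 * (2^-1 ^+ n - 2^-1 ^+ (n + p)).
  elim: p => [|p IH]; first by rewrite addn0 !subrr cmod0 mulr0.
  rewrite addnS seriesSr addrAC; apply: le_trans (cmodD _ _) _.
  have := h (n + p)%N; have := IH; rewrite exprS; lra.
apply: cauchy_tends => e e0.
have [N hN] : exists N, M * 2 * 2^-1 ^+ N < e / 2.
  have : (fun n : nat => 2^-1 ^+ n : R) @ \oo --> 0 by apply: cvg_expr; rewrite ger0_norm; lra.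
  have d0 : 0 < e / 2 / (M * 2 + 1) by rewrite !divr_gt0//; lra.
  move=> /cvgrPdist_lt /(_ _ d0)[N _ /(_ N (leqnn _))] /=.
  rewrite sub0r normrN ger0_norm ?exprn_ge0 ?invr_ge0 ?ler0n//.
  rewrite ltr_pdivlMr; last by lra.
  move=> h'; exists N; have : 0 <= 2^-1 ^+ N :> R by rewrite exprn_ge0 ?invr_ge0 ?ler0n.
  lra.
exists N => n m Nn Nm.
have bnd k : (N <= k)%N -> cmod (series c k - series c N) < e / 2.
  move=> Nk; have := key N (k - N)%N; rewrite subnKC//.
  have : 0 <= M * 2^-1 ^+ k by rewrite mulr_ge0 ?exprn_ge0 ?invr_ge0 ?ler0n.
  lra.
have := bnd _ Nn; have := bnd _ Nm; have := cmod_tri (series c N) (series c n) (series c m).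
rewrite (cmodC (series c N)); lra.
Qed.

End ModulusTheory.

(** * Strict derivatives and power series *)

Section PowerSeries.
Variable R : realType.
Implicit Types (x y z w : R[i]) (f g : R[i] -> R[i]) (a : nat -> R[i]).

(** Differentiability uniform over pairs of points near [z]: the form in which
    a derivative can be inverted by a contraction argument without any
    continuity of the derivative. *)
Definition sder f z (l : R[i]) :=
  forall e : R, 0 < e -> exists2 d : R, 0 < d & forall x y,
    cmod (x - z) < d -> cmod (y - z) < d ->
    cmod (f x - f y - l * (x - y)) <= e * cmod (x - y).

Lemma sder_id z : sder id z 1.
Proof.
by move=> e e0; exists 1 => // x y _ _; rewrite mul1r subrr cmod0 mulr_ge0// ?cmod_ge0// ltW.
Qed.

Lemma sder_cst c z : sder (fun=> c) z 0.
Proof.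
move=> e e0; exists 1 => // x y _ _.
by rewrite mul0r subrr subr0 cmod0 mulr_ge0// ?cmod_ge0// ltW.
Qed.

Lemma sder_bound f z l : sder f z l -> exists2 d : R, 0 < d & forall x y,
  cmod (x - z) < d -> cmod (y - z) < d ->
  cmod (f x - f y) <= (cmod l + 1) * cmod (x - y).
Proof.
move=> /(_ 1 ltr01)[d d0 hd]; exists d => // x y hx hy.
have := hd _ _ hx hy; have := cmod_subl (f x - f y) (l * (x - y)).
by rewrite cmodM; lra.
Qed.

Lemma sder_cont f z l : sder f z l -> forall e : R, 0 < e ->
  exists2 d : R, 0 < d & forall x, cmod (x - z) < d -> cmod (f x - f z) < e.
Proof.
move=> /sder_bound[d d0 hd] e e0.
have l0 : 0 < cmod l + 1 by rewrite ltr_wpDl ?cmod_ge0.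
exists (Num.min d (e / (cmod l + 1))) => [|x]; first by rewrite lt_min d0 divr_gt0.
rewrite lt_min ltr_pdivlMr// => /andP[xd xe].
apply: le_lt_trans (hd _ z xd _) _; first by rewrite subrr cmod0.
by rewrite mulrC.
Qed.

Lemma sder_tends f z l (u : nat -> R[i]) : sder f z l -> tends u z ->
  tends (fun n => f (u n)) (f z).
Proof.
move=> /sder_cont hf hu e /hf[d /hu[N hN] hd]; exists N => n Nn.
by apply: hd; exact: hN.
Qed.

Lemma sderM f g z l m : sder f z l -> sder g z m ->
  sder (fun x => f x * g x) z (l * g z + f z * m).
Proof.
move=> hf hg e e0.
have [df df0 bf] := sder_bound hf; have [dg dg0 bg] := sder_bound hg.
set L := cmod l + 1; set M := cmod m + 1.
have L0 : 0 < L by rewrite /L; have := cmod_ge0 l; lra.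
have M0 : 0 < M by rewrite /M; have := cmod_ge0 m; lra.
set A := cmod (f z) + 1; set B := cmod (g z) + 1.
have A0 : 0 < A by rewrite /A; have := cmod_ge0 (f z); lra.
have B0 : 0 < B by rewrite /B; have := cmod_ge0 (g z); lra.
have eB : 0 < e / 4 / B by rewrite !divr_gt0//; lra.
have eA : 0 < e / 4 / A by rewrite !divr_gt0//; lra.
have eM : 0 < e / 4 / M by rewrite !divr_gt0//; lra.
have eL : 0 < e / 4 / L by rewrite !divr_gt0//; lra.
have [d1 d10 h1] := hf _ eB; have [d2 d20 h2] := hg _ eA.
have [d3 d30 h3] := sder_cont hf eM.
have [d4 d40 h4] := sder_cont hg eL.
exists (Num.min (Num.min d1 d2) (Num.min (Num.min d3 d4) (Num.min df dg))) => [|x y].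
  by rewrite !lt_min d10 d20 d30 d40 df0.
rewrite !lt_min => /andP[/andP[x1 x2] /andP[/andP[x3 x4] /andP[x5 x6]]].
move=> /andP[/andP[y1 y2] /andP[/andP[y3 y4] /andP[y5 y6]]].
rewrite (_ : f x * g x - f y * g y - (l * g z + f z * m) * (x - y) =
  (f x - f y - l * (x - y)) * g z + (f x - f y) * (g x - g z) +
  f z * (g x - g y - m * (x - y)) + (f y - f z) * (g x - g y)); last by ring.
apply: le_trans (cmodD _ _) _; apply: le_trans (lerD (cmodD3 _ _ _) (lexx _)) _.
rewrite !cmodM.
have D0 := cmod_ge0 (x - y).
have t1 : cmod (f x - f y - l * (x - y)) * cmod (g z) <= e / 4 * cmod (x - y).
  apply: (@le_trans _ _ ((e / 4 / B * cmod (x - y)) * B)).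
    apply: ler_pM; rewrite ?cmod_ge0//; first exact: h1.
    by rewrite /B lerDl.
  by rewrite mulrAC divfK ?gt_eqF.
have t2 : cmod (f x - f y) * cmod (g x - g z) <= e / 4 * cmod (x - y).
  apply: (@le_trans _ _ ((L * cmod (x - y)) * (e / 4 / L))).
    apply: ler_pM; rewrite ?cmod_ge0//; first exact: bf.
    by apply/ltW/h4.
  by rewrite mulrC mulrA divfK ?gt_eqF.
have t3 : cmod (f z) * cmod (g x - g y - m * (x - y)) <= e / 4 * cmod (x - y).
  apply: (@le_trans _ _ (A * (e / 4 / A * cmod (x - y)))).
    apply: ler_pM; rewrite ?cmod_ge0//; last exact: h2.
    by rewrite /A lerDl.
  by rewrite mulrA (mulrC A) divfK ?gt_eqF.
have t4 : cmod (f y - f z) * cmod (g x - g y) <= e / 4 * cmod (x - y).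
  apply: (@le_trans _ _ ((e / 4 / M) * (M * cmod (x - y)))).
    apply: ler_pM; rewrite ?cmod_ge0//; last exact: bg.
    by apply/ltW/h3.
  by rewrite mulrA divfK ?gt_eqF.
lra.
Qed.

Lemma sder_derive1 (f : R[i]^o -> R[i]^o) z l : sder f z l -> f^`()%classic z = l.
Proof.
move=> hf; rewrite /derive1; apply: cvg_lim => //.
apply/cvgrPdist_lt => e /cpos_real[e0 ->]; have e2 : 0 < Re e / 2 by lra.
have [d d0 hd] := hf _ e2.
exists d%:C => /=; first by rewrite ltcR.
move=> h /=; rewrite sub0r normrN normcmod ltcR => hh h0.
rewrite normcmod ltcR.
have := hd (h + z) z; rewrite addrK subrr cmod0 => /(_ hh d0) key.
have h0' : 0 < cmod h by rewrite cmod_gt0.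
rewrite (_ : l - _ = - (h^-1 * (f (h + z) - f z - l * h))).
  rewrite cmodN cmodM cmodV mulrC ltr_pdivrMr//.
  by apply: le_lt_trans key _; rewrite ltr_pM2r//; lra.
by rewrite mulrBr mulrCA mulVf// mulr1 opprB.
Qed.

Definition psum a z0 (r : R) f :=
  forall z, cmod (z - z0) < r -> tends (series (fun n => a n * (z - z0) ^+ n)) (f z).

Definition ana f z0 := exists (r : R) a, 0 < r /\ psum a z0 r f.

Lemma tends_bounded (u : nat -> R[i]) l : tends u l ->
  exists M : R, forall n, cmod (u n) <= M.
Proof.
move=> /(_ 1 ltr01)[N hN].
exists (cmod l + 1 + \sum_(i < N) cmod (u i)) => n.
have S0 : 0 <= \sum_(i < N) cmod (u i) by apply: sumr_ge0 => i _; exact: cmod_ge0.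
case: (leqP N n) => [/hN h|nN].
  by have := cmod_subl (u n) l; lra.
have := cmod_ge0 l; rewrite (bigD1 (Ordinal nN))//= => l0.
have : 0 <= \sum_(i < N | i != Ordinal nN) cmod (u i).
  by apply: sumr_ge0 => i _; exact: cmod_ge0.
lra.
Qed.

Lemma psum_coef_bound a z0 (r : R) f : 0 < r -> psum a z0 r f ->
  exists2 M : R, 0 <= M & forall n, cmod (a n) * (r / 2) ^+ n <= M.
Proof.
move=> r0 h.
have r2 : cmod (r / 2)%:C = r / 2 by rewrite cmod_real ger0_norm; lra.
have [|M hM] := @tends_bounded (series (fun n => a n * (r / 2)%:C ^+ n)) (f (z0 + (r / 2)%:C)).
  have := h (z0 + (r / 2)%:C); rewrite addrC addKr; apply; rewrite r2; lra.
exists (M + M) => [|n].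
  by rewrite addr_ge0// (le_trans _ (hM 0%N))// cmod_ge0.
rewrite -r2 -cmodX -cmodM.
rewrite (_ : a n * _ = series (fun n => a n * (r / 2)%:C ^+ n) n.+1 -
   series (fun n => a n * (r / 2)%:C ^+ n) n); last by rewrite seriesSr addrC addKr.
by apply: le_trans (cmodB _ _) _; exact: lerD.
Qed.

Lemma nat_pow2 (n : nat) : n%:R * 2^-1 ^+ n <= 1 :> R.
Proof.
rewrite exprVn ler_pdivrMr ?exprn_gt0// mul1r -natrX ler_nat.
by apply: ltnW; rewrite ltn_expl.
Qed.

Lemma pow_lipschitz (rho : R) (n : nat) x y : cmod x <= rho -> cmod y <= rho ->
  rho * cmod (x ^+ n - y ^+ n) <= n%:R * rho ^+ n * cmod (x - y).
Proof.
move=> hx hy; have rho0 := le_trans (cmod_ge0 _) hx.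
elim: n => [|n IH]; first by rewrite !expr0 subrr cmod0 mulr0 mul0r mul0r.
rewrite (_ : x ^+ n.+1 - y ^+ n.+1 = x * (x ^+ n - y ^+ n) + (x - y) * y ^+ n);
  last by rewrite !exprS; ring.
have h1 := cmodD (x * (x ^+ n - y ^+ n)) ((x - y) * y ^+ n).
apply: le_trans (ler_wpM2l rho0 h1) _; rewrite !cmodM cmodX.
have h2 : cmod x * (rho * cmod (x ^+ n - y ^+ n)) <=
    rho * (n%:R * rho ^+ n * cmod (x - y)).
  by apply: ler_pM; rewrite ?cmod_ge0// mulr_ge0 ?cmod_ge0.
have h3 : rho * cmod (x - y) * cmod y ^+ n <= rho * cmod (x - y) * rho ^+ n.
  by rewrite ler_wpM2l ?mulr_ge0 ?cmod_ge0// lerXn2r ?nnegrE ?cmod_ge0.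
rewrite -natr1 exprS; move: h2 h3.
rewrite mulrCA; lra.
Qed.

(** By induction on the exponent; the factor [rho ^+ 2] is kept on the left so that
    no negative exponent and no division occurs. *)
Lemma pow_strict (rho d : R) (n : nat) x y h :
  cmod x <= rho -> cmod y <= rho -> cmod h <= rho ->
  cmod (x - h) <= d -> cmod (y - h) <= d ->
  rho ^+ 2 * cmod (x ^+ n.+1 - y ^+ n.+1 - n.+1%:R * h ^+ n * (x - y)) <=
  n.+1%:R ^+ 2 * rho ^+ n.+1 * d * cmod (x - y).
Proof.
move=> hx hy hh xd yd; have rho0 := le_trans (cmod_ge0 _) hx.
have d0 := le_trans (cmod_ge0 _) xd; have D0 := cmod_ge0 (x - y).
elim: n => [|n IH].
  rewrite !expr1 expr0 mulr1 mul1r subrr cmod0 mulr0.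
  by rewrite !mulr_ge0// exprn_ge0.
rewrite (_ : _ - _ = x * (x ^+ n.+1 - y ^+ n.+1 - n.+1%:R * h ^+ n * (x - y)) +
  (x - y) * (y ^+ n.+1 - h ^+ n.+1) + (x - h) * (n.+1%:R * h ^+ n) * (x - y)); last first.
  by rewrite -(natr1 n.+1) !exprS; ring.
have := cmodD (x * (x ^+ n.+1 - y ^+ n.+1 - n.+1%:R * h ^+ n * (x - y)) +
  (x - y) * (y ^+ n.+1 - h ^+ n.+1)) ((x - h) * (n.+1%:R * h ^+ n) * (x - y)).
have := cmodD (x * (x ^+ n.+1 - y ^+ n.+1 - n.+1%:R * h ^+ n * (x - y)))
  ((x - y) * (y ^+ n.+1 - h ^+ n.+1)).
rewrite !cmodM !cmodX.
have -> : cmod (n.+1%:R : R[i]) = n.+1%:R :> R.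
  by rewrite -(rmorph_nat (real_complex R)) cmod_real ger0_norm.
set T := cmod (_ - _ - _); set U := cmod (_ + _ + _) => h1 h2.
have h3 : U <= cmod x * T + cmod (x - y) * cmod (y ^+ n.+1 - h ^+ n.+1) +
    cmod (x - h) * (n.+1%:R * cmod h ^+ n) * cmod (x - y) by lra.
have r2 : 0 <= rho ^+ 2 by rewrite exprn_ge0.
apply: le_trans (ler_wpM2l r2 h3) _.
set N : R := n.+1%:R in IH *.
have N0 : 0 <= N by rewrite /N.
have e1 : cmod x * (rho ^+ 2 * T) <= rho * (N ^+ 2 * rho ^+ n.+1 * d * cmod (x - y)).
  by apply: ler_pM; rewrite ?cmod_ge0// mulr_ge0 ?cmod_ge0.
have e2 : rho * cmod (y ^+ n.+1 - h ^+ n.+1) <= N * rho ^+ n.+1 * d.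
  apply: le_trans (pow_lipschitz _ hy hh) _.
  by rewrite ler_wpM2l ?mulr_ge0 ?exprn_ge0.
have e3 : cmod (x - h) * (N * cmod h ^+ n) * cmod (x - y) <= d * (N * rho ^+ n) * cmod (x - y).
  rewrite ler_wpM2r//; apply: ler_pM => //; rewrite ?cmod_ge0 ?mulr_ge0 ?exprn_ge0 ?cmod_ge0//.
  by rewrite ler_wpM2l// lerXn2r ?nnegrE ?cmod_ge0.
have e2' : rho * cmod (x - y) * (rho * cmod (y ^+ n.+1 - h ^+ n.+1)) <=
  rho * cmod (x - y) * (N * rho ^+ n.+1 * d) by rewrite ler_wpM2l ?mulr_ge0.
have e3' := ler_wpM2l r2 e3.
rewrite -(natr1 n.+1) -/N.
have e4 : 0 <= d * rho ^+ n.+2 * cmod (x - y) by nonneg.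
move: e1 e2' e3' e4; rewrite !exprS expr0 !mulr1; lra.
Qed.

(** Termwise differentiation. The radius shrinks by [16 = 2 * 2 ^ 3]: the
    coefficients are bounded on the radius [r / 2], and of three factors [2^-n]
    two absorb the [n ^ 2] of [pow_strict] and one makes the series converge. *)
Lemma psum_derivative a z0 (r : R) f : 0 < r -> psum a z0 r f ->
  exists f1, psum (fun n => n.+1%:R * a n.+1) z0 (r / 16) f1 /\
    forall z, cmod (z - z0) < r / 16 -> sder f z (f1 z).
Proof.
move=> r0 hp; have [M M0 hM] := psum_coef_bound r0 hp.
set rho := r / 16; have rho0 : 0 < rho by rewrite /rho; lra.
have coef n : cmod (a n) * rho ^+ n * n%:R ^+ 2 <= M * 2^-1 ^+ n.
  rewrite (_ : rho = r / 2 * 2^-1 ^+ 3); last by rewrite /rho; field.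
  rewrite exprMn -exprM mulnC (_ : (n * 3 = n + n + n)%N); last by rewrite !mulnS muln0 addn0 addnA.
  rewrite !exprD.
  have -> : cmod (a n) * ((r / 2) ^+ n * (2^-1 ^+ n * 2^-1 ^+ n * 2^-1 ^+ n)) * n%:R ^+ 2 =
    (cmod (a n) * (r / 2) ^+ n) * ((n%:R * 2^-1 ^+ n) * (n%:R * 2^-1 ^+ n)) * 2^-1 ^+ n.
    by rewrite expr2; ring.
  have p0 : 0 <= 2^-1 ^+ n :> R by rewrite exprn_ge0.
  rewrite ler_wpM2r// -[leRHS]mulr1; apply: ler_pM => //; try nonneg.
  by rewrite -[leRHS]mulr1; apply: ler_pM; rewrite ?nat_pow2//; nonneg.
have cnat (n : nat) : cmod (n%:R : R[i]) = n%:R :> R.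
  by rewrite -(rmorph_nat (real_complex R)) cmod_real ger0_norm.
have ex z : exists l, cmod (z - z0) < rho ->
   tends (series (fun n => n.+1%:R * a n.+1 * (z - z0) ^+ n)) l.
  have [hz|hz] := ltP (cmod (z - z0)) rho; last by exists 0.
  have [|l hl] := @geometric_series_tends R
    (fun n => n.+1%:R * a n.+1 * (z - z0) ^+ n) (M / rho).
    move=> n; rewrite !cmodM cmodX cnat.
    apply: (@le_trans _ _ (n.+1%:R * cmod (a n.+1) * rho ^+ n)).
      rewrite ler_wpM2l ?mulr_ge0 ?cmod_ge0// lerXn2r ?nnegrE ?cmod_ge0//; exact: ltW.
    rewrite [leRHS]mulrAC ler_pdivlMr//; have := coef n.+1; rewrite exprS => h.
    have n1 : 1 <= n.+1%:R :> R by rewrite ler1n.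
    have p0 : 0 <= M * 2^-1 ^+ n by rewrite mulr_ge0// exprn_ge0.
    apply: (@le_trans _ _ (M * 2^-1 ^+ n.+1)); last by rewrite exprS; lra.
    apply: le_trans h; rewrite [leLHS](_ : _ = cmod (a n.+1) * (rho * rho ^+ n) * n.+1%:R); last by ring.
    rewrite ler_wpM2l ?mulr_ge0 ?cmod_ge0 ?exprn_ge0//; try exact: ltW.
    by rewrite expr2 ler_peMl.
  by exists l.
have [f1 hf1] := choice ex.
exists f1; split => // z hz e e0.
set D := rho - cmod (z - z0); have D0 : 0 < D by rewrite /D; lra.
set K := M / rho ^+ 2.
have K0 : 0 <= K by rewrite divr_ge0// exprn_ge0// ltW.
exists (Num.min D (e / (K + 1))) => [|x y]; first by rewrite lt_min D0 divr_gt0//; lra.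
rewrite !lt_min => /andP[x1 x2] /andP[y1 y2].
set d := e / (K + 1) in x2 y2.
have d0 : 0 <= d by apply: le_trans (cmod_ge0 _) (ltW x2).
have xr : cmod (x - z0) < rho.
  by have := cmod_tri z x z0; move: x1; rewrite /D; lra.
have yr : cmod (y - z0) < rho.
  by have := cmod_tri z y z0; move: y1; rewrite /D; lra.
have rr : rho < r by rewrite /rho; lra.
have sx := hp x (lt_trans xr rr); have sy := hp y (lt_trans yr rr).
have s1 := hf1 z hz.
have xy0 := cmod_ge0 (x - y).
have subz u v : u - z0 - (v - z0) = u - v by ring.
have key N : cmod (\sum_(0 <= n < N) (a n.+1 * (x - z0) ^+ n.+1 - a n.+1 * (y - z0) ^+ n.+1
   - (n.+1%:R * a n.+1 * (z - z0) ^+ n) * (x - y))) <= K * d * cmod (x - y) * (1 - 2^-1 ^+ N).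
  elim: N => [|N IH]; first by rewrite big_geq// cmod0 expr0 subrr mulr0.
  rewrite big_nat_recr//=; apply: le_trans (cmodD _ _) _.
  rewrite [X in _ + cmod X](_ : _ = a N.+1 * ((x - z0) ^+ N.+1 - (y - z0) ^+ N.+1 -
    N.+1%:R * (z - z0) ^+ N * ((x - z0) - (y - z0)))); last by ring.
  rewrite cmodM.
  have := @pow_strict rho d N (x - z0) (y - z0) (z - z0) (ltW xr) (ltW yr) (ltW hz).
  rewrite !subz.
  move=> /(_ (ltW x2) (ltW y2)); set T := cmod (_ - _ - _) => hT.
  have := coef N.+1 => hc.
  have h1 : cmod (a N.+1) * (rho ^+ 2 * T) <= M * 2^-1 ^+ N.+1 * (d * cmod (x - y)).
    apply: le_trans (ler_wpM2l (cmod_ge0 _) hT) _.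
    have := ler_wpM2r (mulr_ge0 d0 xy0) hc; lra.
  have h2 : cmod (a N.+1) * T <= K * 2^-1 ^+ N.+1 * (d * cmod (x - y)).
    rewrite /K -(ler_pM2l (exprn_gt0 2 rho0)).
    rewrite [leRHS](_ : _ = M * 2^-1 ^+ N.+1 * (d * cmod (x - y))).
      by apply: le_trans h1; rewrite mulrCA.
    by field; rewrite gt_eqF.
  have h3 : 2^-1 ^+ N.+1 = 2^-1 * 2^-1 ^+ N :> R by rewrite exprS.
  move: IH h2; rewrite h3; lra.
have lim : tends (fun N => \sum_(0 <= n < N) (a n.+1 * (x - z0) ^+ n.+1 - a n.+1 * (y - z0) ^+ n.+1
   - (n.+1%:R * a n.+1 * (z - z0) ^+ n) * (x - y))) (f x - f y - f1 z * (x - y)).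
  have hS : forall n, (n <= S n)%N by [].
  rewrite (mulrC (f1 z)).
  apply: (tends_eq _ (tendsB (tendsB (tends_sub hS sx) (tends_sub hS sy)) (tendsZ (x - y) s1))) => N /=.
  rewrite /series /= !sumrB !big_nat_recl//= !expr0 mulr_sumr.
    rewrite opprD addrACA subrr add0r; congr (_ - _).
    by apply: eq_bigr => i _; ring.
apply: (@le_trans _ _ (K * d * cmod (x - y))).
  apply: tends_mod_le lim _ => N; apply: le_trans (key N) _.
  have h1 : 0 <= 2^-1 ^+ N :> R by nonneg.
  have h2 : 0 <= K * d * cmod (x - y) by nonneg.
  by have := mulr_ge0 h2 h1; lra.
rewrite ler_wpM2r// /d mulrA ler_pdivrMr; last by lra.
lra.
Qed.

End PowerSeries.

(** * The maximum principle and the Schwarz lemma *)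

Section MaximumPrinciple.
Variable R : realType.
Implicit Types (x y z w : R[i]) (f g : R[i] -> R[i]) (a b : nat -> R[i]).

Lemma psum_center a z0 (r : R) f : 0 < r -> psum a z0 r f -> f z0 = a 0%N.
Proof.
move=> r0 /(_ z0); rewrite subrr cmod0 => /(_ r0) h.
apply: tends_unique h _ => e e0; exists 1%N => n n1.
rewrite (_ : series _ n = a 0%N) ?subrr ?cmod0// /series /=.
rewrite big_ltn// expr0 mulr1 big_nat_cond big1 ?addr0// => i.
by rewrite andbT => /andP[i0 _]; rewrite expr0n gtn_eqF ?mulr0.
Qed.

Lemma psumD a b z0 (r : R) f g : psum a z0 r f -> psum b z0 r g ->
  psum (fun n => a n + b n) z0 r (fun z => f z + g z).
Proof.
move=> ha hb z hz; apply: tends_eq (tendsD (ha z hz) (hb z hz)) => n.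
by rewrite /series /= -big_split; apply: eq_bigr => i _; rewrite mulrDl.
Qed.

Lemma psumZ a z0 (r : R) f c : psum a z0 r f ->
  psum (fun n => c * a n) z0 r (fun z => c * f z).
Proof.
move=> ha z hz; apply: tends_eq (tendsZ c (ha z hz)) => n.
by rewrite /series /= mulr_sumr; apply: eq_bigr => i _; rewrite mulrA.
Qed.

Lemma psum_mulX a z0 (r : R) f : psum a z0 r f ->
  psum (fun n => if n is m.+1 then a m else 0) z0 r (fun z => (z - z0) * f z).
Proof.
move=> ha z hz e e0.
have [N hN] := tendsZ (z - z0) (ha z hz) e0.
exists N.+1 => -[//|n] Nn; have := hN n Nn.
rewrite /series /= big_nat_recl//= mul0r add0r mulr_sumr.
rewrite (eq_bigr (fun i => a i * (z - z0) ^+ i.+1)) // => i _.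
by rewrite exprS mulrCA.
Qed.

Lemma psum_le a z0 (r r' : R) f : r' <= r -> psum a z0 r f -> psum a z0 r' f.
Proof. by move=> rr h z hz; apply: h; exact: lt_le_trans rr. Qed.

Lemma anaD f g z0 : ana f z0 -> ana g z0 -> ana (fun z => f z + g z) z0.
Proof.
move=> [r [a [r0 ha]]] [s [b [s0 hb]]].
exists (Num.min r s), (fun n => a n + b n); split; first by rewrite lt_min r0.
by apply: psumD; [apply: psum_le ha|apply: psum_le hb]; rewrite ge_min lexx ?orbT.
Qed.

Lemma anaZ f c z0 : ana f z0 -> ana (fun z => c * f z) z0.
Proof.
by move=> [r [a [r0 ha]]]; exists r, (fun n => c * a n); split=> //; exact: psumZ.
Qed.

Lemma ana_mulX f z0 : ana f z0 -> ana (fun z => z * f z) z0.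
Proof.
move=> hf.
rewrite (_ : (fun z => z * f z) = fun z => (z - z0) * f z + z0 * f z); last first.
  by apply/funext => z; rewrite -mulrDl subrK.
apply: anaD; last exact: anaZ.
by case: hf => r [a [r0 ha]]; exists r; eexists; split=> //; exact: psum_mulX ha.
Qed.

Lemma ana_sder f z0 : ana f z0 -> exists2 d : R, 0 < d &
  forall z, cmod (z - z0) < d -> sder f z ((f : R[i]^o -> R[i]^o)^`()%classic z).
Proof.
move=> [r [a [r0 ha]]]; have [f1 [_ h]] := psum_derivative r0 ha.
by exists (r / 16) => [|z hz]; [lra|rewrite (sder_derive1 (h z hz)); exact: h].
Qed.

Lemma ana_derive f z0 : ana f z0 -> ana (f : R[i]^o -> R[i]^o)^`()%classic z0.
Proof.
move=> [r [a [r0 ha]]]; have [f1 [h1 h]] := psum_derivative r0 ha.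
exists (r / 16), (fun n => n.+1%:R * a n.+1); split; first by lra.
by move=> z hz; rewrite (sder_derive1 (h z hz)); exact: h1.
Qed.

(** Each step divides by [z - z0] and gives the quotient its limit [a m.+1] as
    value at [z0]. *)
Lemma psum_factor a z0 (r : R) f m : 0 < r -> psum a z0 r f ->
  (forall i, (i < m)%N -> a i = 0) ->
  exists2 g, psum (fun n => a (m + n)%N) z0 r g &
    forall z, cmod (z - z0) < r -> f z = (z - z0) ^+ m * g z.
Proof.
move=> r0 hf; elim: m => [|m IH] ha.
  by exists f => // z _; rewrite expr0 mul1r.
have [|g hg fg] := IH; first by move=> i im; apply: ha; exact: ltnW.
have g0 : g z0 = 0 by rewrite (psum_center r0 hg) addn0 ha.
exists (fun z => if z == z0 then a m.+1 else g z / (z - z0)) => [z hz|z hz].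
  have [->|zz0] := eqVneq z z0.
    move=> e e0; exists 1%N => n n1.
    rewrite (_ : series _ n = a m.+1) ?subrr ?cmod0// /series /=.
    rewrite big_ltn// expr0 mulr1 addn0 big_nat_cond big1 ?addr0// => i.
    by rewrite andbT => /andP[i0 _]; rewrite expr0n gtn_eqF ?mulr0.
  have zz : z - z0 != 0 by rewrite subr_eq0.
  have := tends_sub (fun n => leqnSn n) (tendsZ (z - z0)^-1 (hg z hz)).
  rewrite mulrC; apply: tends_eq => n /=; rewrite /series /=.
  rewrite big_nat_recl//= addn0 ha// mul0r add0r mulr_sumr.
  by apply: eq_bigr => i _; rewrite exprS addnS; field.
rewrite fg// exprSr; case: eqVneq => [->|zz0].
  by rewrite g0 subrr !mulr0 mul0r.
by rewrite -mulrA; congr (_ * _); field; rewrite subr_eq0.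
Qed.

Lemma croot (m : nat) (c : R[i]) : (0 < m)%N -> exists e, e ^+ m = c.
Proof.
move=> m0; have [e he] := @solve_monicpoly R[i] m (fun i => if i == 0%N then c else 0) m0.
exists e; rewrite he; case: m m0 {he} => // m _.
rewrite big_ord_recl/= expr0 mulr1 big1 ?addr0// => i _.
by rewrite /= mul0r.
Qed.

(** The maximum principle for a quotient [f] of [g] by [h]. If [g - f z0 * h]
    vanished at [z0] to a finite order [m], some direction [e] would make the
    leading term of [f (z0 + t e) - f z0] a positive multiple [t ^ m] of [f z0]
    (of [1] if [f z0 = 0]), and [|f|] would increase along it. *)
Lemma local_max_constant f g h z0 : ana g z0 -> ana h z0 -> h z0 != 0 ->
  (exists2 d : R, 0 < d & forall z, cmod (z - z0) < d ->
     h z * f z = g z /\ cmod (f z) <= cmod (f z0)) ->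
  exists2 d : R, 0 < d & forall z, cmod (z - z0) < d -> f z = f z0.
Proof.
move=> hg hh h0 [d d0 hd].
have [dh dh0 shd] := ana_sder hh.
have hsh := shd z0; rewrite subrr cmod0 in hsh; have {shd} hc := sder_cont (hsh dh0).
have hz0 : 0 < cmod (h z0) by rewrite cmod_gt0.
have [d1 d10 hd1] : exists2 d1 : R, 0 < d1 & forall z, cmod (z - z0) < d1 -> h z != 0.
  have [d1 d10 h1] := hc _ hz0; exists d1 => // z /h1 hz.
  by apply: contraTneq hz => ->; rewrite sub0r cmodN ltxx.
have : ana (fun z => g z + - f z0 * h z) z0 by apply: anaD => //; exact: anaZ.
move=> [r [b [r0 hb]]].
have PE z : cmod (z - z0) < d -> g z + - f z0 * h z = h z * (f z - f z0).
  by move=> /hd[<- _]; rewrite mulrBr mulNr (mulrC (f z0)).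
have [b0|] := pselect (forall n, b n = 0).
  exists (Num.min (Num.min d d1) r); first by rewrite !lt_min d0 d10 r0.
  move=> z; rewrite !lt_min => /andP[/andP[z1 z2] z3].
  have : g z + - f z0 * h z = 0.
    apply: tends_unique (hb z z3) _; apply: tends_eq (tends_cst 0) => n.
    by rewrite /series /= big1// => i _; rewrite b0 mul0r.
  rewrite PE// => /eqP; rewrite mulf_eq0 (negPf (hd1 _ z2))/= subr_eq0.
  by move/eqP.
move=> /existsNP[n0 /eqP bn0].
have exb : exists n, b n != 0 by exists n0.
have [m bm mmin] := ex_minnP exb.
have bi i : (i < m)%N -> b i = 0.
  by move=> im; apply/eqP; apply: contraTT im => /mmin; rewrite -leqNgt.
have [k hk Pk] := psum_factor r0 hb bi.
have km : k z0 = b m by rewrite (psum_center r0 hk) addn0.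
have m0 : (0 < m)%N.
  rewrite lt0n; apply: contraNneq bm => m0; rewrite -km.
  have := Pk z0; rewrite subrr cmod0 => /(_ r0).
  by rewrite PE ?subrr ?cmod0// m0 expr0 mul1r mulr0 => <-.
have [dk dk0 skd] : exists2 d : R, 0 < d & forall z, cmod (z - z0) < d ->
    sder k z ((k : R[i]^o -> R[i]^o)^`()%classic z).
  by apply: ana_sder; eexists; eexists; split; [exact: r0|exact: hk].
have ksd := skd z0; rewrite subrr cmod0 in ksd; have {skd} kc := sder_cont (ksd dk0).
set tau := if f z0 == 0 then 1 else f z0.
have tau0 : 0 < cmod tau.
  by rewrite /tau cmod_gt0; have [_|//] := eqVneq (f z0) 0; rewrite oner_neq0.
have tauP (t : R) : 0 <= t -> cmod (f z0 + t%:C * tau) = cmod (f z0) + t * cmod tau.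
  move=> t0; rewrite /tau; have [->|_] := eqVneq (f z0) 0.
    by rewrite add0r cmod0 add0r cmodM cmod_real ger0_norm.
  rewrite -{1}[f z0]mul1r -mulrDl cmodM -(rmorph1 (real_complex R)) -rmorphD.
  by rewrite cmod_real ger0_norm ?addr_ge0//= mulrDl mul1r.
have [e he] := croot (tau * h z0 / b m) m0.
have e0 : 0 < cmod e.
  rewrite cmod_gt0; apply: contraTneq isT => e0.
  move: he; rewrite e0 expr0n gtn_eqF//= => /esym/eqP.
  by rewrite mulf_eq0 invr_eq0 (negPf bm) orbF mulf_eq0 (negPf h0) orbF -cmod_eq0 gt_eqF.
(* |k - b m| and |h - h z0| are to be so small that e^m k / h stays close to tau *)
set T := cmod tau * cmod (h z0) / 4.
have T0 : 0 < T by rewrite /T !mulr_gt0.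
have Em0 : 0 < cmod e ^+ m by rewrite exprn_gt0.
have TE0 : 0 < T / cmod e ^+ m by rewrite divr_gt0.
have [d2 d20 hd2] := kc _ TE0.
have Ht0 : 0 < T / cmod tau by rewrite divr_gt0.
have [d3 d30 hd3] := hc _ Ht0.
set D := Num.min (Num.min (Num.min d d1) r) (Num.min d2 d3).
have D0 : 0 < D by rewrite /D !lt_min d0 d10 r0 d20 d30.
set t := D / cmod e / 2.
have t0 : 0 < t by rewrite /t !divr_gt0.
set z := z0 + t%:C * e.
have zD : cmod (z - z0) < D.
  rewrite /z addrC addKr cmodM cmod_real ger0_norm ?ltW//.
  by rewrite /t mulrAC divfK ?gt_eqF//; lra.
move: (zD); rewrite /D !lt_min => /andP[/andP[/andP[z1 z2] z3] /andP[z4 z5]].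
have hz := hd1 _ z2; have hz' : 0 < cmod (h z) by rewrite cmod_gt0.
have eq1 : h z * (f z - f z0) = t%:C ^+ m * (e ^+ m * k z).
  by rewrite -PE// Pk// /z addrC addKr exprMn mulrA.
have [_ le1] := hd _ z1.
have tm0 : 0 < t ^+ m by rewrite exprn_gt0.
have eq2 : h z * (f z0 + (t ^+ m)%:C * tau) = h z * f z +
   (t ^+ m)%:C * (tau * (h z - h z0) - e ^+ m * (k z - b m)).
  have ez : h z * f z = h z * f z0 + (t ^+ m)%:C * (e ^+ m * k z).
    by rewrite rmorphXn/= -eq1; ring.
  have -> : e ^+ m * (k z - b m) = e ^+ m * k z - tau * h z0.
    by rewrite mulrBr; congr (_ - _); rewrite he; field.
  by rewrite ez; ring.
have := congr1 (@cmod R) eq2.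
rewrite cmodM tauP ?ltW// => eq3.
have := cmodD (h z * f z) ((t ^+ m)%:C * (tau * (h z - h z0) - e ^+ m * (k z - b m))).
rewrite -eq3 !cmodM cmod_real ger0_norm; last exact: ltW.
have := cmodB (tau * (h z - h z0)) (e ^+ m * (k z - b m)).
rewrite !cmodM cmodX.
have b1 : cmod tau * cmod (h z - h z0) <= T.
  by have := ltW (hd3 _ z5); rewrite ler_pdivlMr// mulrC.
have b2 : cmod e ^+ m * cmod (k z - b m) <= T.
  by have := ltW (hd2 _ z4); rewrite km ler_pdivlMr// mulrC.
have b3 : cmod (h z0) * (3 / 4) <= cmod (h z).
  have := hd3 _ z5; have := cmod_subl (h z0) (h z); rewrite cmodC /T.
  rewrite (_ : cmod tau * cmod (h z0) / 4 / cmod tau = cmod (h z0) / 4); first by lra.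
  by field; rewrite gt_eqF.
set X := cmod (tau * _ - _) => h1 h2.
have X2 : X <= 2 * T by lra.
have b4 := ler_wpM2l (cmod_ge0 (h z)) le1.
have b5 := ler_wpM2l (ltW tm0) X2.
have b6 : cmod tau * (cmod (h z0) * (3 / 4)) <= cmod tau * cmod (h z).
  by rewrite ler_wpM2l// ltW.
have b7 : t ^+ m * (3 * T) <= t ^+ m * (cmod tau * cmod (h z)).
  apply: ler_wpM2l; first exact: ltW.
  by apply: le_trans b6; rewrite /T; lra.
have b8 : 0 < t ^+ m * T by rewrite mulr_gt0.
by exfalso; lra.
Qed.

Definition seqcompact (K : R[i] -> Prop) := forall u : nat -> R[i],
  (forall n, K (u n)) -> exists2 phi : nat -> nat, (forall n, (n <= phi n)%N) &
    exists2 l, K l & tends (u \o phi) l.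

Lemma seqcompact_max (K : R[i] -> Prop) (phi : R[i] -> R) : seqcompact K ->
  (forall u l, (forall n, K (u n)) -> K l -> tends u l ->
     tends (fun n => (phi (u n))%:C) (phi l)%:C) ->
  (exists z, K z) -> exists2 z, K z & forall w, K w -> phi w <= phi z.
Proof.
move=> cK cphi [z0 Kz0].
set E := [set phi z | z in K].
have E0 : E !=set0 by exists (phi z0), z0.
have ubE : has_ubound E.
  apply: contrapT => nE.
  have hn n : exists z, K z /\ n%:R < phi z.
    apply: contrapT => h; apply: nE; exists n%:R => _ [z Kz <-].
    by rewrite leNgt; apply/negP => nz; apply: h; exists z.
  have [u hu] := choice hn.
  have [|psi hpsi [l Kl hl]] := cK u; first by move=> n; exact: (hu n).1.
  have [|N hN] := cphi _ _ _ Kl hl 1 ltr01; first by move=> n; exact: (hu _).1.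
  have [M hM] : exists M : nat, phi l + 1 < M%:R by exists (Num.truncn (phi l + 1)).+1; exact: truncnS_gt.
  have := hN (maxn N M) (leq_maxl _ _); rewrite -rmorphB cmod_real /=.
  have := (hu (psi (maxn N M))).2.
  have : M%:R <= (psi (maxn N M))%:R :> R.
    by rewrite ler_nat (leq_trans (leq_maxr N M)).
  by rewrite ltr_norml => h1 h2 /andP[h3 h4]; lra.
have hsE : has_sup E by split.
have hn n : exists z, K z /\ sup E - n.+1%:R^-1 < phi z.
  have n0 : 0 < n.+1%:R^-1 :> R by rewrite invr_gt0.
  by have [_ [z Kz <-] hz] := sup_adherent n0 hsE; exists z.
have [u hu] := choice hn.
have [|psi hpsi [l Kl hl]] := cK u; first by move=> n; exact: (hu n).1.
exists l => // w Kw.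
apply: (@le_trans _ _ (sup E)); first by apply: (ub_le_sup ubE); exists w.
apply/ler_addgt0Pr => e e0; have e2 : 0 < e / 2 by lra.
have [|N hN] := cphi _ _ _ Kl hl _ e2; first by move=> n; exact: (hu _).1.
have [M hM] : exists M : nat, M.+1%:R^-1 < e / 2 :> R.
  exists (Num.truncn (e / 2)^-1); rewrite -[ltRHS]invrK ltf_pV2 ?posrE ?invr_gt0//.
  exact: truncnS_gt.
have := hN (maxn N M) (leq_maxl _ _); rewrite -rmorphB cmod_real /=.
have := (hu (psi (maxn N M))).2.
have : (psi (maxn N M)).+1%:R^-1 <= M.+1%:R^-1 :> R.
  by rewrite lef_pV2 ?posrE// ler_nat ltnS (leq_trans (leq_maxr N M)).
move: hM; set A := M.+1%:R^-1; set B := (psi _).+1%:R^-1; move: A B => A B hM.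
by rewrite ltr_norml => h1 h2 /andP[h3 h4]; lra.
Qed.

Lemma seqcompact_disc (r : R) : seqcompact (fun z => cmod z <= r).
Proof.
move=> u hu; have [phi hphi [l hl]] := bounded_subseq hu.
by exists phi => //; exists l => //; apply: tends_mod_le hl _ => n; exact: hu.
Qed.

Lemma tends_cmod (u : nat -> R[i]) l : tends u l ->
  tends (fun n => (cmod (u n))%:C) (cmod l)%:C.
Proof.
move=> hu e /hu[N hN]; exists N => n /hN h.
rewrite -rmorphB cmod_real; apply: le_lt_trans h.
by rewrite ler_norml cmod_subl andbT lerNl opprB (cmodC (u n)) cmod_subl.
Qed.

(** Quotients of analytic functions, for which no power series of [f] is needed:
    the maximum principle only uses that of [g - f z0 * h]. *)
Definition local_quotient f z0 := exists g h, [/\ ana g z0, ana h z0, h z0 != 0 &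
  exists2 d : R, 0 < d & forall z, cmod (z - z0) < d -> h z * f z = g z].

Lemma local_quotient_tends f z0 (u : nat -> R[i]) : local_quotient f z0 ->
  tends u z0 -> tends (fun n => f (u n)) (f z0).
Proof.
move=> [g [h [hg hh h0 [d d0 hd]]]] hu.
have [d1 d10 sg] := ana_sder hg; have [d2 d20 sh] := ana_sder hh.
have sg0 := sg z0; rewrite subrr cmod0 in sg0; have tg := sder_tends (sg0 d10) hu.
have sh0 := sh z0; rewrite subrr cmod0 in sh0; have th := sder_tends (sh0 d20) hu.
have hz : 0 < cmod (h z0) by rewrite cmod_gt0.
(* h (f u - f z0) = (g u - g z0) - (h u - h z0) f z0, and |h u| >= |h z0| / 2 *)
have t0 : tends (fun n => g (u n) - f z0 * h (u n)) 0.
  rewrite -[0](subrr (g z0)) -{2}(hd z0) ?subrr ?cmod0// mulrC.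
  by apply: tendsB => //; exact: tendsZ.
move=> e e0.
have e1 : 0 < e * (cmod (h z0) / 2) by rewrite !mulr_gt0.
have [N1 hN1] := t0 _ e1.
have h2 : 0 < cmod (h z0) / 2 by lra.
have [N2 hN2] := th _ h2; have [N3 hN3] := hu _ d0.
exists (maxn N1 (maxn N2 N3)) => n; rewrite !geq_max => /and3P[n1 n2 n3].
have := hN1 _ n1; rewrite subr0 -(hd _ (hN3 _ n3)) (mulrC (f z0)) -mulrBr cmodM.
have := hN2 _ n2; have := cmod_subl (h z0) (h (u n)); rewrite (cmodC (h z0)) => h3 h4 h5.
have h6 : cmod (h z0) / 2 < cmod (h (u n)) by lra.
rewrite ltNge; apply/negP => h7.
have : e * (cmod (h z0) / 2) <= cmod (h (u n)) * cmod (f (u n) - f z0).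
  by rewrite mulrC; apply: ler_pM => //; [lra|nonneg|exact: ltW].
lra.
Qed.

(** Schwarz: the bound [|z|^-2] holds with the value [r^-2] inside the circle
    [|z| = r], and [r] tends to [1]. Indeed, among the points of the closed disc
    of radius [r] at which [|f|] is maximal, one of largest modulus lies on the
    circle, because [f] is constant near an interior one. *)
Lemma schwarz f : (forall z, cmod z < 1 -> local_quotient f z) ->
  (forall z, cmod z < 1 -> cmod z ^+ 2 * cmod (f z) <= 1) ->
  forall z, cmod z < 1 -> cmod (f z) <= 1.
Proof.
move=> lq bnd z1 z11.
have key (r : R) : cmod z1 <= r -> r < 1 -> r ^+ 2 * cmod (f z1) <= 1.
  move=> z1r r1; have r0 : 0 <= r := le_trans (cmod_ge0 _) z1r.
  pose K z := cmod z <= r.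
  have fc (u : nat -> R[i]) l : K l -> tends u l ->
      tends (fun n => (cmod (f (u n)))%:C) (cmod (f l))%:C.
    move=> Kl hu; apply: tends_cmod; apply: local_quotient_tends => //.
    by apply: lq; exact: le_lt_trans r1.
  have [||z2 Kz2 max2] := @seqcompact_max K (fun z => cmod (f z)) (@seqcompact_disc r).
  - by move=> u l _; exact: fc.
  - by exists z1.
  pose K' z := K z /\ cmod (f z) = cmod (f z2).
  have [|||z [Kz fz] max3] := @seqcompact_max K' (@cmod R).
  - move=> u hu; have [|phi hphi [l Kl hl]] := @seqcompact_disc r u.
      by move=> n; exact: (hu n).1.
    exists phi => //; exists l => //; split=> //; apply: complexI.
    apply: tends_unique (fc _ _ Kl hl) _.
    by apply: tends_eq (tends_cst _) => n /=; rewrite (hu _).2.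
  - by move=> u l _ _; exact: tends_cmod.
  - by exists z2.
  have [zr|zr] := ltP (cmod z) r; last first.
    have := bnd z (le_lt_trans Kz r1); rewrite fz => h.
    apply: le_trans h; apply: ler_pM; rewrite ?exprn_ge0 ?cmod_ge0//.
      by rewrite lerXn2r ?nnegrE ?cmod_ge0.
    exact: max2.
  have [g [h [hg hh h0 [d d0 hd]]]] := lq z (lt_trans zr r1).
  have [|d' d'0 cst] := @local_max_constant f g h z hg hh h0.
    exists (Num.min d (r - cmod z)); first by rewrite lt_min d0 subr_gt0.
    move=> w; rewrite lt_min => /andP[/hd hw wr]; split=> //; rewrite fz.
    by apply: max2; rewrite /K; have := cmod_subl w z; lra.
  set e := if z == 0 then 1 else z / (cmod z)%:C.
  have [e1 ze] : cmod e = 1 /\ z = (cmod z)%:C * e.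
    rewrite /e; case: eqVneq => [->|z0]; first by rewrite cmod1 cmod0 mul0r.
    have cz : 0 < cmod z by rewrite cmod_gt0.
    split; first by rewrite cmodM cmodV cmod_real ger0_norm ?ltW// divff ?gt_eqF.
    by rewrite mulrC divfK// -cmod_eq0 cmod_real normr_eq0 gt_eqF.
  set t := Num.min (d' / 2) (r - cmod z).
  have t0 : 0 < t by rewrite /t lt_min subr_gt0 zr andbT; lra.
  set w := (cmod z + t)%:C * e.
  have cw : cmod w = cmod z + t.
    by rewrite /w cmodM e1 mulr1 cmod_real ger0_norm// addr_ge0 ?cmod_ge0// ltW.
  have wz : cmod (w - z) < d'.
    rewrite {1}ze -mulrBl -rmorphB addrC addKr cmodM e1 mulr1 cmod_real ger0_norm ?ltW//.
    have : t <= d' / 2 by rewrite /t ge_min lexx.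
    lra.
  have : cmod w <= cmod z.
    apply: max3; split; last by rewrite cst.
    have : t <= r - cmod z by rewrite /t ge_min lexx orbT.
    by rewrite /K cw; lra.
  by rewrite cw; lra.
rewrite leNgt; apply/negP => f1.
set F := cmod (f z1) in f1 *.
set r := Num.max (cmod z1) (1 - (F - 1) / (4 * F)).
have q0 : 0 < (F - 1) / (4 * F) by rewrite divr_gt0; lra.
have r1 : r < 1 by rewrite /r gt_max z11 /=; lra.
have h1 : cmod z1 <= r by rewrite /r le_max lexx.
have := key r h1 r1; rewrite -/F.
have h2 : 1 - (F - 1) / (4 * F) <= r by rewrite /r le_max lexx orbT.
have : (F - 1) / (4 * F) * (4 * F) = F - 1 by rewrite divfK// gt_eqF//; lra.
move: h2 q0; set q := _ / _ => h2 q0 qF h3.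
have h4 : 1 - 2 * q <= r ^+ 2.
  have h5 := cmod_ge0 z1; rewrite expr2.
  have := sqr_ge0 (r - 1); rewrite expr2; lra.
have : (1 - 2 * q) * F <= r ^+ 2 * F by rewrite ler_wpM2r// /F cmod_ge0.
lra.
Qed.

End MaximumPrinciple.

(** * Solving a one-parameter family of holomorphic equations *)

Section ImplicitFunction.
Variable R : realType.
Implicit Types (x y z w v : R[i]) (f g h phi psi : R[i] -> R[i]).

Lemma tendsM (u v : nat -> R[i]) a b : tends u a -> tends v b ->
  tends (fun n => u n * v n) (a * b).
Proof.
move=> hu hv; have [M hM] := tends_bounded hv.
have M0 : 0 <= M := le_trans (cmod_ge0 _) (hM 0%N).
move=> e e0.
have e1 : 0 < e / 2 / (M + 1) by rewrite !divr_gt0//; lra.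
have a0 := cmod_ge0 a.
have e2 : 0 < e / 2 / (cmod a + 1) by rewrite !divr_gt0//; lra.
have [N hN] := hu _ e1; have [N' hN'] := hv _ e2.
exists (maxn N N') => n; rewrite geq_max => /andP[/hN h1 /hN' h2].
rewrite (_ : _ - _ = (u n - a) * v n + a * (v n - b)); last by ring.
apply: le_lt_trans (cmodD _ _) _; rewrite !cmodM.
have h3 : cmod (u n - a) * cmod (v n) <= e / 2 / (M + 1) * M.
  by apply: ler_pM; rewrite ?cmod_ge0// ltW.
have h4 : cmod a * cmod (v n - b) <= cmod a * (e / 2 / (cmod a + 1)).
  by rewrite ler_wpM2l// ltW.
have h5 : e / 2 / (M + 1) * (M + 1) = e / 2 by rewrite divfK// gt_eqF//; lra.
have h6 : e / 2 / (cmod a + 1) * (cmod a + 1) = e / 2 by rewrite divfK// gt_eqF//; lra.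
lra.
Qed.

(** Newton's iteration with the frozen derivative [a]. The last bound compares the
    solution with the first iterate: it is what gives solutions that depend on a
    parameter their velocity. *)
Lemma newton_solve h v a w (rho eta : R) : a != 0 -> 0 <= eta <= 1 / 2 ->
  (forall x y, cmod (x - v) < rho -> cmod (y - v) < rho ->
     cmod (h x - h y - a * (x - y)) <= eta * cmod a * cmod (x - y)) ->
  2 * (cmod (w - h v) / cmod a) < rho ->
  exists x, [/\ h x = w, cmod (x - v) <= 2 * (cmod (w - h v) / cmod a) &
    cmod (x - v - (w - h v) / a) <= 2 * eta * (cmod (w - h v) / cmod a)].
Proof.
move=> a0 /andP[eta0 eta1] hl; set d := _ / _ => drho.
have ca : 0 < cmod a by rewrite cmod_gt0.
have d0 : 0 <= d by rewrite /d; nonneg.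
pose u := fix u n := if n is m.+1 then u m + (w - h (u m)) / a else v.
have step n : u n.+1 - u n = (w - h (u n)) / a by rewrite /= addrC addKr.
have inv n : cmod (u n.+1 - u n) <= d * 2^-1 ^+ n /\
    cmod (u n - v) <= 2 * d * (1 - 2^-1 ^+ n).
  elim: n => [|n [IH1 IH2]].
    by rewrite step subrr cmod0 cmodM cmodV expr0 subrr mulr0 mulr1.
  have p0 : 0 < 2^-1 ^+ n :> R by rewrite exprn_gt0.
  have dp0 : 0 <= d * 2^-1 ^+ n by nonneg.
  have IH3 : cmod (u n.+1 - v) <= 2 * d * (1 - 2^-1 ^+ n.+1).
    by have := cmod_tri (u n) (u n.+1) v; rewrite exprS; lra.
  split=> //.
  have b1 : cmod (u n - v) < rho by lra.
  have b2 : cmod (u n.+1 - v) < rho.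
    by have : 0 <= d * 2^-1 ^+ n.+1 by [nonneg]; lra.
  rewrite step.
  have -> : w - h (u n.+1) = - (h (u n.+1) - h (u n) - a * (u n.+1 - u n)).
    by rewrite step; field.
  rewrite cmodM cmodN cmodV ler_pdivrMr//; apply: le_trans (hl _ _ b2 b1) _.
  rewrite exprS.
  have : eta * cmod (u n.+1 - u n) <= 1 / 2 * (d * 2^-1 ^+ n).
    by apply: ler_pM => //; exact: cmod_ge0.
  by move=> /(ler_wpM2r (ltW ca)); lra.
have [l hl1] := geometric_series_tends (fun n => (inv n).1).
have hx : tends u (v + l).
  apply: tends_eq (tendsD (tends_cst v) hl1) => n.
  by rewrite /series /= telescope_sumr// addrC subrK.
set x := v + l in hx.
have xv : cmod (x - v) <= 2 * d.
  apply: (tends_le hx) => n; apply: le_trans (inv n).2 _.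
  by have : 0 <= d * 2^-1 ^+ n by [nonneg]; lra.
have xr : cmod (x - v) < rho by lra.
have lim1 : tends (fun n => h (u n)) (h x).
  move=> e e0; have e1 : 0 < e / ((eta + 1) * cmod a) by rewrite divr_gt0// mulr_gt0//; lra.
  have [N hN] := hx _ e1; exists N => n /hN.
  rewrite ltr_pdivlMr; last by rewrite mulr_gt0//; lra.
  have un : cmod (u n - v) < rho.
    by have := (inv n).2; have : 0 <= d * 2^-1 ^+ n by [nonneg]; lra.
  have := hl _ _ un xr; have := cmod_subl (h (u n) - h x) (a * (u n - x)).
  by rewrite cmodM; lra.
have lim2 : tends (fun n => h (u n)) w.
  have := tendsB (tends_cst w) (tendsZ a (tendsB (tends_sub leqnSn hx) hx)).
  rewrite subrr mulr0 subr0; apply: tends_eq => n.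
  by rewrite [(u \o succn) n - _]step; field.
exists x; split=> //; first exact: tends_unique lim1 lim2.
have vr : cmod (v - v) < rho by rewrite subrr cmod0; lra.
have := hl _ _ xr vr; rewrite (tends_unique lim1 lim2) => key.
rewrite (_ : _ - _ = - ((w - h v - a * (x - v)) / a)); last by field.
rewrite cmodN cmodM cmodV ler_pdivrMr//; apply: le_trans key _.
by have := ler_wpM2l (mulr_ge0 eta0 (ltW ca)) xv; lra.
Qed.

(** The strict derivative of [phi + s * psi] is uniform in the parameter [s] near
    [s0], so that solutions exist and are unique on a neighbourhood that does not
    depend on [s]. *)
Lemma param_strict phi psi v al be s0 : sder phi v al -> sder psi v be ->
  forall e : R, 0 < e -> exists2 d : R, 0 < d & forall s x y,
    cmod (s - s0) < d -> cmod (x - v) < d -> cmod (y - v) < d ->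
    cmod ((phi x + s * psi x) - (phi y + s * psi y) - (al + s0 * be) * (x - y)) <=
      e * cmod (x - y).
Proof.
move=> hphi hpsi e e0; have e3 : 0 < e / 3 by lra.
have [d1 d10 h1] := hphi _ e3.
set A := cmod s0 + 1; have A0 : 0 < A by rewrite /A; have := cmod_ge0 s0; lra.
have eA : 0 < e / 3 / A by rewrite divr_gt0.
have [d2 d20 h2] := hpsi _ eA.
set B := cmod be + 1; have B0 : 0 < B by rewrite /B; have := cmod_ge0 be; lra.
exists (Num.min (Num.min d1 d2) (Num.min 1 (e / 3 / B))) => [|s x y].
  by rewrite !lt_min d10 d20 ltr01 divr_gt0.
rewrite !lt_min => /andP[_ /andP[s1 s2]] /andP[/andP[x1 x2] _] /andP[/andP[y1 y2] _].
rewrite (_ : _ - _ - _ = (phi x - phi y - al * (x - y)) +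
  s * (psi x - psi y - be * (x - y)) + (s - s0) * be * (x - y)); last by ring.
apply: le_trans (cmodD3 _ _ _) _; rewrite !cmodM.
have t1 := h1 _ _ x1 y1; have t2 := h2 _ _ x2 y2; have D0 := cmod_ge0 (x - y).
have sA : cmod s <= A by rewrite /A; have := cmod_subl s s0; lra.
have t3 : cmod s * cmod (psi x - psi y - be * (x - y)) <= A * (e / 3 / A * cmod (x - y)).
  by apply: ler_pM; rewrite ?cmod_ge0.
have e4 : A * (e / 3 / A * cmod (x - y)) = e / 3 * cmod (x - y) by field; rewrite gt_eqF.
have t5 : cmod (s - s0) * cmod be * cmod (x - y) <= e / 3 / B * B * cmod (x - y).
  by rewrite ler_wpM2r//; apply: ler_pM; rewrite ?cmod_ge0//; [exact: ltW|rewrite /B lerDl].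
rewrite divfK ?gt_eqF// in t5; lra.
Qed.

Lemma param_injective phi psi v al be s0 : sder phi v al -> sder psi v be ->
  al + s0 * be != 0 ->
  exists2 d : R, 0 < d & forall s x y,
    cmod (s - s0) < d -> cmod (x - v) < d -> cmod (y - v) < d ->
    phi x + s * psi x = phi y + s * psi y -> x = y.
Proof.
move=> hphi hpsi a0; have ca : 0 < cmod (al + s0 * be) by rewrite cmod_gt0.
have e0 : 0 < cmod (al + s0 * be) / 2 by lra.
have [d d0 hd] := param_strict s0 hphi hpsi e0; exists d => // s x y ss xv yv eq.
have := hd _ _ _ ss xv yv; rewrite eq subrr sub0r cmodN cmodM => h.
apply/eqP; rewrite -subr_eq0 -cmod_eq0 eq_le cmod_ge0 andbT leNgt; apply/negP => xy.
by have := mulr_gt0 ca xy; lra.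
Qed.

Lemma param_solve phi psi v al be s0 : sder phi v al -> sder psi v be ->
  al + s0 * be != 0 -> forall eta : R, 0 < eta ->
  exists2 d : R, 0 < d & forall s, cmod (s - s0) < d ->
    exists2 x, phi x + s * psi x = phi v + s0 * psi v &
      cmod (x - v + (s - s0) * psi v / (al + s0 * be)) <= eta * cmod (s - s0).
Proof.
set a := al + s0 * be => hphi hpsi a0 eta eta0.
have ca : 0 < cmod a by rewrite cmod_gt0.
set P := cmod (psi v) + 1; have P0 : 0 < P by rewrite /P; have := cmod_ge0 (psi v); lra.
set eta' := Num.min (1 / 2) (eta * cmod a / (2 * P)).
have eta'0 : 0 < eta'.
  rewrite lt_min; apply/andP; split; first by lra.
  by rewrite divr_gt0// mulr_gt0.
have eta'1 : eta' <= 1 / 2 by rewrite ge_min lexx.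
have eta'2 : eta' <= eta * cmod a / (2 * P) by rewrite ge_min lexx orbT.
have ea : 0 < eta' * cmod a by rewrite mulr_gt0.
have [d d0 hd] := param_strict s0 hphi hpsi ea.
exists (Num.min d (d * cmod a / (2 * P))) => [|s].
  by rewrite lt_min d0 divr_gt0// mulr_gt0.
rewrite lt_min => /andP[sd]; rewrite ltr_pdivlMr; last by rewrite mulr_gt0.
move=> sd2; have ss0 := cmod_ge0 (s - s0).
pose h x := phi x + s * psi x.
have E : phi v + s0 * psi v - h v = - ((s - s0) * psi v) by rewrite /h; ring.
have psiP : cmod (psi v) <= P by rewrite /P lerDl.
have sP : cmod (s - s0) * cmod (psi v) <= cmod (s - s0) * P by rewrite ler_wpM2l.
have [|||x [x1 x2 x3]] := @newton_solve h v a (phi v + s0 * psi v) d eta' a0.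
- by rewrite ltW.
- by move=> x y xv yv; exact: hd.
- rewrite E cmodN cmodM mulrA ltr_pdivrMr//; lra.
exists x => //; move: x3; rewrite E cmodN mulNr opprK => x3.
apply: le_trans x3 _; rewrite cmodM.
have h1 : eta' * (2 * P) <= eta * cmod a by rewrite -ler_pdivlMr// mulr_gt0.
rewrite mulrA ler_pdivrMr//.
have h2 := ler_wpM2l ss0 h1.
have h3 := ler_wpM2l (ltW eta'0) sP.
lra.
Qed.

(** This replaces the flow of a differential equation: local existence provides the
    step to the right, and compactness the passage to the limit. *)
Lemma real_induction (P : R -> Prop) (a b : R) : a <= b -> P a ->
  (forall t, a <= t -> P t -> exists2 e : R, 0 < e & forall d, 0 <= d < e -> P (t + d)) ->
  (forall (u : nat -> R) t, a <= t -> (forall n, a <= u n <= t) ->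
     (forall n, P (u n)) -> tends (fun n => (u n)%:C) t%:C -> P t) ->
  P b.
Proof.
move=> ab Pa right closed_.
pose S := [set t | a <= t <= b /\ P t].
have S0 : S !=set0 by exists a; rewrite /S /= lexx ab.
have ubS : has_ubound S by exists b => t [/andP[]].
have hs : has_sup S by split.
set t := sup S.
have at_ : a <= t by apply: (ub_le_sup ubS); rewrite /S /= lexx ab.
have tb : t <= b by apply: ge_sup => // x [/andP[]].
have Pt : P t.
  have hn (n : nat) : exists x : R, S x /\ t - n.+1%:R^-1 < x.
    have n0 : 0 < n.+1%:R^-1 :> R by rewrite invr_gt0.
    by have [x Sx hx] := sup_adherent n0 hs; exists x.
  have [u hu] := choice hn.
  have ut n : u n <= t by apply: (ub_le_sup ubS); exact: (hu n).1.
  apply: (closed_ u) => // [n|n|e e0].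
  - by rewrite ut andbT; have [[/andP[]]] := hu n.
  - by have [[]] := hu n.
  exists (Num.truncn e^-1) => n hn1; rewrite -rmorphB cmod_real ltr_norml.
  have h1 := (hu n).2; have h2 := ut n.
  have : n.+1%:R^-1 < e.
    rewrite -[ltRHS]invrK ltf_pV2 ?posrE ?invr_gt0//.
    by apply: lt_le_trans (truncnS_gt _) _; rewrite ler_nat.
  by move: h1; set q := n.+1%:R^-1 => h1 h3; apply/andP; split; lra.
have [tb'|] := ltP t b; last by move=> bt; rewrite (le_anti (introT andP (conj bt tb))).
have [e e0 he] := right _ at_ Pt.
set d := Num.min (e / 2) (b - t).
have d0 : 0 < d by rewrite lt_min subr_gt0 tb' andbT; lra.
have d1 : d <= e / 2 by rewrite ge_min lexx.
have d2 : d <= b - t by rewrite ge_min lexx orbT.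
have : S (t + d).
  split; first by apply/andP; split; lra.
  by apply: he; apply/andP; split; lra.
by move=> /(ub_le_sup ubS); rewrite -/t; lra.
Qed.

End ImplicitFunction.

(** * Absolute continuity *)

Section AbsoluteContinuity.
Variable R : realType.
Implicit Types (a b s t x e : R) (u M E h : R -> R).

Lemma is_derive_eps h x (l : R) :
  (forall e, 0 < e -> exists2 d : R, 0 < d & forall t, `|t| < d ->
     `|h (x + t) - h x - l * t| <= e * `|t|) -> is_derive x 1 h l.
Proof.
move=> hl; have H : (r^-1 *: (h (r *: 1 + x) - h x)) @[r --> 0^'] --> l.
  apply/cvgrPdist_lt => e e0; have e2 : 0 < e / 2 by lra.
  have [d d0 hd] := hl _ e2; exists d => // t /=; rewrite sub0r normrN => td t0.
  have := hd _ td; rewrite -[t *: 1]/(t * 1) mulr1 (addrC t) -[_ *: _]/(_ * _) => key.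
  have nt : 0 < `|t| by rewrite normr_gt0.
  rewrite (_ : l - _ = - (t^-1 * (h (x + t) - h x - l * t))).
    rewrite normrN normrM normfV mulrC ltr_pdivrMr//; apply: le_lt_trans key _.
    by rewrite ltr_pM2r//; lra.
  by field.
by apply: DeriveDef; [apply/cvg_ex; exists l|exact: cvg_lim H].
Qed.

Lemma continuous_eps h :
  (forall x e, 0 < e -> exists2 d : R, 0 < d & forall y, `|y - x| < d ->
     `|h y - h x| < e) -> continuous h.
Proof.
move=> hh x; apply/cvgrPdist_lt => e e0; have [d d0 hd] := hh x e e0.
exists d => // y /= xy; rewrite distrC; apply: hd.
by rewrite distrC.
Qed.

(** The mean value theorem, applied to [M + h] and [M - h]. *)
Lemma derivable_le h M (dh dM : R -> R) a b : a <= b ->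
  {within `[a, b], continuous h} -> continuous M ->
  (forall x, a < x < b -> [/\ is_derive x 1 h (dh x), is_derive x 1 M (dM x) &
     `|dh x| <= dM x]) ->
  `|h b - h a| <= M b - M a.
Proof.
move=> ab ch cM der.
have aux (sg : bool) (g := fun x => M x + (-1) ^+ sg * h x) : g a <= g b.
  move: ab; rewrite le_eqVlt => /predU1P[->//|ab].
  have [x||c] := @MVT R g (fun x => dM x + (-1) ^+ sg * dh x) a b ab.
  - rewrite in_itv/= => xab; have [h1 h2 _] := der x xab.
    exact: is_deriveD h2 (is_deriveZ ((-1) ^+ sg) h1).
  - move=> x; apply: cvgD; first exact: (continuous_subspaceT cM).
    by apply: cvgM; [exact: cvg_cst|exact: ch].
  rewrite in_itv/= => cab E; rewrite -subr_ge0 E.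
  have [_ _ le] := der c cab.
  apply: mulr_ge0; last by rewrite subr_ge0 ltW.
  move: le; rewrite ler_norml => /andP[l1 l2].
  by case: sg {g E} => /=; rewrite ?expr0 ?expr1; lra.
have h1 := aux false; have h2 := aux true.
rewrite ler_norml; move: h1 h2; rewrite /= expr0 expr1.
by move=> h1 h2; apply/andP; split; lra.
Qed.

(** The exceptional points are dealt with one at a time, by cutting the interval at
    each of them. *)
Lemma derivable_le_except h M (dh dM : R -> R) (l : seq R) a b : a <= b ->
  continuous h -> continuous M ->
  (forall x, a < x < b -> x \notin l ->
     [/\ is_derive x 1 h (dh x), is_derive x 1 M (dM x) & `|dh x| <= dM x]) ->
  `|h b - h a| <= M b - M a.
Proof.
move=> ab ch cM der.
pose P (r : seq R) := forall s t, a <= s -> s <= t -> t <= b ->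
  (forall x, s < x < t -> x \in l -> x \in r) -> `|h t - h s| <= M t - M s.
suff hP : forall r, P r by apply: (hP l).
elim => [|p r IH] s t as_ st tb hr.
  have chs : {within `[s, t], continuous h} by exact: continuous_subspaceT.
  apply: (derivable_le st chs cM (dh := dh) (dM := dM)) => x /andP[sx xt].
  apply: der; first by rewrite (le_lt_trans as_ sx) (lt_le_trans xt tb).
  by apply/negP => /hr; rewrite sx xt => /(_ isT).
have [/andP[sp pt]|spt] := boolP (s < p < t); last first.
  apply: IH => // x xst xl; have := hr x xst xl; rewrite inE => /predU1P[xp|//].
  by rewrite -xp xst in spt.
have h1 : `|h p - h s| <= M p - M s.
  apply: IH => //; [exact: ltW|exact: le_trans (ltW pt) tb|].
  move=> x /andP[sx xp] xl; have := hr x _ xl; rewrite inE (lt_eqF xp)/=; apply.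
  by rewrite sx (lt_trans xp).
have h2 : `|h t - h p| <= M t - M p.
  apply: IH => //; [exact: le_trans as_ (ltW sp)|exact: ltW|].
  move=> x /andP[px xt] xl; have := hr x _ xl; rewrite inE (gt_eqF px)/=; apply.
  by rewrite xt (lt_trans sp).
rewrite (_ : h t - h s = (h t - h p) + (h p - h s)); last by rewrite addrA subrK.
by apply: le_trans (ler_normD _ _) _; lra.
Qed.

Lemma abs_continuous_dominated a b u M :
  (forall s t, a <= s -> s <= t -> t <= b -> `|u t - u s| <= M t - M s) ->
  abs_continuous a b M -> abs_continuous a b u.
Proof.
move=> uM hM e e0; have [d d0 hd] := hM e e0; exists d => // n s t st tI sm.
apply: le_lt_trans (hd n s t st tI sm); apply: ler_sum => i _.
have [/andP[h1 h2] h3] := st i.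
by apply: le_trans (uM _ _ h1 h2 h3) (ler_norm _).
Qed.

(** The images under [E] of disjoint intervals are disjoint intervals of
    [[E a, E b]], so that Lebesgue measure bounds the sum of their lengths. *)
Lemma disjoint_increments a b E n (s t : 'I_n -> R) :
  {homo E : x y / x <= y} -> a <= b ->
  (forall i, a <= s i <= t i /\ t i <= b) ->
  trivIset setT (fun i => `]s i, t i[%classic) ->
  \sum_(i < n) (E (t i) - E (s i)) <= E b - E a.
Proof.
move=> hE ab st tI.
have itvm i : lebesgue_measure (`]E (s i), E (t i)[%classic : set R) =
    (E (t i) - E (s i))%:E.
  rewrite lebesgue_measure_itv/= lte_fin.
  have [/andP[_ si] _] := st i.
  case: ltP => [_|h]; first by rewrite EFinB.
  by have := hE _ _ si => h'; rewrite (@le_anti _ _ (E (t i)) (E (s i))) ?h ?h'// subrr.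
have tE : trivIset setT (fun i => `]E (s i), E (t i)[%classic : set R).
  apply/trivIsetP => i j _ _ ij; rewrite -subset0 => y [] /=; rewrite !in_itv/=.
  move=> /andP[y1 y2] /andP[y3 y4].
  have lt_of p q : E p < E q -> p < q.
    by move=> h; rewrite ltNge; apply/negP => /hE; rewrite leNgt h.
  have c1 := lt_of _ _ (lt_trans y1 y2); have c2 := lt_of _ _ (lt_trans y1 y4).
  have c3 := lt_of _ _ (lt_trans y3 y2); have c4 := lt_of _ _ (lt_trans y3 y4).
  pose p := Num.max (s i) (s j); pose q := Num.min (t i) (t j).
  have pq : p < q by rewrite /p /q gt_max !lt_min c1 c2 c3 c4.
  move/trivIsetP : tI => /(_ i j I I ij); rewrite -subset0 => /(_ ((p + q) / 2)); apply.
  have p1 : s i <= p by rewrite le_max lexx.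
  have p2 : s j <= p by rewrite le_max lexx orbT.
  have q1 : q <= t i by rewrite ge_min lexx.
  have q2 : q <= t j by rewrite ge_min lexx orbT.
  by split; rewrite /= in_itv/=; apply/andP; split; lra.
rewrite -lee_fin -sumEFin.
under eq_bigr do rewrite -itvm.
rewrite -measure_semi_additive_ord//; last first.
  by apply: bigsetU_measurable => i _; exact: measurable_itv.
apply: (@le_trans _ _ (lebesgue_measure (`[E a, E b]%classic : set R))).
  apply: le_measure; rewrite ?inE.
  - by apply: bigsetU_measurable => i _; exact: measurable_itv.
  - exact: measurable_itv.
  - elim/big_ind: _ => [//|A B hA hB y [/hA|/hB]//|i _ y] /=.
    rewrite !in_itv/= => /andP[y1 y2]; have [/andP[h1 h2] h3] := st i.
    by rewrite (le_trans (hE _ _ h1) (ltW y1)) (le_trans (ltW y2) (hE _ _ h3)).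
rewrite lebesgue_measure_itv/= lte_fin; case: ltP => [_|h]; first by rewrite EFinB.
by rewrite lee_fin subr_ge0 hE.
Qed.

(** The Lipschitz part of the increments is controlled by the total length of the
    intervals, the other part by [E b - E a], whatever the intervals are. *)
Lemma abs_continuous_lipschitz_part a b M : a <= b ->
  {homo M : x y / x <= y} ->
  (forall e, 0 < e -> exists (L : R) (E : R -> R), [/\ 0 <= L, {homo E : x y / x <= y},
     E b - E a <= e & forall s t, s <= t -> M t - M s <= L * (t - s) + (E t - E s)]) ->
  abs_continuous a b M.
Proof.
move=> ab hM h e e0; have e2 : 0 < e / 2 by lra.
have [L [E [L0 hE Ee ME]]] := h _ e2.
exists (e / 2 / (L + 1)); first by rewrite divr_gt0//; lra.
move=> n s t st tI; rewrite ltr_pdivlMr; last by lra.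
move=> sm.
have -> : \sum_(i < n) `|M (t i) - M (s i)| = \sum_(i < n) (M (t i) - M (s i)).
  apply: eq_bigr => i _; rewrite ger0_norm// subr_ge0 hM//.
  by have [/andP[]] := st i.
have h1 : \sum_(i < n) (M (t i) - M (s i)) <=
    \sum_(i < n) (L * (t i - s i) + (E (t i) - E (s i))).
  by apply: ler_sum => i _; apply: ME; have [/andP[]] := st i.
apply: le_lt_trans h1 _; rewrite big_split/= -mulr_sumr.
have := disjoint_increments hE ab st tI.
have : 0 <= \sum_(i < n) (t i - s i).
  by apply: sumr_ge0 => i _; rewrite subr_ge0; have [/andP[]] := st i.
move: sm; set S := \sum_(i < n) (t i - s i) => sm S0 h2.
lra.
Qed.

(** A primitive on the whole line of the even function [al * `|t| `^ (al - 1)],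
    which is unbounded at the origin. *)
Definition oddpow (al : R) (t : R) := if t < 0 then - ((- t) `^ al) else t `^ al.

Lemma oddpowN al t : 0 < al -> oddpow al (- t) = - oddpow al t.
Proof.
move=> al0; rewrite /oddpow oppr_lt0 opprK; case: (ltgtP t 0) => [t0|t0|->].
- by rewrite opprK.
- by [].
- by rewrite oppr0 powR0 ?gt_eqF// oppr0.
Qed.

Lemma oddpow_ge0 al t : 0 <= t -> oddpow al t = t `^ al.
Proof. by move=> t0; rewrite /oddpow ltNge t0. Qed.

Lemma oddpow_homo al : 0 < al -> {homo oddpow al : x y / x <= y}.
Proof.
move=> al0; have pos x y : 0 <= x -> x <= y -> oddpow al x <= oddpow al y.
  move=> x0 xy; rewrite !oddpow_ge0//; last exact: le_trans xy.
  by apply: ge0_ler_powR; rewrite ?nnegrE//; [exact: ltW|exact: le_trans xy].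
move=> x y xy; have [x0|x0] := leP 0 x; first exact: pos.
have [y0|y0] := leP 0 y.
  rewrite (oddpow_ge0 _ y0) /oddpow x0; apply: (@le_trans _ _ 0); last exact: powR_ge0.
  by rewrite oppr_le0 powR_ge0.
rewrite -(opprK x) -(opprK y) oddpowN// (oddpowN (- y))// lerN2.
by apply: pos; [rewrite oppr_ge0 ltW|rewrite lerN2].
Qed.

Lemma oddpow_derive al t : 0 < al -> t != 0 ->
  is_derive t 1 (oddpow al) (al * `|t| `^ (al - 1)).
Proof.
move=> al0; have pos x : 0 < x -> is_derive x 1 (oddpow al) (al * `|x| `^ (al - 1)).
  move=> x0; rewrite gtr0_norm//.
  apply: (near_eq_is_derive _ (is_derive1_powR al x0)).
  exists x => // y /= xy; rewrite oddpow_ge0//.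
  by have := ler_norm (x - y); lra.
case: (ltgtP t 0) => // t0 _; last exact: pos.
have := pos (- t); rewrite oppr_gt0 => /(_ t0) h.
rewrite (_ : oddpow al = - (oddpow al \o -%R)); last first.
  by apply/funext => y; rewrite !fctE /= oddpowN// opprK.
have hN := is_derive1_comp h (is_deriveNid t 1).
apply: (is_derive_eq (is_deriveN hN)).
by rewrite normrN mulrN1 opprK.
Qed.

Lemma powR_small al e : 0 < al -> 0 < e ->
  exists2 d : R, 0 < d & forall x, 0 <= x -> x < d -> x `^ al < e.
Proof.
move=> al0 e0; exists (e `^ al^-1); first exact: powR_gt0.
move=> x x0 xd; have : x `^ al < (e `^ al^-1) `^ al.
  by apply: gt0_ltr_powR; rewrite ?nnegrE ?powR_ge0.
by rewrite -powRrM mulVf ?gt_eqF// powRr1// ltW.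
Qed.

Lemma powR_antitone al x (y : R) : al <= 1 -> 0 < x -> x <= y ->
  y `^ (al - 1) <= x `^ (al - 1).
Proof.
move=> al1 x0 xy; have y0 : 0 < y by exact: lt_le_trans xy.
rewrite -opprB !powRN lef_pV2 ?posrE ?powR_gt0//.
by apply: ge0_ler_powR; rewrite ?nnegrE ?subr_ge0// ltW.
Qed.

Lemma oddpow_continuous al : 0 < al -> continuous (oddpow al).
Proof.
move=> al0 t; have [->|t0] := eqVneq t 0; last first.
  apply: differentiable_continuous; apply/derivable1_diffP.
  exact: (@ex_derive _ _ _ _ _ _ _ (oddpow_derive al0 t0)).
apply/cvgrPdist_lt => e e0; have [d d0 hd] := powR_small al0 e0.
exists d => // y /=; rewrite sub0r normrN {1}/oddpow ltxx powR0 ?gt_eqF// sub0r normrN => yd.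
rewrite /oddpow; case: (ltP y 0) => y0.
  rewrite normrN ger0_norm ?powR_ge0//; apply: hd; first by rewrite oppr_ge0 ltW.
  by rewrite -ltr0_norm.
by rewrite ger0_norm ?powR_ge0//; apply: hd => //; rewrite -(ger0_norm y0).
Qed.

Lemma oddpow_lipschitz_away al (eta : R) s t : 0 < al -> al <= 1 -> 0 < eta -> eta <= s ->
  s <= t -> oddpow al t - oddpow al s <= al * eta `^ (al - 1) * (t - s).
Proof.
move=> al0 al1 eta0 es st.
have [->|ts] := eqVneq s t; first by rewrite !subrr mulr0.
have {ts}st : s < t by rewrite lt_neqAle ts.
have [x||x] := @MVT R (oddpow al) (fun x => al * `|x| `^ (al - 1)) s t st.
- rewrite in_itv/= => /andP[sx _]; apply: oddpow_derive => //.
  by rewrite gt_eqF//; lra.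
- by apply: continuous_subspaceT => x; exact: oddpow_continuous.
rewrite in_itv/= => /andP[sx xt] ->.
rewrite ler_wpM2r ?subr_ge0 ?(ltW st)//; apply: ler_wpM2l; first exact: ltW.
have ex : eta <= x by lra.
rewrite ger0_norm; last by lra.
exact: powR_antitone.
Qed.

(** Cut at the distance [eta] from the singularity [c]: outside, the function is
    Lipschitz; inside, its total increment is small by continuity. *)
Lemma abs_continuous_oddpow al a b c : 0 < al -> al <= 1 -> a <= b ->
  abs_continuous a b (fun t => oddpow al (t - c)).
Proof.
move=> al0 al1 ab.
have hN := oddpow_homo al0.
apply: abs_continuous_lipschitz_part => // [x y xy|e e0].
  by apply: hN; rewrite lerD2r.
have e2 : 0 < e / 2 by lra.
have [d d0 hd] := powR_small al0 e2.
pose eta := d / 2; have eta0 : 0 < eta by rewrite /eta; lra.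
pose L := al * eta `^ (al - 1); have L0 : 0 <= L by rewrite /L; nonneg.
pose E t := oddpow al (Num.max (- eta) (Num.min eta (t - c))).
exists (2 * L), E; split=> [||| s t st].
- by rewrite mulr_ge0.
- move=> x y xy; apply: hN.
  rewrite ge_max !le_max lexx/= le_min !ge_min lexx/= lerD2r xy.
  by rewrite orbT orbT.
- have Ne : oddpow al eta < e / 2 by rewrite oddpow_ge0 ?ltW//; apply: hd; [exact: ltW|rewrite /eta; lra].
  have h1 : E b <= oddpow al eta.
    by apply: hN; rewrite ge_max ge_min lexx andbT; lra.
  have h2 : oddpow al (- eta) <= E a by apply: hN; rewrite le_max lexx.
  by rewrite oddpowN// in h2; lra.
have split_ x : oddpow al x = oddpow al (Num.max x eta) +
    oddpow al (Num.max (- eta) (Num.min eta x)) - oddpow al (Num.max (- x) eta).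
  have [xe|ex] := leP x (- eta).
    rewrite (max_r (_ : x <= eta)); last by lra.
    rewrite (min_r (_ : x <= eta)); last by lra.
    rewrite (max_l (_ : x <= - eta))// (max_l (_ : eta <= - x)); last by lra.
    by rewrite !oddpowN//; lra.
  rewrite (max_r (_ : - x <= eta)); last by lra.
  have [xe2|ex2] := leP x eta.
    by rewrite (max_r (ltW ex)); lra.
  by rewrite (max_r (_ : - eta <= eta)); lra.
have h1 : oddpow al (Num.max (t - c) eta) - oddpow al (Num.max (s - c) eta) <= L * (t - s).
  have le1 : Num.max (s - c) eta <= Num.max (t - c) eta.
    by rewrite ge_max !le_max lexx orbT andbT lerD2r st.
  apply: le_trans (oddpow_lipschitz_away al0 al1 eta0 _ le1) _.
    by rewrite le_max lexx orbT.
  apply: ler_wpM2l => //.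
  by case: (leP (t - c) eta); case: (leP (s - c) eta); lra.
have h2 : oddpow al (Num.max (- (s - c)) eta) - oddpow al (Num.max (- (t - c)) eta) <= L * (t - s).
  have le1 : Num.max (- (t - c)) eta <= Num.max (- (s - c)) eta.
    by rewrite ge_max !le_max lexx orbT andbT lerN2 lerD2r st.
  apply: le_trans (oddpow_lipschitz_away al0 al1 eta0 _ le1) _.
    by rewrite le_max lexx orbT.
  apply: ler_wpM2l => //.
  by case: (leP (- (t - c)) eta); case: (leP (- (s - c)) eta); lra.
rewrite (split_ (t - c)) (split_ (s - c)) -/(E t) -/(E s); lra.
Qed.

Lemma abs_continuousD a b (u v : R -> R) : abs_continuous a b u -> abs_continuous a b v ->
  abs_continuous a b (fun t => u t + v t).
Proof.
move=> hu hv e e0; have e2 : 0 < e / 2 by lra.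
have [d d0 hd] := hu _ e2; have [d' d'0 hd'] := hv _ e2.
exists (Num.min d d'); first by rewrite lt_min d0.
move=> n s t st tI; rewrite lt_min => /andP[s1 s2].
have := hd n s t st tI s1; have := hd' n s t st tI s2.
have : \sum_(i < n) `|u (t i) + v (t i) - (u (s i) + v (s i))| <=
   \sum_(i < n) (`|u (t i) - u (s i)| + `|v (t i) - v (s i)|).
  apply: ler_sum => i _; rewrite (_ : _ - _ = (u (t i) - u (s i)) + (v (t i) - v (s i))); last by ring.
  exact: ler_normD.
rewrite big_split/=; lra.
Qed.

Lemma abs_continuousZ a b C (u : R -> R) : abs_continuous a b u ->
  abs_continuous a b (fun t => C * u t).
Proof.
move=> hu e e0; have C0 : 0 < `|C| + 1 by rewrite ltr_wpDl.
have e1 : 0 < e / (`|C| + 1) by rewrite divr_gt0.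
have [d d0 hd] := hu _ e1; exists d => // n s t st tI sm.
have := hd n s t st tI sm; rewrite ltr_pdivlMr//.
under [X in _ -> X < _]eq_bigr do rewrite -mulrBr normrM.
rewrite -mulr_sumr.
have : 0 <= \sum_(i < n) `|u (t i) - u (s i)| by apply: sumr_ge0.
lra.
Qed.

Lemma abs_continuous_id a b : abs_continuous a b (fun t : R => t).
Proof.
move=> e e0; exists e => // n s t st tI sm.
under eq_bigr => i _ do (rewrite ger0_norm; last by rewrite subr_ge0; have [/andP[]] := st i).
exact: sm.
Qed.

(** The singularities of [|t^2 - m|^(al - 1)] are integrable, so that this function
    is dominated by the derivative of an absolutely continuous one. When [m > 0]
    and [x0 ^+ 2 = m], one of the factors [t - x0], [t + x0] of [t^2 - m] has
    modulus at least [x0], and only the other one matters. *)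
Lemma abs_continuous_majorant al (m D : R) a b : 0 < al -> al <= 1 -> m != 0 ->
  0 <= D -> a <= b ->
  exists (M dM : R -> R) (l : seq R), [/\ continuous M, abs_continuous a b M &
    forall t, t \notin l -> [/\ t ^+ 2 != m, is_derive t 1 M (dM t) &
      D * `|t ^+ 2 - m| `^ (al - 1) <= dM t]].
Proof.
move=> al0 al1; rewrite neq_lt => /orP[m0|m0] D0 ab.
  pose K := D * (- m) `^ (al - 1).
  exists (fun t => K * t), (fun=> K), [::]; split.
  - by move=> t; apply: cvgM; [exact: cvg_cst|exact: cvg_id].
  - exact: abs_continuousZ (abs_continuous_id a b).
  - move=> t _; have t2 := sqr_ge0 t; split.
    + by rewrite gt_eqF//; lra.
    + by have := is_deriveZ K (is_derive_id t (1 : R)); rewrite /GRing.scale/= mulr1.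
    + rewrite ler_wpM2l// ger0_norm; last by lra.
      by apply: powR_antitone => //; lra.
pose x0 := Num.sqrt m; have x00 : 0 < x0 by rewrite sqrtr_gt0.
have mE : m = x0 ^+ 2 by rewrite sqr_sqrtr// ltW.
pose D' := D * x0 `^ (al - 1).
have D'0 : 0 <= D' by rewrite mulr_ge0// powR_ge0.
pose N c t := oddpow al (t - c).
exists (fun t => D' / al * (N x0 t + N (- x0) t)),
  (fun t => D' * (`|t - x0| `^ (al - 1) + `|t + x0| `^ (al - 1))), [:: x0; - x0].
have Nc c : continuous (N c).
  move=> t; apply: (@continuous_comp _ _ _ (fun t => t - c) (oddpow al)).
    by apply: cvgB; [exact: cvg_id|exact: cvg_cst].
  exact: oddpow_continuous.
have Nd c t : t != c -> is_derive t 1 (N c) (al * `|t - c| `^ (al - 1)).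
  rewrite -subr_eq0 => tc.
  have h := is_deriveB (is_derive_id t (1 : R)) (is_derive_cst c t 1).
  have := @is_derive1_comp _ (oddpow al) (id - cst c) t _ _ (oddpow_derive al0 tc) h.
  by rewrite subr0 mulr1.
split.
- move=> t; apply: cvgM; first exact: cvg_cst.
  by apply: cvgD; exact: Nc.
- apply: abs_continuousZ; apply: abs_continuousD; exact: abs_continuous_oddpow.
move=> t; rewrite !inE negb_or => /andP[t1 t2].
have tp : 0 < `|t - x0| by rewrite normr_gt0 subr_eq0.
have tm : 0 < `|t + x0| by rewrite normr_gt0 addr_eq0.
have E : t ^+ 2 - m = (t - x0) * (t + x0) by rewrite mE; ring.
split.
- by rewrite -subr_eq0 E mulf_neq0 -?normr_gt0.
- have := is_deriveZ (D' / al) (is_deriveD (Nd _ _ t1) (Nd _ _ t2)).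
  rewrite opprK -mulrDr [_ *: _]mulrA divfK ?gt_eqF//.
rewrite E normrM /D' -mulrA ler_wpM2l//.
have p1 := powR_ge0 `|t - x0| (al - 1); have p2 := powR_ge0 `|t + x0| (al - 1).
have p0 := powR_ge0 x0 (al - 1).
have [h|h] := leP x0 `|t + x0|.
  apply: (@le_trans _ _ ((x0 * `|t - x0|) `^ (al - 1))).
    apply: powR_antitone => //; first by rewrite mulr_gt0.
    by rewrite mulrC ler_wpM2l.
  by rewrite powRM; [rewrite ler_wpM2l// lerDl|exact: ltW|exact: ltW].
have h2 : x0 <= `|t - x0|.
  have := ler_norm ((x0 + x0) - (t + x0) ); have := ler_norm (t + x0).
  rewrite (_ : x0 + x0 - (t + x0) = - (t - x0)); last by ring.
  by rewrite normrN; lra.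
apply: (@le_trans _ _ ((x0 * `|t + x0|) `^ (al - 1))).
  apply: powR_antitone => //; first by rewrite mulr_gt0.
  by rewrite ler_wpM2r.
by rewrite powRM; [rewrite ler_wpM2l// lerDr|exact: ltW|exact: ltW].
Qed.

End AbsoluteContinuity.

(** * Real differentials of complex functions *)

Section RealDifferential.
Variable R : realType.
Implicit Types (x y z w h A B l e : R[i]) (f g phi : R[i] -> R[i]).

Lemma re_scale (x : R) w : Re (x%:C * w) = x * Re w.
Proof. by case: w => a b /=; rewrite mul0r subr0. Qed.

Lemma conjcM z w : (z * w)^* = z^* * w^*.
Proof. exact: rmorphM. Qed.

Lemma complex_eta z : Re z +i* Im z = z. Proof. by case: z. Qed.

Lemma conj_real_part (x : R) : (x%:C)^* = x%:C :> R[i].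
Proof. exact: conjc_real. Qed.

Lemma conj_inv_involutive z : (((z^*)^-1)^*)^-1 = z.
Proof.
rewrite -[RHS]invrK; congr (_^-1); apply: etrans (conjc_inv _) _.
by congr (_^-1); exact: conjcK.
Qed.

(** [A] and [B] are the Wirtinger derivatives of [g] at [z]; unlike the partial
    derivatives they compose by simple rules. *)
Definition rder g z A B := forall e : R, 0 < e -> exists2 d : R, 0 < d &
  forall h, cmod h < d -> cmod (g (z + h) - g z - (A * h + B * h^*)) <= e * cmod h.

Lemma rder_sder f z l : sder f z l -> rder f z l 0.
Proof.
move=> hf e /hf[d d0 hd]; exists d => // h hh.
have := hd (z + h) z; rewrite subrr cmod0 (addrC z h) addrK mul0r addr0.
exact.
Qed.

Lemma rder_conj z : rder (fun w => w^*) z 0 1.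
Proof.
move=> e e0; exists 1 => // h _; rewrite rmorphD mul0r add0r mul1r.
by rewrite (addrC z^*) addrK subrr cmod0 mulr_ge0 ?cmod_ge0// ltW.
Qed.

Lemma rderD f g z A B A' B' : rder f z A B -> rder g z A' B' ->
  rder (fun w => f w + g w) z (A + A') (B + B').
Proof.
move=> hf hg e e0; have e2 : 0 < e / 2 by lra.
have [d d0 hd] := hf _ e2; have [d' d'0 hd'] := hg _ e2.
exists (Num.min d d') => [|h]; first by rewrite lt_min d0.
rewrite lt_min => /andP[h1 h2].
rewrite (_ : _ - _ - _ = (f (z + h) - f z - (A * h + B * h^*)) +
  (g (z + h) - g z - (A' * h + B' * h^*))); last by ring.
by apply: le_trans (cmodD _ _) _; have := hd _ h1; have := hd' _ h2; lra.
Qed.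

Lemma rder_bound g z A B : rder g z A B -> exists2 L : R, 0 < L &
  exists2 d : R, 0 < d & forall h, cmod h < d -> cmod (g (z + h) - g z) <= L * cmod h.
Proof.
move=> /(_ 1 ltr01)[d d0 hd]; exists (cmod A + cmod B + 1).
  by rewrite ltr_wpDl// addr_ge0 ?cmod_ge0.
exists d => // h hh; have := hd _ hh; rewrite mul1r => key.
have := cmod_subl (g (z + h) - g z) (A * h + B * h^*).
by have := cmodD (A * h) (B * h^*); rewrite !cmodM cmodJ; lra.
Qed.

Lemma rder_comp phi g z A B l : rder g z A B -> sder phi (g z) l ->
  rder (fun w => phi (g w)) z (l * A) (l * B).
Proof.
move=> hg hphi e e0.
have [L L0 [d d0 hd]] := rder_bound hg.
have l0 := cmod_ge0 l.
have e1 : 0 < e / 2 / L by rewrite !divr_gt0//; lra.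
have e2 : 0 < e / 2 / (cmod l + 1) by rewrite !divr_gt0//; lra.
have [d1 d10 hd1] := hphi _ e1; have [d2 d20 hd2] := hg _ e2.
exists (Num.min (Num.min d d2) (d1 / L)) => [|h].
  by rewrite !lt_min d0 d20 divr_gt0.
rewrite !lt_min ltr_pdivlMr// => /andP[/andP[h1 h2] h3].
have c0 := cmod_ge0 h.
rewrite (_ : _ - _ - _ = (phi (g (z + h)) - phi (g z) - l * (g (z + h) - g z)) +
  l * (g (z + h) - g z - (A * h + B * h^*))); last by ring.
apply: le_trans (cmodD _ _) _; rewrite cmodM.
have k1 := hd _ h1; have k2 := hd2 _ h2.
have k3 : cmod (phi (g (z + h)) - phi (g z) - l * (g (z + h) - g z)) <=
    e / 2 / L * cmod (g (z + h) - g z).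
  by apply: hd1; [apply: le_lt_trans k1 _; rewrite mulrC|rewrite subrr cmod0].
have k4 : e / 2 / L * cmod (g (z + h) - g z) <= e / 2 / L * (L * cmod h).
  by rewrite ler_wpM2l// ltW.
rewrite mulrA divfK ?gt_eqF// in k4.
have k5 : cmod l * cmod (g (z + h) - g z - (A * h + B * h^*)) <=
    (cmod l + 1) * (e / 2 / (cmod l + 1) * cmod h).
  by apply: ler_pM => //; [exact: cmod_ge0|rewrite lerDl].
have k6 : (cmod l + 1) * (e / 2 / (cmod l + 1) * cmod h) = e / 2 * cmod h.
  by field; rewrite gt_eqF//; lra.
lra.
Qed.

Lemma rderM f g z A B A' B' : rder f z A B -> rder g z A' B' ->
  rder (fun w => f w * g w) z (A * g z + f z * A') (B * g z + f z * B').
Proof.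
move=> hf hg e e0.
have [L L0 [d d0 hd]] := rder_bound hf; have [M M0 [d' d'0 hd']] := rder_bound hg.
have f0 := cmod_ge0 (f z); have g0 := cmod_ge0 (g z).
have e1 : 0 < e / 3 / (cmod (g z) + 1) by rewrite !divr_gt0//; lra.
have e2 : 0 < e / 3 / (cmod (f z) + 1) by rewrite !divr_gt0//; lra.
have [d1 d10 hd1] := hf _ e1; have [d2 d20 hd2] := hg _ e2.
have LM : 0 < L * M by rewrite mulr_gt0.
exists (Num.min (Num.min (Num.min d d') (Num.min d1 d2)) (e / 3 / (L * M))) => [|h].
  by rewrite !lt_min d0 d'0 d10 d20 !divr_gt0//; lra.
rewrite !lt_min ltr_pdivlMr// => /andP[/andP[/andP[h1 h2] /andP[h3 h4]] h5].
have c0 := cmod_ge0 h.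
rewrite (_ : _ - _ - _ = (f (z + h) - f z - (A * h + B * h^*)) * g z +
  f z * (g (z + h) - g z - (A' * h + B' * h^*)) +
  (f (z + h) - f z) * (g (z + h) - g z)); last by ring.
apply: le_trans (cmodD3 _ _ _) _; rewrite !cmodM.
have k1 : cmod (f (z + h) - f z - (A * h + B * h^*)) * cmod (g z) <=
    (e / 3 / (cmod (g z) + 1) * cmod h) * (cmod (g z) + 1).
  by apply: ler_pM; rewrite ?cmod_ge0 ?lerDl//; exact: hd1.
have k2 : cmod (f z) * cmod (g (z + h) - g z - (A' * h + B' * h^*)) <=
    (cmod (f z) + 1) * (e / 3 / (cmod (f z) + 1) * cmod h).
  by apply: ler_pM; rewrite ?cmod_ge0 ?lerDl//; exact: hd2.
have k3 : cmod (f (z + h) - f z) * cmod (g (z + h) - g z) <= (L * cmod h) * (M * cmod h).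
  by apply: ler_pM; rewrite ?cmod_ge0//; [exact: hd|exact: hd'].
have k4 : (L * cmod h) * (M * cmod h) <= e / 3 * cmod h.
  by have := ler_wpM2r c0 (ltW h5); lra.
have k5 : (e / 3 / (cmod (g z) + 1) * cmod h) * (cmod (g z) + 1) = e / 3 * cmod h.
  by field; rewrite gt_eqF//; lra.
have k6 : (cmod (f z) + 1) * (e / 3 / (cmod (f z) + 1) * cmod h) = e / 3 * cmod h.
  by field; rewrite gt_eqF//; lra.
lra.
Qed.

Lemma rder_near f g z A B (d : R) : 0 < d -> (forall x, cmod (x - z) < d -> f x = g x) ->
  rder f z A B -> rder g z A B.
Proof.
move=> d0 fg hf e /hf[d' d'0 hd']; exists (Num.min d d'); first by rewrite lt_min d0.
move=> h; rewrite lt_min => /andP[h1 h2].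
by rewrite -!fg ?subrr ?cmod0 ?(addrC z) ?addrK//; rewrite (addrC h); exact: hd'.
Qed.

Lemma sder_inv z : z != 0 -> sder (fun w => w^-1) z (- z ^- 2).
Proof.
move=> z0 e e0; have cz : 0 < cmod z by rewrite cmod_gt0.
exists (Num.min (cmod z / 2) (e * cmod z ^+ 3 / 10)) => [|x y].
  by rewrite lt_min !divr_gt0//; rewrite mulr_gt0// exprn_gt0.
rewrite !lt_min => /andP[x1 x2] /andP[y1 y2].
have xz : cmod z / 2 < cmod x by have := cmod_subl z x; rewrite (cmodC z x); lra.
have yz : cmod z / 2 < cmod y by have := cmod_subl z y; rewrite (cmodC z y); lra.
have yz2 : cmod y <= 3 / 2 * cmod z by have := cmod_subl y z; lra.
have x0 : x != 0 by rewrite -cmod_gt0; lra.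
have y0 : y != 0 by rewrite -cmod_gt0; lra.
rewrite (_ : _ - _ - _ = ((x - z) * y + z * (y - z)) / (z ^+ 2 * x * y) * (x - y)); last first.
  by field; rewrite x0 y0 z0.
rewrite cmodM ler_wpM2r ?cmod_ge0// cmodM cmodV ler_pdivrMr; last first.
  by rewrite cmod_gt0 !mulf_neq0.
apply: le_trans (cmodD _ _) _; rewrite !(cmodX, cmodM).
set D := e * cmod z ^+ 3 / 10 in x2 y2.
have k1 : cmod (x - z) * cmod y <= D * (3 / 2 * cmod z).
  by apply: ler_pM; rewrite ?cmod_ge0//; exact: ltW.
have k2 : cmod z * cmod (y - z) <= cmod z * D by rewrite ler_wpM2l ?cmod_ge0// ltW.
have k3 : cmod z / 2 * (cmod z / 2) <= cmod x * cmod y.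
  by apply: ler_pM; nonneg.
have k4 := ler_wpM2l (ltW (mulr_gt0 e0 (exprn_gt0 2 cz))) k3.
have k5 : D * cmod z = e * cmod z ^+ 2 * (cmod z / 2 * (cmod z / 2)) * (4 / 10).
  by rewrite /D; field.
have k6 : 0 <= e * cmod z ^+ 2 * (cmod z / 2 * (cmod z / 2)) by nonneg.
lra.
Qed.

Lemma rder_line_Re g z A B e (t : R) : rder g (z + t%:C * e) A B ->
  is_derive t 1 (fun s : R => Re (g (z + s%:C * e))) (Re (A * e + B * e^*)).
Proof.
move=> hg; apply: is_derive_eps => eps eps0.
have e0 := cmod_ge0 e.
have e1 : 0 < eps / (cmod e + 1) by rewrite divr_gt0//; lra.
have [d d0 hd] := hg _ e1; exists (d / (cmod e + 1)); first by rewrite divr_gt0//; lra.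
move=> s; rewrite ltr_pdivlMr; last by lra.
move=> sd; have s0 := normr_ge0 s.
have hs : cmod (s%:C * e) < d by rewrite cmodM cmod_real; lra.
have E : z + t%:C * e + s%:C * e = z + (t + s)%:C * e by rewrite -addrA -mulrDl -rmorphD.
have := hd _ hs; rewrite E conjcM conj_real_part => key.
set X := g _ - g _ - _ in key.
have -> : Re (g (z + (t + s)%:C * e)) - Re (g (z + t%:C * e)) - Re (A * e + B * e^*) * s = Re X.
  rewrite /X !re_sub; congr (_ - _); rewrite mulrC -re_scale; congr Re; ring.
apply: le_trans (Re_cmod _) _; apply: le_trans key _.
rewrite cmodM cmod_real.
have h1 : eps / (cmod e + 1) * (cmod e + 1) = eps by rewrite divfK// gt_eqF//; lra.
have h2 : 0 <= eps / (cmod e + 1) by rewrite ltW.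
have h3 : 0 <= eps / (cmod e + 1) * `|s| by nonneg.
by rewrite -{2}h1; lra.
Qed.

Lemma rder_line_Im g z A B e (t : R) : rder g (z + t%:C * e) A B ->
  is_derive t 1 (fun s : R => Im (g (z + s%:C * e))) (Im (A * e + B * e^*)).
Proof.
move=> hg.
have hc : sder (fun w => - 'i%C * w) (g (z + t%:C * e)) (- 'i%C).
  have := sderM (sder_cst (- 'i%C) (g (z + t%:C * e))) (sder_id _).
  by rewrite mul0r add0r mulr1.
have Ii w : Re (- 'i%C * w) = Im w by case: w => a b /=; ring.
have := rder_line_Re (rder_comp hg hc).
rewrite (_ : (fun s : R => Re _) = fun s : R => Im (g (z + s%:C * e))); last first.
  by apply/funext => s; rewrite Ii.
by rewrite -!mulrA -mulrDr Ii.
Qed.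

Lemma partial_x_rder g (x y : R) A B : rder g (x +i* y) A B -> partial_x g x y = A + B.
Proof.
have E t : t +i* y = (0 +i* y) + t%:C * 1 by rewrite mulr1; apply/eqP; rewrite eq_complex /= add0r addr0 !eqxx.
rewrite (E x) => h; rewrite /partial_x.
have := rder_line_Re h; have := rder_line_Im h.
rewrite -(_ : (fun t : R => Re (g (t +i* y))) = fun s : R => Re (g ((0 +i* y) + s%:C * 1))); last first.
  by apply/funext => t; rewrite -E.
rewrite -(_ : (fun t : R => Im (g (t +i* y))) = fun s : R => Im (g ((0 +i* y) + s%:C * 1))); last first.
  by apply/funext => t; rewrite -E.
move=> h1 h2; rewrite !derive1E (@derive_val _ _ _ _ _ _ _ h1) (@derive_val _ _ _ _ _ _ _ h2).
apply: etrans (complex_eta _) _; rewrite mulr1; congr (A + _).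
by rewrite -[RHS]mulr1; congr (B * _); exact: (conj_real_part 1).
Qed.

Lemma partial_y_rder g (x y : R) A B : rder g (x +i* y) A B ->
  partial_y g x y = 'i%C * (A - B).
Proof.
have E t : x +i* t = x%:C + t%:C * 'i%C.
  by apply/eqP; rewrite eq_complex /= !mulr0 !mul0r mulr1 subr0 !addr0 !add0r !eqxx.
rewrite (E y) => h; rewrite /partial_y.
have := rder_line_Re h; have := rder_line_Im h.
rewrite -(_ : (fun t : R => Re (g (x +i* t))) = fun s : R => Re (g (x%:C + s%:C * 'i%C))); last first.
  by apply/funext => t; rewrite -E.
rewrite -(_ : (fun t : R => Im (g (x +i* t))) = fun s : R => Im (g (x%:C + s%:C * 'i%C))); last first.
  by apply/funext => t; rewrite -E.
move=> h1 h2; rewrite !derive1E (@derive_val _ _ _ _ _ _ _ h1) (@derive_val _ _ _ _ _ _ _ h2).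
apply: etrans (complex_eta _) _; rewrite mulrBr (mulrC A); congr (_ + _).
by rewrite (mulrC _ B) -mulrN; congr (B * _); apply/eqP; rewrite eq_complex /= oppr0 !eqxx.
Qed.

Lemma dz_rder g (x y : R) A B : rder g (x +i* y) A B -> dz g x y = A.
Proof.
move=> h; rewrite /dz (partial_x_rder h) (partial_y_rder h) mulrA -expr2 sqr_i.
by field.
Qed.

Lemma dzbar_rder g (x y : R) A B : rder g (x +i* y) A B -> dzbar g x y = B.
Proof.
move=> h; rewrite /dzbar (partial_x_rder h) (partial_y_rder h) mulrA -expr2 sqr_i.
by field.
Qed.

End RealDifferential.

(** * The unit circle as a null set *)

Section NullSets.
Variable R : realType.

Lemma ae_sqr_neq1 (P : R -> Prop) : (forall y : R, y ^+ 2 != 1 -> P y) ->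
  {ae lebesgue_measure, forall y : R, P y}.
Proof.
move=> hP; exists [set 1; -1]; split.
- by apply: measurableU; exact: measurable_set1.
- by apply: countable_lebesgue_measure0; exact/finite_set_countable/finite_set2.
move=> y /= nP; have : y ^+ 2 == 1 by apply/negPn/negP => /hP.
by rewrite sqrf_eq1 => /orP[/eqP->|/eqP->]; [left|right].
Qed.

(** By Fubini, as a vertical line meets the circle in at most two points. *)
Lemma plane_ae_off_circle (P : R -> R -> Prop) :
  (forall x y : R, x ^+ 2 + y ^+ 2 != 1 -> P x y) -> plane_ae P.
Proof.
move=> hP; exists [set p : R * R | p.1 ^+ 2 + p.2 ^+ 2 = 1]; split.
- pose q (p : R * R) := p.1 ^+ 2 + p.2 ^+ 2.
  have mq : measurable_fun setT q.
    by apply: measurable_funD; apply: measurable_funX;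
      [exact: measurable_fst|exact: measurable_snd].
  have := mq measurableT [set 1] (measurable_set1 1).
  by rewrite setTI.
- apply: integral0_eq => x _ /=.
  apply: countable_lebesgue_measure0; rewrite xsectionE.
  pose r := Num.sqrt (1 - x ^+ 2).
  apply: (@sub_countable _ _ _ [set r; - r]); last first.
    exact/finite_set_countable/finite_set2.
  apply: subset_card_le => y /= xy.
  have yr : y ^+ 2 = r ^+ 2.
    have yE : 1 - x ^+ 2 = y ^+ 2 by rewrite -xy; ring.
    by rewrite /r sqr_sqrtr yE// sqr_ge0.
  by move/eqP: yr; rewrite eqf_sqr => /orP[/eqP->|/eqP->]; [left|right].
move=> [x y] /= nP; apply/eqP/negPn/negP => h; apply: nP; exact: hP.
Qed.

End NullSets.

(** * The Loewner family of the extension *)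

(** A step [d] of time multiplies [s] by at most [(1 + x) ^+ 2], which the
    contraction of the radius [r] by [1 - x] more than pays for, as
    [(1 - x) ^+ 2 * (1 + x) ^+ 2 < 1]. *)
Lemma shrink_factor (R : realType) (kap s d r r' : R) : 0 < kap -> kap <= 1 ->
  0 < s -> 0 <= d -> d <= s -> 0 < r -> 0 <= r' ->
  r' <= r * (1 - d * ((1 + kap / 2) / (2 * s))) + r * (kap / (8 * s)) * d ->
  [/\ r' <= r, r' ^+ 2 * (s + d) <= r ^+ 2 * s &
      0 < d -> r' ^+ 2 * (s + d) < r ^+ 2 * s].
Proof.
move=> kp kq s0 d0 ds r0 r'0 r'1; set be := (1 + kap / 4) / (2 * s).
have r'2 : r' <= r * (1 - d * be).
  apply: le_trans r'1 _; rewrite /be le_eqVlt; apply/orP; left; apply/eqP.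
  by field; rewrite gt_eqF.
have sb : s * be = (1 + kap / 4) / 2 by rewrite /be; field; rewrite gt_eqF.
have be0 : 0 < be by rewrite /be divr_gt0//; lra.
have xs : d * be < 1.
  have : d * be <= s * be by rewrite ler_pM2r// ltW.
  by rewrite sb; lra.
set x := d * be in xs r'2.
have x0 : 0 <= x by rewrite /x mulr_ge0// ltW.
have hs : s + d <= s * (1 + x) ^+ 2.
  have e1 : s * (2 * x) = d * (1 + kap / 4) by rewrite /x mulrCA (mulrCA s) sb; field.
  have e2 : 0 <= s * x ^+ 2 by nonneg.
  have e3 : 0 <= d * kap by nonneg.
  rewrite (_ : s * (1 + x) ^+ 2 = s + s * (2 * x) + s * x ^+ 2); last by ring.
  by clear - e1 e2 e3; lra.
have sq1 : r' ^+ 2 <= r ^+ 2 * (1 - x) ^+ 2.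
  rewrite -exprMn lerXn2r ?nnegrE//; apply: mulr_ge0; first exact: ltW.
  by rewrite subr_ge0 ltW.
have sq2 : r' ^+ 2 * (s + d) <= r ^+ 2 * s * (1 - x ^+ 2) ^+ 2.
  apply: (@le_trans _ _ (r ^+ 2 * (1 - x) ^+ 2 * (s * (1 + x) ^+ 2))).
    by apply: ler_pM => //; [exact: exprn_ge0|rewrite addr_ge0// ltW].
  by rewrite le_eqVlt; apply/orP; left; apply/eqP; ring.
have rs0 : 0 < r ^+ 2 * s by rewrite mulr_gt0// exprn_gt0.
have x2 : x ^+ 2 <= 1 by rewrite exprn_ile1// ltW.
have p1 : (1 - x ^+ 2) ^+ 2 <= 1.
  by rewrite exprn_ile1 ?subr_ge0// lerBlDr lerDl sqr_ge0.
split.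
- by apply: le_trans r'2 _; apply: ler_piMr; [exact: ltW|rewrite lerBlDr lerDl].
- by apply: le_trans sq2 _; apply: ler_piMr => //; exact: ltW.
move=> dp; apply: le_lt_trans sq2 _; rewrite gtr_pMr//.
have xp : 0 < x by rewrite /x mulr_gt0.
by rewrite exprn_ilt1// ?subr_ge0// gtrBl exprn_gt0.
Qed.

Section Chain.
Variable R : realType.
Implicit Types (x y z w v u : R[i]).
Variables (f f1 f2 : R[i] -> R[i]) (c : R[i]) (k : R).
Hypothesis fd : forall z, cmod z < 1 -> sder f z (f1 z).
Hypothesis f1d : forall z, cmod z < 1 -> sder f1 z (f2 z).
Hypothesis f0 : f 0 = 0.
Hypothesis f10 : f1 0 = 1.
Hypothesis f1n : forall z, cmod z < 1 -> f1 z != 0.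
Hypothesis k0 : 0 <= k.
Hypothesis k1 : k < 1.
Hypothesis ck : cmod c <= k.
(** Ahlfors' condition, in which [s] stands for [|u|^-2]; the whole range
    [|u|^2 s <= 1] is needed because the solutions below move inside the circle
    [|u|^2 s = 1]. *)
Hypothesis ahlfors : forall u (s : R), cmod u < 1 -> 1 <= s -> cmod u ^+ 2 * s <= 1 ->
  cmod (c * f1 u + (s - 1)%:C * (u * f2 u)) <= k * s * cmod (f1 u).

Ltac klra := have := k0; have := k1; have := ck; lra.

Definition lpsi u := u * f1 u.

Definition lsg (s : R) : R[i] := (s - 1)%:C / (1 + c).

(** A Loewner chain up to rescaling of the time [s]. On the circle [|u|^2 s = 1]
    this is [f u + (z - u) f1 u / (1 + c)] with [z = 1 / u^*] and [s = |z|^2],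
    the value at [z] of the extension. *)
Definition lG (s : R) u := f u + lsg s * lpsi u.

(** The maps [lG s], each on the disc of radius [s^(-1/2)], cover growing parts of
    the plane; the moving boundary circles sweep out the exterior. *)
Definition Sol w (s : R) v := [/\ cmod v < 1, cmod v ^+ 2 * s <= 1 & lG s v = w].

Lemma c1_neq0 : 1 + c != 0.
Proof.
rewrite -cmod_gt0; have := cmod_subl 1 (- c); rewrite cmod1 cmodN opprK.
by move=> h; apply: lt_le_trans h; klra.
Qed.

Lemma lsg1 : lsg 1 = 0. Proof. by rewrite /lsg subrr mul0r. Qed.
Lemma lG1 u : lG 1 u = f u. Proof. by rewrite /lG lsg1 mul0r addr0. Qed.
Lemma lG0 s : lG s 0 = 0. Proof. by rewrite /lG f0 /lpsi mul0r mulr0 addr0. Qed.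

Lemma lsgB s t : lsg s - lsg t = (s - t)%:C / (1 + c).
Proof. by rewrite /lsg -mulrBl -rmorphB opprB addrA subrK. Qed.

Lemma cmod_lsgB s t : cmod (lsg s - lsg t) = `|s - t| / cmod (1 + c).
Proof. by rewrite lsgB cmodM cmodV cmod_real. Qed.

Lemma lpsid u : cmod u < 1 -> sder lpsi u (f1 u + u * f2 u).
Proof. by move=> u1; have := sderM (sder_id u) (f1d u1); rewrite mul1r. Qed.

Definition ldG s u := f1 u + lsg s * (f1 u + u * f2 u).

(** The quotient of [(1 + c) * ldG s u] by [f1 u]: the solutions [u] of
    [lG s u = w] obey the Loewner equation [du/ds = - u / lW s u]. *)
Definition lW (s : R) u := s%:C + (c * f1 u + (s - 1)%:C * (u * f2 u)) / f1 u.

Lemma ldGE s u : cmod u < 1 -> (1 + c) * ldG s u = lW s u * f1 u.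
Proof.
move=> u1; rewrite /ldG /lsg /lW rmorphB /=; field.
by rewrite c1_neq0 f1n.
Qed.

Lemma lW_near s u : cmod u < 1 -> 1 <= s -> cmod u ^+ 2 * s <= 1 ->
  cmod (lW s u - s%:C) <= k * s.
Proof.
move=> u1 s1 us; rewrite /lW addrC addKr cmodM cmodV ler_pdivrMr ?cmod_gt0 ?f1n//.
exact: ahlfors.
Qed.

Lemma lW_bounds s u : cmod u < 1 -> 1 <= s -> cmod u ^+ 2 * s <= 1 ->
  (1 - k) * s <= cmod (lW s u) <= (1 + k) * s.
Proof.
move=> u1 s1 us; have h := lW_near u1 s1 us.
have ss : cmod (s%:C : R[i]) = s by rewrite cmod_real ger0_norm//; klra.
have := cmod_subl (lW s u) s%:C; have := cmod_subl s%:C (lW s u).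
by rewrite (cmodC s%:C) ss => h1 h2; apply/andP; split; klra.
Qed.

Lemma lW_neq0 s u : cmod u < 1 -> 1 <= s -> cmod u ^+ 2 * s <= 1 -> lW s u != 0.
Proof.
move=> u1 s1 us; rewrite -cmod_gt0; have /andP[h _] := lW_bounds u1 s1 us.
by apply: lt_le_trans h; rewrite mulr_gt0; klra.
Qed.

Lemma ldG_neq0 s u : cmod u < 1 -> 1 <= s -> cmod u ^+ 2 * s <= 1 -> ldG s u != 0.
Proof.
move=> u1 s1 us; have : (1 + c) * ldG s u != 0.
  by rewrite ldGE// mulf_neq0 ?f1n// lW_neq0.
by rewrite mulf_eq0 negb_or => /andP[].
Qed.

Let kap := (1 - k) / (1 + k).

Lemma kap_gt0 : 0 < kap.
Proof. by rewrite divr_gt0; klra. Qed.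

Lemma kap_le1 : kap <= 1.
Proof. by rewrite ler_pdivrMr; klra. Qed.

(** The motion [- u / W] contracts faster than [s^(-1/2)] does: the real part of
    [s / W] exceeds [1/2] by a fixed amount, as [|W - s| <= k s] with [k < 1]. *)
Lemma contraction_factor (W : R[i]) (s d : R) : 1 <= s -> cmod (W - s%:C) <= k * s ->
  0 <= d -> d <= s -> d <= (1 - k) ^+ 2 * kap / 2 ->
  cmod (W - d%:C) <= cmod W * (1 - d * ((1 + kap / 2) / (2 * s))).
Proof.
move=> s1 Ws d0 ds dk; have s0 : 0 < s by klra.
have kp := kap_gt0; have kq := kap_le1.
set X := Re W; set Y := Im W.
have dsk : (X - s) ^+ 2 + Y ^+ 2 <= (k * s) ^+ 2.
  have := cmod_sqr (W - s%:C); rewrite re_sub im_sub /= subr0 -/X -/Y => <-.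
  rewrite lerXn2r ?nnegrE ?cmod_ge0//.
  by rewrite mulr_ge0//; klra.
have WE : cmod W ^+ 2 = X ^+ 2 + Y ^+ 2 by exact: cmod_sqr.
set N := cmod W in WE *.
have N1 : (1 - k) * s <= N.
  have := cmod_subl s%:C W; rewrite cmodC cmod_real (ger0_norm (ltW s0)) -/N.
  by move: Ws; klra.
have N2 : N <= (1 + k) * s.
  have := cmod_subl W s%:C; rewrite cmod_real (ger0_norm (ltW s0)) -/N.
  by move: Ws; klra.
have ks0 : 0 < (1 - k) * s by rewrite mulr_gt0//; klra.
have Npos : 0 < N by klra.
(* expanding |W - s|^2 <= k^2 s^2 gives 2 s X >= N^2 + (1 - k^2) s^2, and
   (1 - k^2) s^2 >= kap N^2 *)
have kapE : kap * (1 + k) = 1 - k by rewrite /kap divfK// gt_eqF//; klra.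
have NK : N ^+ 2 * kap <= s ^+ 2 * (1 - k ^+ 2).
  have e1 : N ^+ 2 <= ((1 + k) * s) ^+ 2.
    by rewrite lerXn2r ?nnegrE ?cmod_ge0// mulr_ge0//; klra.
  have := ler_wpM2r (ltW kp) e1.
  rewrite (_ : ((1 + k) * s) ^+ 2 * kap = s ^+ 2 * (1 - k ^+ 2))//.
  by rewrite (_ : 1 - k ^+ 2 = (kap * (1 + k)) * (1 + k)); [ring|rewrite kapE; ring].
have HX : N ^+ 2 * (1 + kap) <= 2 * s * X.
  by move: dsk; rewrite WE !exprMn in NK *; rewrite !expr2 in NK *; nra.
have N3 : (1 - k) ^+ 2 * s <= N ^+ 2 / s.
  rewrite ler_pdivlMr//; have : ((1 - k) * s) ^+ 2 <= N ^+ 2.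
    by rewrite lerXn2r ?nnegrE ?cmod_ge0// ltW.
  by rewrite exprMn expr2 mulrA.
have dN : d <= N ^+ 2 / s * (kap / 2).
  have e1 : (1 - k) ^+ 2 <= N ^+ 2 / s.
    apply: le_trans N3; rewrite ler_peMr// exprn_ge0//; klra.
  have := ler_wpM2r (ltW kp) e1; klra.
set b := (1 + kap / 2) / (2 * s).
have sb : s * b = (1 + kap / 2) / 2 by rewrite /b; field; rewrite gt_eqF.
have b0 : 0 < b by rewrite /b divr_gt0//; klra.
have db : d * b <= 1.
  have := ler_wpM2r (ltW b0) ds; rewrite sb; klra.
have rhs0 : 0 <= N * (1 - d * b) by apply: mulr_ge0; [exact: ltW|klra].
rewrite -(@ler_pXn2r _ 2)// ?nnegrE ?cmod_ge0//.
rewrite cmod_sqr re_sub im_sub /= subr0 -/X -/Y exprMn.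
have : d * (N ^+ 2 * (2 * b)) <= d * (2 * X - d).
  rewrite ler_wpM2l//.
  have e2 : N ^+ 2 * (2 * b) = N ^+ 2 / s + N ^+ 2 / s * (kap / 2).
    by rewrite /b; field; rewrite gt_eqF.
  have e3 : N ^+ 2 / s + N ^+ 2 / s * kap <= 2 * X.
    rewrite -(ler_pM2r s0) mulrDl divfK ?gt_eqF// mulrAC divfK ?gt_eqF//; klra.
  rewrite e2; klra.
have e4 : 0 <= N ^+ 2 * (d * b) ^+ 2 by rewrite mulr_ge0 ?sqr_ge0.
have e5 : N ^+ 2 * (1 - d * b) ^+ 2 = N ^+ 2 - d * (N ^+ 2 * (2 * b)) + N ^+ 2 * (d * b) ^+ 2.
  by ring.
rewrite e5; move: e4; rewrite WE => e4.
have -> : (X - d) ^+ 2 + Y ^+ 2 = X ^+ 2 + Y ^+ 2 - d * (2 * X - d) by ring.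
klra.
Qed.

(** An upper bound for the speed of the solutions: [|u / W| <= (1 - k)^-1], and the
    factor [2] leaves room for the error of a finite step. *)
Definition lK : R := 2 / (1 - k).

Lemma lK_gt0 : 0 < lK. Proof. by rewrite divr_gt0//; klra. Qed.

(** An explicit step [v - d v / W] of the Loewner equation, corrected to an exact
    solution by an error [eta d] which is small against the contraction. *)
Lemma Sol_step w s v : 1 <= s -> Sol w s v ->
  exists2 e : R, 0 < e & forall d, 0 <= d < e -> exists v',
    [/\ Sol w (s + d) v', cmod (v' - v) <= lK * d,
        cmod v' ^+ 2 * (s + d) <= cmod v ^+ 2 * s &
        v != 0 -> 0 < d -> cmod v' ^+ 2 * (s + d) < cmod v ^+ 2 * s].
Proof.
move=> s1 [v1 vs vw]; have s0 : 0 < s by klra.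
have [vz|vn0] := eqVneq v 0.
  exists 1 => // d /andP[d0 _]; exists 0; move: vw; rewrite vz lG0 => <-.
  rewrite /Sol cmod0 expr0n mul0r ler01 ltr01 lG0 subrr cmod0; split=> //.
  - by rewrite mulr_ge0// ltW// lK_gt0.
  - by rewrite mul0r.
have cv : 0 < cmod v by rewrite cmod_gt0.
have kp := kap_gt0; have kq := kap_le1.
have cc : 0 < cmod (1 + c) by rewrite cmod_gt0 c1_neq0.
pose eta := cmod v * (kap / (8 * s)).
have eta0 : 0 < eta by rewrite mulr_gt0// divr_gt0// mulr_gt0.
have ec0 : 0 < eta * cmod (1 + c) by rewrite mulr_gt0.
have G0 := ldG_neq0 v1 s1 vs.
have [D D0 hD] := param_solve (fd v1) (lpsid v1) G0 ec0.
have W0 := lW_neq0 v1 s1 vs; have cW : 0 < cmod (lW s v) by rewrite cmod_gt0.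
have /andP[W1 W2] := lW_bounds v1 s1 vs; have Wn := lW_near v1 s1 vs.
exists (Num.min (D * cmod (1 + c)) (Num.min s ((1 - k) ^+ 2 * kap / 2))) => [|d].
  have K2 : 0 < (1 - k) ^+ 2 by rewrite exprn_gt0//; klra.
  by rewrite !lt_min s0 mulr_gt0//= divr_gt0// mulr_gt0.
rewrite !lt_min => /andP[d0 /and3P[d1 d2 d3]].
have [|v' vG vv] := hD (lsg (s + d)).
  by rewrite cmod_lsgB addrC addKr ger0_norm// ltr_pdivrMr.
have E : (lsg (s + d) - lsg s) * lpsi v / ldG s v = d%:C * v / lW s v.
  rewrite lsgB addrC addKr.
  have -> : lW s v = (1 + c) * ldG s v / f1 v by rewrite ldGE// mulfK// f1n.
  by rewrite /lpsi; field; rewrite c1_neq0 G0 f1n.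
have sds : s + d - s = d by ring.
move: vv; rewrite -/(ldG s v) E cmod_lsgB sds ger0_norm//.
rewrite mulrA (mulrAC eta) mulfK ?gt_eqF// => vv.
have fac : cmod (lW s v - d%:C) <= cmod (lW s v) * (1 - d * ((1 + kap / 2) / (2 * s))).
  by apply: contraction_factor => //; exact: ltW.
have v'1 : cmod v' <= cmod v * (1 - d * ((1 + kap / 2) / (2 * s))) + eta * d.
  have := cmodD (v' - v + d%:C * v / lW s v) (v * ((lW s v - d%:C) / lW s v)).
  rewrite (_ : _ + _ = v'); last by field.
  rewrite [cmod (v * _)]cmodM cmodM cmodV => h; rewrite addrC.
  apply: le_trans h _; apply: lerD vv _; rewrite ler_wpM2l ?cmod_ge0//.
  by rewrite ler_pdivrMr// mulrC.
have [v'v sq3 strict] := shrink_factor kp kq s0 d0 (ltW d2) cv (cmod_ge0 v') v'1.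
exists v'; split=> //.
- by split; [exact: le_lt_trans v1|exact: le_trans vs|rewrite -vw].
have h : cmod (v' - v) <= eta * d + d * (cmod v / cmod (lW s v)).
  have -> : v' - v = v' - v + d%:C * v / lW s v - d%:C * v / lW s v by rewrite addrK.
  apply: le_trans (cmodB _ _) _; apply: lerD vv _.
  by rewrite !cmodM cmodV cmod_real ger0_norm// mulrA.
apply: le_trans h _; rewrite /lK (mulrC eta) -mulrDr mulrC ler_wpM2r//.
have km : 0 < 1 - k by rewrite subr_gt0.
have h1 : cmod v / cmod (lW s v) <= (1 - k)^-1.
  rewrite -[leRHS]mul1r; apply: ler_pM; [nonneg|nonneg|exact: ltW|].
  rewrite lef_pV2 ?posrE//; apply: le_trans W1; rewrite ler_peMr//; exact: ltW.
have h2 : eta <= (1 - k)^-1.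
  apply: (@le_trans _ _ 1); last by rewrite invf_ge1// lerBlDr lerDl.
  rewrite /eta; apply: mulr_ile1; rewrite ?cmod_ge0//.
  - by apply: divr_ge0; [exact: ltW|rewrite mulr_ge0// ltW].
  - exact: ltW.
  - rewrite ler_pdivrMr ?mulr_gt0// mul1r; apply: le_trans kq _.
    apply: (le_trans s1); apply: ler_peMl; [exact: ltW|exact: (ler1n R 8)].
by rewrite (_ : 2 = 1 + 1) // mulrDl mul1r lerD.
Qed.

Lemma tends_lsg (s : nat -> R) t : tends (fun n => (s n)%:C) t%:C ->
  tends (fun n => lsg (s n)) (lsg t).
Proof.
move=> h; rewrite /lsg mulrC.
apply: (tends_eq _ (tendsZ (1 + c)^-1 (_ : tends (fun n => (s n - 1)%:C) (t - 1)%:C))).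
  by move=> n; rewrite mulrC.
rewrite rmorphB; apply: (tends_eq _ (tendsB h (tends_cst 1))) => n.
by rewrite rmorphB.
Qed.

Lemma lG_tends (s : nat -> R) t (v : nat -> R[i]) l : cmod l < 1 ->
  tends (fun n => (s n)%:C) t%:C -> tends v l ->
  tends (fun n => lG (s n) (v n)) (lG t l).
Proof.
move=> l1 hs hv; apply: tendsD; first exact: sder_tends (fd l1) hv.
apply: tendsM; first exact: tends_lsg.
exact: sder_tends (lpsid l1) hv.
Qed.

Lemma tends_sqr_le (s : nat -> R) t (v : nat -> R[i]) l (m : R) :
  tends (fun n => (s n)%:C) t%:C -> tends v l -> 0 <= t ->
  (forall n, 0 <= s n) ->
  (forall n, cmod (v n) ^+ 2 * s n <= m) -> cmod l ^+ 2 * t <= m.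
Proof.
move=> hs hv t0 s0 h.
rewrite (_ : _ * t = cmod (l * l * t%:C)); last first.
  by rewrite !cmodM cmod_real ger0_norm// -expr2.
apply: tends_mod_le (tendsM (tendsM hv hv) hs) _ => n.
by rewrite !cmodM cmod_real ger0_norm// -expr2.
Qed.

(** The steps are joined by continuous induction, without uniqueness of solutions
    and without solving a differential equation. *)
Lemma Sol_push w s s' v : 1 <= s -> s <= s' -> Sol w s v -> exists v',
  [/\ Sol w s' v', cmod (v' - v) <= lK * (s' - s) &
      cmod v' ^+ 2 * s' <= cmod v ^+ 2 * s].
Proof.
move=> s1 ss' hv; have [v1 _ _] := hv.
have rad t v' : s <= t -> cmod v' ^+ 2 * t <= cmod v ^+ 2 * s -> cmod v' <= cmod v.
  move=> st h; have t0 : 0 < t by klra.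
  rewrite -(@ler_pXn2r _ 2)// ?nnegrE ?cmod_ge0// -(ler_pM2r t0).
  by apply: le_trans h _; rewrite ler_wpM2l// exprn_ge0 ?cmod_ge0.
apply: (real_induction (P := fun t => exists v', [/\ Sol w t v',
   cmod (v' - v) <= lK * (t - s) & cmod v' ^+ 2 * t <= cmod v ^+ 2 * s]) ss').
- by exists v; rewrite !subrr cmod0 mulr0.
- move=> t st [v' [h1 h2 h3]].
  have [e e0 he] := Sol_step (le_trans s1 st) h1.
  exists e => // d /he[v'' [g1 g2 g3 _]]; exists v''; split=> //; last exact: le_trans h3.
  by have := cmod_tri v' v'' v; klra.
- move=> u t st ut hu tu; have [v' hv'] := choice hu.
  have u1 n : 1 <= u n by have /andP[] := ut n; klra.
  have [|phi hphi [l hl]] := @bounded_subseq R v' 1.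
    by move=> n; have [[]] := hv' n => h _ _ _ _; exact: ltW.
  have tu' := tends_sub hphi tu.
  have m : cmod l ^+ 2 * t <= cmod v ^+ 2 * s.
    apply: (tends_sqr_le tu' hl); [klra| |].
      by move=> n /=; have := u1 (phi n); klra.
    by move=> n; have [] := hv' (phi n).
  have l1 : cmod l < 1 by apply: le_lt_trans v1; apply: rad m.
  exists l; split=> //.
    split=> //; first by apply: le_trans m _; have [] := hv.
    apply: tends_unique (lG_tends l1 tu' hl) _.
    by apply: tends_eq (tends_cst w) => n; have [[]] := hv' (phi n).
  apply: tends_le hl _ => n.
  have [_ h _] := hv' (phi n); apply: le_trans h _.
  apply: ler_wpM2l; first exact/ltW/lK_gt0.
  by have /andP[_] := ut (phi n); klra.
Qed.

Lemma Sol_push_strict w s s' v : 1 <= s -> s < s' -> Sol w s v -> exists v',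
  [/\ Sol w s' v', cmod (v' - v) <= lK * (s' - s) & cmod v' ^+ 2 * s' < 1].
Proof.
move=> s1 ss' hv.
have [v0|vn0] := eqVneq v 0.
  have [v' [h1 h2 h3]] := Sol_push s1 (ltW ss') hv; exists v'; split=> //.
  by apply: le_lt_trans h3 _; rewrite v0 cmod0 expr0n mul0r.
have [e e0 he] := Sol_step s1 hv.
pose d := Num.min (e / 2) (s' - s).
have d0 : 0 < d by rewrite lt_min subr_gt0 ss' andbT; klra.
have d1 : d <= e / 2 by rewrite ge_min lexx.
have d2 : d <= s' - s by rewrite ge_min lexx orbT.
have [|v' [h1 h2 _ /(_ vn0 d0) h4]] := he d; first by apply/andP; split; klra.
have [||v'' [g1 g2 g3]] := Sol_push _ _ h1 (s' := s'); [klra|klra|].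
exists v''; split=> //; first by have := cmod_tri v' v'' v; klra.
by have [_ h _] := hv; klra.
Qed.

(** For large [s] the map [lG s / lsg s] is a small perturbation of [lpsi], whose
    derivative at [0] is [1]; so it is close to the identity on a fixed disc. *)
Lemma large_strict : exists2 rho : R, 0 < rho <= 1 & exists2 S : R, 2 <= S &
  forall s x y, S <= s -> cmod x < rho -> cmod y < rho ->
    cmod ((lpsi x + (lsg s)^-1 * f x) - (lpsi y + (lsg s)^-1 * f y) - 1 * (x - y)) <=
      1 / 2 * cmod 1 * cmod (x - y).
Proof.
have c0 : cmod (0 : R[i]) < 1 by rewrite cmod0.
have e2 : 0 < 1 / 2 :> R by klra.
have := param_strict 0 (lpsid c0) (fd c0) e2.
rewrite f10 !mul0r !addr0 => -[d d0 hd].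
have cc : 0 < cmod (1 + c) by rewrite cmod_gt0 c1_neq0.
exists (Num.min d 1); first by rewrite lt_min d0 ltr01 ge_min lexx orbT.
exists (Num.max 2 (2 + cmod (1 + c) / d)); first by rewrite le_max lexx.
move=> s x y; rewrite ge_max => /andP[s1 s2]; rewrite !lt_min => /andP[x1 _] /andP[y1 _].
rewrite cmod1 mulr1; apply: hd; rewrite subr0//.
rewrite cmodV /lsg cmodM cmodV cmod_real.
have q0 : 0 < cmod (1 + c) / d by rewrite divr_gt0.
rewrite ger0_norm; last by klra.
rewrite invfM invrK mulrC ltr_pdivrMr; last by klra.
have : cmod (1 + c) = d * (cmod (1 + c) / d) by field; rewrite gt_eqF.
move=> e; rewrite {1}e ltr_pM2l//; klra.
Qed.

Lemma lsg_neq0 s : 1 < s -> lsg s != 0.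
Proof.
move=> s1; rewrite mulf_neq0 ?invr_eq0 ?c1_neq0//.
by rewrite -cmod_gt0 cmod_real normr_gt0 gt_eqF; klra.
Qed.

Lemma lGE s u : 1 < s -> lG s u = lsg s * (lpsi u + (lsg s)^-1 * f u).
Proof. by move=> s1; rewrite mulrDr mulVKf ?lsg_neq0// addrC. Qed.

Lemma small_of_large (rho s : R) u : 0 < rho -> rho ^- 2 < s -> cmod u ^+ 2 * s <= 1 ->
  cmod u < rho.
Proof.
move=> r0 rs us; have s0 : 0 < s by apply: lt_trans rs; rewrite invr_gt0 exprn_gt0.
rewrite ltNge; apply/negP => ru.
have : rho ^+ 2 * s <= 1.
  apply: le_trans us; rewrite ler_pM2r// lerXn2r ?nnegrE ?cmod_ge0//; exact: ltW.
by rewrite leNgt -ltr_pdivrMl ?exprn_gt0// mulr1 rs.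
Qed.

Lemma Sol_unique_large : exists2 S : R, 2 <= S & forall w s v v', S <= s ->
  Sol w s v -> Sol w s v' -> v = v'.
Proof.
have [rho /andP[r0 _] [S S2 hS]] := large_strict.
exists (Num.max S (rho ^- 2 + 1)); first by rewrite le_max S2.
move=> w s v v'; rewrite ge_max => /andP[s1 s2] [_ v2 v3] [_ v5 v6].
have s3 : rho ^- 2 < s by klra.
have := hS s v v' s1 (small_of_large r0 s3 v2) (small_of_large r0 s3 v5).
have : lpsi v + (lsg s)^-1 * f v = lpsi v' + (lsg s)^-1 * f v'.
  have s11 : 1 < s by klra.
  by apply: (mulfI (lsg_neq0 s11)); rewrite -!lGE// v3 v6.
move=> ->; rewrite subrr sub0r cmodN mul1r cmod1 mulr1 => h.
apply/eqP; rewrite -subr_eq0 -cmod_eq0 eq_le cmod_ge0 andbT; klra.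
Qed.

(** Newton's iteration started at [0]: its first step [w / lsg s] is of order
    [1 / s], well inside the disc of radius [s^(-1/2)]. *)
Lemma Sol_exists_large w : exists2 s : R, 1 <= s & exists v, Sol w s v.
Proof.
have [rho /andP[r0 r1] [S S2 hS]] := large_strict.
have cc : 0 < cmod (1 + c) by rewrite cmod_gt0 c1_neq0.
pose A := cmod w * cmod (1 + c).
have A0 : 0 <= A by rewrite /A; nonneg.
pose s := S + 16 * A ^+ 2 + 8 * A / rho.
have Ar : 0 <= 8 * A / rho by nonneg.
have A2 : 0 <= A ^+ 2 by nonneg.
have s2 : 2 <= s by rewrite /s; klra.
have sS : S <= s by rewrite /s; klra.
have s1 : 1 < s by klra.
have s0 : 0 < s by klra.
pose h x := lpsi x + (lsg s)^-1 * f x.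
have h0 : h 0 = 0 by rewrite /h f0 /lpsi mul0r mulr0 addr0.
have dE : cmod (w / lsg s - h 0) / cmod 1 = A / (s - 1).
  rewrite h0 subr0 cmod1 divr1 cmodM cmodV /lsg cmodM cmodV cmod_real ger0_norm; last by klra.
  by rewrite /A; field; rewrite !gt_eqF//; klra.
have As : A / (s - 1) <= 2 * A / s.
  rewrite ler_pdivrMr; last by klra.
  rewrite mulrAC ler_pdivlMr//.
  have : 0 <= A * (s - 2) by rewrite mulr_ge0//; klra.
  klra.
have [|x y x1 y1||x [x1 x2 _]] := @newton_solve R h 0 1 (w / lsg s) rho (1 / 2) (oner_neq0 _).
- by apply/andP; split; klra.
- by apply: hS => //; rewrite -[cmod _]/(cmod _) -[X in cmod X]subr0.
- rewrite dE.
  have : 2 * A / s < rho / 2.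
    rewrite ltr_pdivrMr//.
    have : rho * (8 * A / rho) = 8 * A by field; rewrite gt_eqF.
    have : rho * (8 * A / rho) <= rho * s.
      rewrite ler_pM2l// /s; klra.
    have : 0 < rho * s by rewrite mulr_gt0.
    klra.
  klra.
have xA : cmod x <= 4 * A / s by move: x2; rewrite subr0 dE; klra.
exists s; first exact: ltW.
have xr : cmod x < 1.
  apply: le_lt_trans xA _; rewrite ltr_pdivrMr//.
  have : 8 * A <= 8 * A / rho by rewrite ler_pdivlMr// ler_piMr//; nonneg.
  rewrite /s; klra.
exists x; split=> //.
  have : cmod x ^+ 2 <= (4 * A / s) ^+ 2 by rewrite lerXn2r ?nnegrE ?cmod_ge0//; nonneg.
  move=> /(ler_wpM2r (ltW s0)) h1; apply: le_trans h1 _.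
  rewrite (_ : (4 * A / s) ^+ 2 * s = 16 * A ^+ 2 / s); last by field; rewrite gt_eqF.
  by rewrite ler_pdivrMr// /s; klra.
by rewrite lGE// -/(h x) x1 mulrC divfK// lsg_neq0.
Qed.

(** Two solutions at the same time stay distinct at all later times, since the
    solutions are locally unique; but for large [s] there is at most one. *)
Lemma Sol_unique w s v v' : 1 <= s -> Sol w s v -> Sol w s v' -> v = v'.
Proof.
move=> s1 hv hv'; apply: contrapT => vv'.
have [S S2 hS] := Sol_unique_large.
pose rho := Num.max (cmod v) (cmod v').
have rho1 : rho < 1 by rewrite gt_max; have [-> _ _] := hv; have [-> _ _] := hv'.
pose P t := exists x : R[i] * R[i], [/\ x.1 <> x.2, Sol w t x.1, Sol w t x.2,
   cmod x.1 <= rho & cmod x.2 <= rho].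
have sS : s <= Num.max s S by rewrite le_max lexx.
suff : P (Num.max s S).
  move=> [[x y] /= [xy hx hy _ _]]; apply: xy; apply: (hS w (Num.max s S)) => //.
  by rewrite le_max lexx orbT.
have down x y (t d : R) : 0 < t -> 0 <= d ->
    cmod y ^+ 2 * (t + d) <= cmod x ^+ 2 * t -> cmod y <= cmod x.
  move=> t0 d0 h; rewrite -(@ler_pXn2r _ 2)// ?nnegrE ?cmod_ge0// -(ler_pM2r t0).
  apply: le_trans h; rewrite ler_wpM2l ?exprn_ge0 ?cmod_ge0//; klra.
apply: (real_induction sS).
- by exists (v, v'); split=> //=; rewrite le_max lexx ?orbT.
- move=> t st [[x y] /= [xy hx hy xr yr]]; have t1 : 1 <= t by klra.
  have [e e0 he] := Sol_step t1 hx; have [e' e'0 he'] := Sol_step t1 hy.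
  have D0 : 0 < cmod (x - y) by rewrite cmod_gt0 subr_eq0; apply/eqP.
  have K0 := lK_gt0.
  exists (Num.min (Num.min e e') (cmod (x - y) / (2 * lK))) => [|d].
    by rewrite !lt_min e0 e'0 divr_gt0// mulr_gt0.
  rewrite !lt_min => /andP[d0 /andP[/andP[d1 d2] d3]].
  have [|x' [x1 x2 x3 _]] := he d; first by rewrite d0.
  have [|y' [y1 y2 y3 _]] := he' d; first by rewrite d0.
  exists (x', y'); split=> //=.
  + move=> xy'; rewrite -xy' in y2.
    have K2 : 0 < 2 * lK by klra.
    move: d3; rewrite ltr_pdivlMr// => d3.
    by have := cmod_tri x' x y; rewrite (cmodC x x'); klra.
  + by apply: le_trans xr; apply: down x3 => //; klra.
  + by apply: le_trans yr; apply: down y3 => //; klra.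
- move=> u t st ut hu tu; have [x hx] := choice hu.
  have t1 : 1 <= t by klra.
  have u0 n : 0 <= u n by have /andP[] := ut n; klra.
  have [|phi hphi [l hl]] := @bounded_subseq R (fun n => (x n).1) rho.
    by move=> n; have [] := hx n.
  have [|psi hpsi [m hm]] := @bounded_subseq R (fun n => (x (phi n)).2) rho.
    by move=> n; have [] := hx (phi n).
  have {}hl := tends_sub hpsi hl.
  have hpp n : (n <= phi (psi n))%N by exact: leq_trans (hpsi n) (hphi _).
  have tu' := tends_sub hpp tu.
  have lr : cmod l <= rho by apply: tends_mod_le hl _ => n; have [] := hx (phi (psi n)).
  have mr : cmod m <= rho by apply: tends_mod_le hm _ => n; have [] := hx (phi (psi n)).
  have l1 : cmod l < 1 by klra.
  have m1 : cmod m < 1 by klra.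
  have sl : Sol w t l.
    split=> //.
      apply: (tends_sqr_le tu' hl) => [|n|n]; [klra|exact: u0|].
      by have [_ []] := hx (phi (psi n)).
    apply: tends_unique (lG_tends l1 tu' hl) _.
    by apply: tends_eq (tends_cst w) => n; have [_ []] := hx (phi (psi n)).
  have sm : Sol w t m.
    split=> //.
      apply: (tends_sqr_le tu' hm) => [|n|n]; [klra|exact: u0|].
      by have [_ _ []] := hx (phi (psi n)).
    apply: tends_unique (lG_tends m1 tu' hm) _.
    by apply: tends_eq (tends_cst w) => n; have [_ _ []] := hx (phi (psi n)).
  exists (l, m); split=> //= lm.
  have [_ l2 _] := sl.
  have [d d0 hd] := param_injective (fd l1) (lpsid l1) (ldG_neq0 l1 t1 l2).
  have [N hN] := tends_lsg tu' d0.
  have [N' hN'] := hl _ d0; rewrite -lm in hm; have [N'' hN''] := hm _ d0.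
  pose n := maxn N (maxn N' N'').
  have [xy [_ _ e1] [_ _ e2] _ _] := hx (phi (psi n)).
  apply: xy; apply: (hd (lsg (u (phi (psi n))))).
  + by apply: hN; exact: leq_maxl.
  + by apply: hN'; rewrite /n !leq_max leqnn orbT.
  + by apply: hN''; rewrite /n !leq_max leqnn !orbT.
  + by move: e1 e2; rewrite /lG => -> ->.
Qed.

(** * Boundary values *)

(** A bound for the second derivative that makes [f] continuous up to the
    boundary. *)
Hypothesis growth : forall u, cmod u < 1 -> cmod (f2 u) * (1 - cmod u) <= k * cmod (f1 u).

(** Along a radius, [|f1 (t u)|^2 (1 - t |u|)^(2 k)] is nonincreasing, by [growth]. *)
Lemma f1_growth u : cmod u < 1 -> cmod (f1 u) * (1 - cmod u) `^ k <= 1.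
Proof.
move=> u1; set r := cmod u; have r0 : 0 <= r by exact: cmod_ge0.
have r1 : r < 1 := u1.
have pos (t : R) : 0 <= t <= 1 -> 0 < 1 - t * r.
  by case/andP=> t0 t1; have : t * r <= 1 * r by [rewrite ler_wpM2r]; rewrite mul1r; lra.
have inD (t : R) : 0 <= t <= 1 -> cmod (0 + t%:C * u) < 1.
  move=> t01; have := pos t t01; case/andP: t01 => t0 t1.
  by rewrite add0r cmodM cmod_real ger0_norm// -/r; lra.
pose X (t : R) := Re (f1 (0 + t%:C * u)); pose Y (t : R) := Im (f1 (0 + t%:C * u)).
pose D (t : R) := f2 (0 + t%:C * u) * u.
have dX (t : R) : 0 <= t <= 1 -> is_derive t 1 X (Re (D t)).
  by move=> t01; have := rder_line_Re (rder_sder (f1d (inD t t01))); rewrite mul0r addr0.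
have dY (t : R) : 0 <= t <= 1 -> is_derive t 1 Y (Im (D t)).
  by move=> t01; have := rder_line_Im (rder_sder (f1d (inD t t01))); rewrite mul0r addr0.
pose q (t : R) := 1 - t * r.
have dq (t : R) : is_derive t 1 q (- r).
  apply: is_derive_eps => e e0; exists 1 => // s _.
  by rewrite /q (_ : _ - _ - _ = 0) ?normr0 ?mulr_ge0 ?(ltW e0)//; ring.
pose phi : R -> R := (X * X + Y * Y) * ((powR (R := R))^~ (k * 2) \o q).
have dphi (t : R) : 0 <= t <= 1 -> is_derive t 1 phi
   ((q t) `^ (k * 2 - 1) * (2 * (q t * (X t * Re (D t) + Y t * Im (D t)) -
      k * r * (X t ^+ 2 + Y t ^+ 2)))).
  move=> t01; have qt : 0 < q t := pos t t01.
  have d1 := is_deriveD (is_deriveM (dX t t01) (dX t t01)) (is_deriveM (dY t t01) (dY t t01)).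
  have d2 := is_derive1_comp (is_derive1_powR (k * 2) qt) (dq t).
  apply: (is_derive_eq (is_deriveM d1 d2)); rewrite !fctE /=.
  have -> : (q t) `^ (k * 2) = q t * (q t) `^ (k * 2 - 1).
    have := @powRD R (q t) 1 (k * 2 - 1).
    by rewrite (gt_eqF qt) implybT (powRr1 (ltW qt)) addrC subrK; apply.
  rewrite /= -![_ *: _]/(_ * _) /=; ring.
have phiE t : phi t = cmod (f1 (0 + t%:C * u)) ^+ 2 * (1 - t * r) `^ (k * 2).
  by rewrite cmod_sqr !expr2.
have phi0 : phi 0 = 1.
  have -> : phi 0 = cmod (f1 0) ^+ 2 * (1 - 0 * r) `^ (k * 2).
    by rewrite phiE; congr (cmod (f1 _) ^+ 2 * _); rewrite mul0r addr0.
  by rewrite f10 cmod1 mul0r subr0 powR1 expr1n mulr1.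
have phi1 : phi 1 = (cmod (f1 u) * (1 - r) `^ k) ^+ 2.
  have -> : phi 1 = cmod (f1 u) ^+ 2 * (1 - 1 * r) `^ (k * 2).
    by rewrite phiE; congr (cmod (f1 _) ^+ 2 * _); rewrite mul1r add0r.
  by rewrite mul1r exprMn powRrM powR_mulrn ?powR_ge0.
have der t : t \in `]0, 1[%R -> derivable phi t 1.
  rewrite in_itv/= => /andP[t0 t1]; have t01 : 0 <= t <= 1 by rewrite !ltW.
  exact: (@ex_derive _ _ _ _ _ _ _ (dphi t t01)).
have dec t : t \in `]0, 1[%R -> phi^`()%classic t <= 0.
  rewrite in_itv/= => /andP[t0 t1]; have t01 : 0 <= t <= 1 by rewrite !ltW.
  rewrite derive1E (@derive_val _ _ _ _ _ _ _ (dphi t t01)).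
  have qt : 0 < q t := pos t t01.
  rewrite mulr_ge0_le0 ?powR_ge0// mulr_ge0_le0// subr_le0.
  set W := f1 (0 + t%:C * u).
  have -> : X t * Re (D t) + Y t * Im (D t) = Re (W^* * D t).
    by rewrite /X /Y -/W; case: (W) (D t) => a b [a' b'] /=; ring.
  have -> : X t ^+ 2 + Y t ^+ 2 = cmod W ^+ 2 by rewrite cmod_sqr.
  have h1 := le_trans (ler_norm _) (Re_cmod (W^* * D t)).
  rewrite cmodM cmodJ in h1.
  have h2 := growth (inD t t01).
  have e1 : cmod (0 + t%:C * u) = t * r.
    by rewrite add0r cmodM cmod_real ger0_norm// ltW.
  rewrite e1 -/(q t) -/W in h2.
  have h3 : q t * cmod (D t) <= k * r * cmod W.
    by rewrite /D cmodM -/r; have := ler_wpM2r r0 h2; lra.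
  have h4 := ler_wpM2l (ltW qt) h1.
  have h5 := ler_wpM2l (cmod_ge0 W) h3.
  rewrite expr2; lra.
have cont : {within `[0, 1], continuous phi}.
  apply: derivable_within_continuous => t; rewrite in_itv/= => t01.
  exact: (@ex_derive _ _ _ _ _ _ _ (dphi t t01)).
have i0 : (0 : R) \in `[0, 1]%R by rewrite in_itv/= lexx ler01.
have i1 : (1 : R) \in `[0, 1]%R by rewrite in_itv/= lexx ler01.
have := ler0_derive1_le_cc der dec cont i1 i0 ler01.
rewrite phi0 phi1 -[leRHS](expr1n _ 2) ler_pXn2r// nnegrE//.
by rewrite mulr_ge0 ?cmod_ge0 ?powR_ge0.
Qed.

Let al := 1 - k.

Lemma al_gt0 : 0 < al. Proof. by rewrite subr_gt0 k1. Qed.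

Definition holder (x : R) := 2 / al * x `^ al.

Lemma holder_small (e : R) : 0 < e ->
  exists2 d : R, 0 < d & forall x : R, 0 <= x -> x < d -> holder x < e.
Proof.
move=> e0; have a0 := al_gt0.
have e1 : 0 < e * (al / 2) by rewrite mulr_gt0// divr_gt0.
have [d d0 hd] := powR_small a0 e1; exists d => // x x0 /(hd _ x0) h.
rewrite /holder (_ : e = 2 / al * (e * (al / 2))); last by field; rewrite gt_eqF.
by rewrite ltr_pM2l// divr_gt0.
Qed.

(** By [f1_growth] the derivative along a radius is at most [(1 - t)^(- k)], which
    is integrable because [k < 1]. *)
Lemma f_radial z (a b : R) : cmod z <= 1 -> 0 <= a -> a <= b -> b <= 1 -> b * cmod z < 1 ->
  cmod (f (b%:C * z) - f (a%:C * z)) <= holder (1 - a).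
Proof.
move=> z1 a0 ab b1 bz; have aa := al_gt0.
have zz := cmod_ge0 z.
have inD (t : R) : 0 <= t <= b -> cmod (0 + t%:C * z) < 1.
  case/andP=> t0 tb; rewrite add0r cmodM cmod_real ger0_norm//.
  by apply: le_lt_trans bz; rewrite ler_wpM2r.
pose M (t : R) := al^-1 * - oddpow al (1 - t).
have cM : continuous M.
  move=> t; apply: cvgM; first exact: cvg_cst.
  apply: cvgN; apply: (@continuous_comp _ _ _ (fun t : R => 1 - t) (oddpow al)).
    by apply: cvgB; [exact: cvg_cst|exact: cvg_id].
  exact: oddpow_continuous.
have dM (t : R) : t < 1 -> is_derive t 1 M ((1 - t) `^ (al - 1)).
  move=> t1; have t2 : 1 - t != 0 by rewrite gt_eqF// subr_gt0.
  have dq : is_derive t 1 (fun s : R => 1 - s) (- 1).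
    apply: is_derive_eps => e e0; exists 1 => // s _.
    by rewrite (_ : _ - _ - _ = 0) ?normr0 ?mulr_ge0 ?(ltW e0)//; ring.
  have := is_deriveZ al^-1 (is_deriveN (@is_derive1_comp _ _ (fun s : R => 1 - s) _ _ _ (oddpow_derive aa t2) dq)).
  move=> /is_derive_eq; apply.
  rewrite -[_ *: _]/(_ * _) mulrN1 opprK mulKf ?gt_eqF//.
  by rewrite ger0_norm// subr_ge0 ltW.
have bound (dF : R -> R) (F : R -> R) :
    (forall t, 0 <= t <= b -> is_derive t 1 F (dF t)) ->
    (forall t, 0 <= t <= b -> `|dF t| <= cmod (f1 (0 + t%:C * z) * z)) ->
    `|F b - F a| <= al^-1 * (1 - a) `^ al.
  move=> dF1 dF2.
  have : `|F b - F a| <= M b - M a.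
    apply: (derivable_le ab _ cM (dh := dF) (dM := fun t => (1 - t) `^ (al - 1))).
      apply: derivable_within_continuous => t; rewrite in_itv/= => /andP[at_ tb].
      have t0b : 0 <= t <= b by rewrite tb (le_trans a0 at_).
      exact: (@ex_derive _ _ _ _ _ _ _ (dF1 t t0b)).
    move=> t /andP[at_ tb]; have t0 : 0 <= t by lra.
    have t0b : 0 <= t <= b by rewrite t0 ltW.
    have t1 : t < 1 by lra.
    split; [exact: dF1|exact: dM|apply: le_trans (dF2 _ t0b) _].
    have := f1_growth (inD t t0b); set w := cmod (f1 _).
    have w0 : 0 <= w by exact: cmod_ge0.
    rewrite cmodM -/w add0r cmodM cmod_real ger0_norm// => h.
    have q0 : 0 < 1 - t by lra.
    have tz : t * cmod z <= t by rewrite ler_piMr.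
    have h2 : (1 - t) `^ k <= (1 - t * cmod z) `^ k.
      by apply: ge0_ler_powR; rewrite ?nnegrE ?k0//; lra.
    rewrite /al addrAC subrr sub0r powRN.
    rewrite -[leRHS]mul1r ler_pdivlMr ?powR_gt0//.
    apply: le_trans h; apply: ler_pM; rewrite ?powR_ge0//; first by nonneg.
    by rewrite ler_piMr.
  move=> h; apply: le_trans h _; rewrite /M -mulrBr opprK.
  rewrite ler_wpM2l ?invr_ge0 ?(ltW aa)// !oddpow_ge0 ?subr_ge0//; last exact: le_trans b1.
  by rewrite addrC lerBlDr lerDl powR_ge0.
have hRe := bound (fun t => Re (f1 (0 + t%:C * z) * z)) (fun t => Re (f (0 + t%:C * z))).
have hIm := bound (fun t => Im (f1 (0 + t%:C * z) * z)) (fun t => Im (f (0 + t%:C * z))).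
apply: le_trans (cmod_ReIm _) _; rewrite re_sub im_sub.
have -> : holder (1 - a) = al^-1 * (1 - a) `^ al + al^-1 * (1 - a) `^ al.
  by rewrite /holder; field; rewrite gt_eqF.
rewrite -[f (b%:C * z)](_ : f (0 + b%:C * z) = _) ?add0r//.
apply: lerD.
  have := hRe; rewrite !add0r; apply => t t0b; last exact: Re_cmod.
  by have := rder_line_Re (rder_sder (fd (inD t t0b))); rewrite mul0r addr0.
have := hIm; rewrite !add0r; apply => t t0b; last exact: Im_cmod.
by have := rder_line_Im (rder_sder (fd (inD t t0b))); rewrite mul0r addr0.
Qed.

Lemma tends_eventually (u v : nat -> R[i]) l :
  (exists N, forall n, (N <= n)%N -> u n = v n) -> tends u l -> tends v l.
Proof.
move=> [N uv] hu e /hu[M hM]; exists (maxn N M) => n; rewrite geq_max => /andP[n1 n2].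
by rewrite -uv//; exact: hM.
Qed.

Definition rn (n : nat) : R := 1 - n.+1%:R^-1.

Lemma rn01 n : 0 <= rn n < 1.
Proof.
have h : 0 < n.+1%:R^-1 :> R by rewrite invr_gt0.
have h2 : n.+1%:R^-1 <= 1 :> R by rewrite invf_le1// ler1n.
by rewrite /rn subr_ge0 h2 gtrBl h.
Qed.

Lemma rn_close (e : R) : 0 < e -> exists N, forall n, (N <= n)%N -> 1 - rn n < e.
Proof.
move=> e0; exists (Num.truncn e^-1) => n Nn; rewrite /rn opprB addrCA subrr addr0.
rewrite -[ltRHS]invrK ltf_pV2 ?posrE ?invr_gt0//.
by apply: lt_le_trans (truncnS_gt _) _; rewrite ler_nat.
Qed.

Lemma tends_rn z : tends (fun n => (rn n)%:C * z) z.
Proof.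
move=> e e0; have z0 := cmod_ge0 z.
have e1 : 0 < e / (cmod z + 1) by rewrite divr_gt0//; lra.
have [N hN] := rn_close e1; exists N => n /hN; rewrite ltr_pdivlMr; last by lra.
move=> h; have -> : (rn n)%:C * z - z = (rn n - 1)%:C * z.
  by rewrite (rmorphB (real_complex R) (rn n) 1) mulrBl rmorph1 mul1r.
have /andP[_ r1] := rn01 n.
rewrite cmodM cmod_real distrC ger0_norm ?subr_ge0 ?(ltW r1)//.
by apply: le_lt_trans h; rewrite ler_wpM2l ?lerDl// subr_ge0 ltW.
Qed.

Lemma rn_disc n z : cmod z <= 1 -> cmod ((rn n)%:C * z) < 1.
Proof.
move=> z1; case/andP: (rn01 n) => r0 r1; rewrite cmodM cmod_real ger0_norm//.
by apply: le_lt_trans r1; rewrite ler_piMr.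
Qed.

(** The radial limit, which serves as boundary value on the circle. *)
Definition fbar z : R[i] :=
  xget 0 [set l | tends (fun n => f ((rn n)%:C * z)) l].

Lemma fbarP z : cmod z <= 1 -> tends (fun n => f ((rn n)%:C * z)) (fbar z).
Proof.
move=> z1; suff [l hl] : exists l, tends (fun n => f ((rn n)%:C * z)) l by exact: (xgetPex 0 (ex_intro _ l hl)).
apply: cauchy_tends => e e0; have [d d0 hd] := holder_small e0.
have [N hN] := rn_close d0; exists N => n m Nn Nm.
have aux p q : rn p <= rn q -> (N <= p)%N -> cmod (f ((rn q)%:C * z) - f ((rn p)%:C * z)) < e.
  move=> pq Np; have /andP[p0 p1] := rn01 p; have /andP[q0 q1] := rn01 q.
  have := f_radial z1 p0 pq (ltW q1) _ => /(_ _)/le_lt_trans; apply.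
    by apply: le_lt_trans q1; rewrite ler_piMr.
  by apply: hd; [rewrite subr_ge0 ltW|exact: hN].
have [nm|mn] := leP (rn n) (rn m); last by apply: aux => //; exact: ltW.
by rewrite cmodC; exact: aux.
Qed.

Lemma fbar_in z : cmod z < 1 -> fbar z = f z.
Proof.
move=> z1; apply: tends_unique (fbarP (ltW z1)) _.
exact: sder_tends (fd z1) (tends_rn z).
Qed.

Lemma fbar_radial z (a : R) : cmod z <= 1 -> 0 <= a < 1 ->
  cmod (fbar z - f (a%:C * z)) <= holder (1 - a).
Proof.
move=> z1 /andP[a0 a1]; have a2 : 0 < 1 - a by rewrite subr_gt0.
have [N hN] := rn_close a2.
have hs : forall n, (n <= n + N)%N by move=> n; exact: leq_addr.
apply: (tends_le (tends_sub hs (fbarP z1))) => n /=.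
have /andP[q0 q1] := rn01 (n + N).
apply: f_radial => //; last by apply: le_lt_trans q1; rewrite ler_piMr.
- by have := hN (n + N)%N (leq_addl _ _); lra.
- exact: ltW.
Qed.

Lemma fbar_tends (u : nat -> R[i]) l : (forall n, cmod (u n) <= 1) -> cmod l <= 1 ->
  tends u l -> tends (fun n => fbar (u n)) (fbar l).
Proof.
move=> u1 l1 hu e e0; have e3 : 0 < e / 3 by lra.
have [d d0 hd] := holder_small e3.
pose a := Num.max 0 (1 - d / 2).
have a1 : a < 1 by rewrite gt_max ltr01; lra.
have a0 : 0 <= a by rewrite le_max lexx.
have ha : holder (1 - a) < e / 3.
  apply: hd; first by rewrite subr_ge0 ltW.
  by have : 1 - d / 2 <= a by [rewrite le_max lexx orbT]; lra.
have al1 : cmod (a%:C * l) < 1.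
  by rewrite cmodM cmod_real ger0_norm//; apply: le_lt_trans a1; rewrite ler_piMr.
have [N hN] := sder_tends (fd al1) (tendsZ a%:C hu) e3.
exists N => n /hN h.
have a01 : 0 <= a < 1 by rewrite a0.
have h1 := fbar_radial (u1 n) a01; have h2 := fbar_radial l1 a01.
rewrite (_ : fbar (u n) - fbar l = (fbar (u n) - f (a%:C * u n)) +
  (f (a%:C * u n) - f (a%:C * l)) + (f (a%:C * l) - fbar l)); last by ring.
by apply: le_lt_trans (cmodD3 _ _ _) _; rewrite (cmodC _ (fbar l)); lra.
Qed.

(** The term [lsg s * lpsi v] of [lG s v] is at most of order
    [(s - 1) * (1 - |v|)^(- k)], and [1 - |v|] is at least of order [s - 1]. *)
Lemma lG_boundary v (s : R) : cmod v < 1 -> 1 <= s <= 2 -> cmod v ^+ 2 * s <= 1 ->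
  cmod (lG s v - f v) <= 4 / cmod (1 + c) * (s - 1) `^ al.
Proof.
move=> v1 /andP[s1 s2] vs; have v0 := cmod_ge0 v.
have cc : 0 < cmod (1 + c) by rewrite cmod_gt0 c1_neq0.
rewrite /lG addrC addKr /lsg /lpsi !cmodM cmodV cmod_real ger0_norm ?subr_ge0//.
have [->|sn1] := eqVneq s 1.
  by rewrite subrr !mul0r mulr_ge0 ?powR_ge0// divr_ge0// ltW.
have sp : 0 < s - 1 by rewrite subr_gt0 lt_neqAle eq_sym sn1.
have far : (s - 1) / 4 <= 1 - cmod v.
  have : cmod v ^+ 2 <= 1 - (s - 1) / 2.
    rewrite -(@ler_pM2r _ s)//; last by lra.
    by apply: le_trans vs _; nra.
  have : (1 - cmod v) * (1 + cmod v) <= (1 - cmod v) * 2 by rewrite ler_wpM2l//; lra.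
  rewrite expr2; lra.
have h1 := f1_growth v1.
have h2 : cmod (f1 v) * ((s - 1) / 4) `^ k <= 1.
  apply: le_trans h1; rewrite ler_wpM2l ?cmod_ge0//.
  by apply: ge0_ler_powR; rewrite ?nnegrE ?k0//; lra.
have h3 : 4 `^ (- k) >= 4^-1 :> R.
  rewrite powRN lef_pV2 ?posrE ?powR_gt0//.
  by have := @ler1_powR R 4 k; apply; klra.
have h4 : (s - 1) `^ k * cmod (f1 v) <= 4.
  have e4 : ((s - 1) / 4) `^ k = (s - 1) `^ k * 4 `^ (- k).
    by rewrite powRM ?invr_ge0 ?(ltW sp)// -powR_inv1// -powRrM mulN1r.
  rewrite e4 in h2.
  have e5 : (s - 1) `^ k * cmod (f1 v) * 4^-1 <= (s - 1) `^ k * cmod (f1 v) * 4 `^ (- k).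
    by rewrite ler_wpM2l// mulr_ge0 ?powR_ge0 ?cmod_ge0.
  lra.
have e6 : s - 1 = (s - 1) `^ al * (s - 1) `^ k.
  have := @powRD R (s - 1) al k; rewrite (gt_eqF sp) implybT => <-//.
  by rewrite /al subrK powRr1// ltW.
have h5 : cmod v * cmod (f1 v) <= cmod (f1 v) by rewrite ler_piMl ?cmod_ge0// ltW.
apply: (@le_trans _ _ ((s - 1) / cmod (1 + c) * cmod (f1 v))).
  by rewrite ler_wpM2l// divr_ge0// ltW.
rewrite {1}e6 (_ : _ * _ = (s - 1) `^ al / cmod (1 + c) * ((s - 1) `^ k * cmod (f1 v))); last by ring.
rewrite (_ : 4 / _ * _ = (s - 1) `^ al / cmod (1 + c) * 4); last by ring.
by rewrite ler_wpM2l// divr_ge0 ?powR_ge0// ltW.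
Qed.

(** * The extension to the plane *)

(** A point [z] of the plane is encoded by a time [sz z] and by a point [vz z] of
    the closed disc, the reflection of [z] in the unit circle when [z] is outside;
    [F z] is then [lG (sz z) (vz z)], up to boundary values. *)
Definition vz z := if cmod z <= 1 then z else (z^*)^-1.
Definition sz z : R := Num.max 1 (cmod z ^+ 2).

Definition F z := if cmod z <= 1 then fbar z else lG (cmod z ^+ 2) (z^*)^-1.

Lemma F_in z : cmod z < 1 -> F z = f z.
Proof. by move=> z1; rewrite /F (ltW z1) fbar_in. Qed.

Lemma sz_in z : cmod z <= 1 -> sz z = 1.
Proof. by move=> z1; rewrite /sz max_l// exprn_ile1// cmod_ge0. Qed.

Lemma sz_out z : 1 < cmod z -> sz z = cmod z ^+ 2.
Proof. by move=> z1; rewrite /sz max_r// ltW// exprn_egt1. Qed.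

Lemma sz_ge1 z : 1 <= sz z. Proof. by rewrite le_max lexx. Qed.

Lemma cmod_vz_out z : 1 < cmod z -> cmod (vz z) = (cmod z)^-1.
Proof. by move=> z1; rewrite /vz leNgt z1 /= cmodV cmodJ. Qed.

Lemma vz_le1 z : cmod (vz z) <= 1.
Proof.
have [z1|z1] := leP (cmod z) 1; first by rewrite /vz z1.
by rewrite cmod_vz_out// invf_le1 ?ltW// (lt_trans ltr01).
Qed.

Lemma F_out z : 1 < cmod z -> F z = lG (sz z) (vz z).
Proof. by move=> z1; rewrite /F /vz sz_out// leNgt z1. Qed.

Lemma Sol_out z : 1 < cmod z ->
  Sol (F z) (sz z) (vz z) /\ cmod (vz z) ^+ 2 * sz z = 1.
Proof.
move=> z1; have z0 : 0 < cmod z by rewrite (lt_trans ltr01).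
have e : cmod (vz z) ^+ 2 * sz z = 1.
  by rewrite cmod_vz_out// sz_out// exprVn mulVf// expf_neq0// gt_eqF.
split=> //; split; [by rewrite cmod_vz_out// invf_lt1|by rewrite e|by rewrite F_out].
Qed.

Lemma sqr_cmod_le1 x : cmod x < 1 -> cmod x ^+ 2 * 1 <= 1.
Proof. by move=> x1; rewrite mulr1 exprn_ile1 ?cmod_ge0// ltW. Qed.

(** Every point of the plane starts a solution that moves with bounded speed. On the
    unit circle, where [Sol] does not hold at the initial time, it is a limit of
    solutions started at [(rn n)%:C * z]. *)
Lemma F_push z (s' : R) : sz z < s' -> exists v',
  [/\ Sol (F z) s' v', cmod v' ^+ 2 * s' < 1 & cmod (v' - vz z) <= lK * (s' - sz z)].
Proof.
move=> ss'; have [z1|] := leP (cmod z) 1; last first.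
  move=> z1; have [h1 h2] := Sol_out z1.
  have [v' [g1 g2 g3]] := Sol_push_strict (sz_ge1 z) ss' h1.
  by exists v'.
have vE : vz z = z by rewrite /vz z1.
have FE : F z = fbar z by rewrite /F z1.
rewrite vE FE; move: ss'; rewrite sz_in// => s1.
pose s2 := (1 + s') / 2.
have s12 : 1 < s2 by rewrite /s2; lra.
have s23 : s2 < s' by rewrite /s2; lra.
have hs n : Sol (f ((rn n)%:C * z)) 1 ((rn n)%:C * z).
  have h := rn_disc n z1; split; rewrite ?lG1//; exact: sqr_cmod_le1.
have hv n := Sol_push (lexx 1) (ltW s12) (hs n).
have [v hv'] := choice hv.
have [|phi hphi [l hl]] := @bounded_subseq R v 1.
  by move=> n; have [[h _ _] _ _] := hv' n; exact: ltW.
have ls : cmod l ^+ 2 * s2 <= 1.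
  apply: (tends_sqr_le (tends_cst s2%:C) hl) => [|n|n]; [lra|lra|].
  by have [[]] := hv' (phi n).
have l1 : cmod l < 1.
  rewrite ltNge; apply/negP => l1; have : 1 <= cmod l ^+ 2 by rewrite exprn_ege1.
  move=> h; have : 1 * s2 <= cmod l ^+ 2 * s2 by rewrite ler_wpM2r//; lra.
  lra.
have hl2 : lG s2 l = fbar z.
  apply: tends_unique (lG_tends l1 (tends_cst s2%:C) hl) _.
  apply: tends_eq (tends_sub hphi (fbarP z1)) => n /=.
  by have [[_ _ h] _ _] := hv' (phi n); rewrite h.
have lz : cmod (l - z) <= lK * (s2 - 1).
  apply: tends_mod_le (tendsB hl (tends_sub hphi (tends_rn z))) _ => n /=.
  by have [_ h _] := hv' (phi n).
have sl : Sol (fbar z) s2 l by [].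
have [v' [g1 g2 g3]] := Sol_push_strict (ltW s12) s23 sl.
exists v'; split=> //.
by have := cmod_tri l v' z; lra.
Qed.

Lemma vz_sz_inj z w : vz z = vz w -> sz z = sz w -> z = w.
Proof.
have inj_out x : 1 < cmod x -> x = ((vz x)^*)^-1.
  by move=> x1; rewrite /vz leNgt x1 /= conj_inv_involutive.
move=> hv hs; have [z1|z1] := leP (cmod z) 1; have [w1|w1] := leP (cmod w) 1.
- by move: hv; rewrite /vz z1 w1.
- have : 1 < sz w by rewrite sz_out// exprn_egt1.
  by rewrite -hs sz_in// ltxx.
- have : 1 < sz z by rewrite sz_out// exprn_egt1.
  by rewrite hs sz_in// ltxx.
- by rewrite (inj_out z z1) (inj_out w w1) hv.
Qed.

(** Points with the same image start solutions of the same equation, which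
    coincide at later times; so the points have the same time, as a point of
    the plane starts on the moving circle and not inside it, and then they are
    arbitrarily close. *)
Lemma F_inj z w : F z = F w -> z = w.
Proof.
have lt_case x y : F x = F y -> sz x < sz y -> False.
  move=> Fxy xy; have [v' [h1 h2 _]] := F_push xy.
  have y1 : 1 < cmod y.
    by rewrite ltNge; apply/negP => y1; move: xy; rewrite (sz_in y1) ltNge sz_ge1.
  have [g1 g2] := Sol_out y1; rewrite Fxy in h1.
  have E := Sol_unique (sz_ge1 y) h1 g1.
  by move: h2; rewrite E g2 ltxx.
move=> Fzw; have [zw|wz|E] := ltgtP (sz z) (sz w).
- by case: (lt_case _ _ Fzw zw).
- by case: (lt_case _ _ (esym Fzw) wz).
apply: vz_sz_inj => //; apply/eqP; rewrite -subr_eq0 -cmod_eq0 eq_le cmod_ge0 andbT.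
have K0 := lK_gt0.
apply/ler_addgt0Pr => e e0; rewrite add0r.
pose d := e / (2 * lK); have d0 : 0 < d by rewrite divr_gt0//; lra.
have zs : sz z < sz z + d by rewrite ltrDl.
have ws : sz w < sz z + d by rewrite E ltrDl.
have [v1 [h1 _ h2]] := F_push zs; have [v2 [g1 _ g2]] := F_push ws.
rewrite -Fzw in g1; have s1 : 1 <= sz z + d by have := sz_ge1 z; lra.
have E2 := Sol_unique s1 h1 g1; rewrite -E2 -E in g2.
have := cmod_tri v1 (vz z) (vz w); rewrite (cmodC (vz z) v1).
have : lK * (sz z + d - sz z) = e / 2 by rewrite /d; field; rewrite gt_eqF.
move: h2 g2; lra.
Qed.

Lemma tends_conj (u : nat -> R[i]) l : tends u l -> tends (fun n => (u n)^*) l^*.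
Proof.
move=> hu e /hu[N hN]; exists N => n /hN h.
by rewrite -rmorphB cmodJ.
Qed.

Lemma tends_cmod_sqr (u : nat -> R[i]) l : tends u l ->
  tends (fun n => (cmod (u n) ^+ 2)%:C) (cmod l ^+ 2)%:C.
Proof.
move=> hu; have := tendsM (tends_cmod hu) (tends_cmod hu).
rewrite -rmorphM -expr2; apply: tends_eq => n.
by rewrite -rmorphM -expr2.
Qed.

Lemma tends_real_lt (u : nat -> R) l (x : R) : tends (fun n => (u n)%:C) l%:C ->
  l < x -> exists N, forall n, (N <= n)%N -> u n < x.
Proof.
move=> hu lx; have [|N hN] := hu (x - l); first by rewrite subr_gt0.
exists N => n /hN; rewrite -rmorphB cmod_real ltr_norml => /andP[_].
by rewrite ltrD2r.
Qed.

Lemma tends_real_gt (u : nat -> R) l (x : R) : tends (fun n => (u n)%:C) l%:C ->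
  x < l -> exists N, forall n, (N <= n)%N -> x < u n.
Proof.
move=> hu lx; have [|N hN] := hu (l - x); first by rewrite subr_gt0.
exists N => n /hN; rewrite -rmorphB cmod_real ltr_norml => /andP[+ _].
by rewrite opprB ltrD2r.
Qed.

Lemma F_close z : sz z <= 2 ->
  cmod (F z - fbar (vz z)) <= 4 / cmod (1 + c) * (sz z - 1) `^ al.
Proof.
move=> s2; have cc : 0 < cmod (1 + c) by rewrite cmod_gt0 c1_neq0.
have [z1|z1] := leP (cmod z) 1.
  rewrite /F /vz z1 subrr cmod0; apply: mulr_ge0; last exact: powR_ge0.
  by rewrite divr_ge0// ltW.
have [[h1 h2 _] _] := Sol_out z1.
by rewrite fbar_in// F_out//; apply: lG_boundary; rewrite ?sz_ge1.
Qed.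

(** On the unit circle, [F z] is close to [fbar (vz z)] by [F_close], and [vz z] is
    close to [z]. *)
Lemma F_tends (u : nat -> R[i]) l : tends u l -> tends (fun n => F (u n)) (F l).
Proof.
move=> hu; have hc := tends_cmod hu.
have [l1|l1|l1] := ltgtP (cmod l) 1.
- have [N hN] := tends_real_lt hc l1.
  rewrite F_in//; apply: tends_eventually (sder_tends (fd l1) hu).
  by exists N => n /hN h; rewrite F_in.
- have [N hN] := tends_real_gt hc l1.
  have l0 : l^* != 0 by rewrite conjc_eq0 -cmod_gt0 (lt_trans ltr01).
  have [[v1 _ _] _] := Sol_out l1.
  rewrite F_out// sz_out//.
  have hv : tends (fun n => ((u n)^*)^-1) (vz l).
    rewrite /vz leNgt l1 /=.
    exact: sder_tends (sder_inv l0) (tends_conj hu).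
  apply: tends_eventually (lG_tends v1 (tends_cmod_sqr hu) hv).
  by exists N => n /hN h; rewrite F_out// sz_out// /vz leNgt h.
have FE : F l = fbar l by rewrite /F l1 lexx.
rewrite FE => e e0; have e2 : 0 < e / 2 by lra.
have hs : tends (fun n => (sz (u n))%:C) 1.
  move=> d d0; have [N hN] := tends_cmod_sqr hu d0; exists N => n /hN.
  rewrite l1 expr1n -!rmorphB !cmod_real /sz.
  have [h|h] := leP (cmod (u n) ^+ 2) 1; last by [].
  by rewrite subrr normr0.
have hv : tends (fun n => vz (u n)) l.
  move=> d d0; have d2 : 0 < d / 2 by lra.
  have [N hN] := hu _ d2; have [M hM] := hs _ d2.
  exists (maxn N M) => n; rewrite geq_max => /andP[/hN h1 /hM].
  rewrite -rmorphB cmod_real ger0_norm ?subr_ge0 ?sz_ge1// => h2.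
  have h3 : cmod (vz (u n) - u n) <= sz (u n) - 1.
    have [z1|z1] := leP (cmod (u n)) 1.
      by rewrite /vz z1 subrr cmod0 subr_ge0 sz_ge1.
    rewrite /vz (leNgt (cmod (u n)) 1) z1 /= sz_out//.
    have z0 : (u n)^* != 0 by rewrite conjc_eq0 -cmod_gt0 (lt_trans ltr01).
    rewrite (_ : _ - u n = (1 - u n * (u n)^*) / (u n)^*); last by field.
    rewrite cmodM cmodV cmodJ -sqr_normc normcmod -rmorphXn -[1]/(1%:C) -rmorphB cmod_real.
    rewrite ler_pdivrMr; last by rewrite (lt_trans ltr01).
    rewrite distrC ger0_norm; last by rewrite subr_ge0 ltW// exprn_egt1.
    by rewrite ler_peMr ?subr_ge0 ?ltW// exprn_egt1.
  by have := cmod_tri (u n) (vz (u n)) l; lra.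
have l1' : cmod l <= 1 by rewrite l1.
have [N hN] := fbar_tends (fun n => vz_le1 (u n)) l1' hv e2.
have cc : 0 < cmod (1 + c) by rewrite cmod_gt0 c1_neq0.
have e4 : 0 < e / 2 / (4 / cmod (1 + c)) by rewrite !divr_gt0.
have [d d0 hd] := powR_small al_gt0 e4.
have dm : 0 < Num.min d 1 by rewrite lt_min d0 ltr01.
have [M hM] := hs _ dm.
exists (maxn N M) => n; rewrite geq_max => /andP[/hN h1 /hM].
rewrite -rmorphB cmod_real ger0_norm ?subr_ge0 ?sz_ge1// lt_min => /andP[h2 h3].
have := hd (sz (u n) - 1); rewrite subr_ge0 sz_ge1 => /(_ isT h2).
rewrite ltr_pdivlMr ?divr_gt0// mulrC => h4.
have h5 := @F_close (u n); have := cmod_tri (fbar (vz (u n))) (F (u n)) (fbar l).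
have {}h5 := h5 (ltac:(lra)).
lra.
Qed.

(** A solution strictly inside the moving circle also has a past. *)
Lemma Sol_backward w (s : R) l : 1 < s -> Sol w s l -> cmod l ^+ 2 * s < 1 ->
  exists2 s' : R, 1 <= s' < s & exists v, Sol w s' v.
Proof.
move=> s1 [l1 ls hl] lt; have s0 : 0 < s by lra.
pose tau := (1 - cmod l ^+ 2 * s) / (3 * s).
have lq0 : 0 <= cmod l ^+ 2 by rewrite exprn_ge0// cmod_ge0.
have lq1 : 0 <= cmod l ^+ 2 * s by rewrite mulr_ge0// ltW.
have tau0 : 0 < tau by rewrite divr_gt0//; lra.
have tauE : tau * (3 * s) = 1 - cmod l ^+ 2 * s by rewrite /tau divfK// gt_eqF//; lra.
have tau1 : tau <= 1 by rewrite ler_pdivrMr; lra.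
have P0 := cmod_ge0 (lpsi l).
have a0 := ldG_neq0 l1 (ltW s1) ls.
have ca : 0 < cmod (ldG s l) by rewrite cmod_gt0.
have [d d0 hd] := param_solve (fd l1) (lpsid l1) a0 ltr01.
have cc : 0 < cmod (1 + c) by rewrite cmod_gt0 c1_neq0.
set Q := cmod (lpsi l) / cmod (ldG s l) + 1.
have Q0 : 0 < Q by rewrite ltr_wpDl// divr_ge0// ltW.
pose e := Num.min (s - 1) (Num.min (d / 2 * cmod (1 + c)) (tau / Q * cmod (1 + c))).
have dd : 0 < d / 2 by rewrite divr_gt0.
have tq : 0 < tau / Q by rewrite divr_gt0.
have e0 : 0 < e by rewrite !lt_min subr_gt0 s1 (mulr_gt0 dd cc) (mulr_gt0 tq cc).
have e1 : e <= s - 1 by rewrite ge_min lexx.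
have e2 : e <= d / 2 * cmod (1 + c) by rewrite !ge_min lexx orbT.
have e3 : e <= tau / Q * cmod (1 + c) by rewrite !ge_min lexx !orbT.
have D : cmod (lsg (s - e) - lsg s) = e / cmod (1 + c).
  by rewrite cmod_lsgB addrAC subrr sub0r normrN gtr0_norm.
have eD : e / cmod (1 + c) <= tau / Q by rewrite ler_pdivrMr.
have [|v vw vl] := hd (lsg (s - e)).
  by rewrite D ltr_pdivrMr//; have : 0 < d * cmod (1 + c) by [rewrite mulr_gt0]; lra.
rewrite mul1r D in vl.
have vclose : cmod (v - l) <= tau.
  have := cmodB (v - l + (lsg (s - e) - lsg s) * lpsi l / ldG s l)
    ((lsg (s - e) - lsg s) * lpsi l / ldG s l).
  rewrite addrK [cmod (_ / ldG s l)]cmodM [cmod (_ * lpsi l)]cmodM cmodV D => h.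
  have eQ : e / cmod (1 + c) * Q <= tau by rewrite -ler_pdivlMr.
  apply: le_trans (le_trans h _) eQ.
  rewrite /Q [leRHS]mulrDr mulr1 [X in _ <= X + _]mulrA [leRHS]addrC.
  exact: lerD vl (lexx _).
have vr : cmod v <= cmod l + tau by have := cmod_subl v l; lra.
have vs : cmod v ^+ 2 * (s - e) <= 1.
  have l0 := cmod_ge0 l.
  have h1 : cmod v ^+ 2 <= cmod l ^+ 2 + 3 * tau.
    have : cmod v ^+ 2 <= (cmod l + tau) ^+ 2.
      by rewrite lerXn2r ?nnegrE ?cmod_ge0//; lra.
    have : cmod l * tau <= 1 * tau by rewrite ler_wpM2r// ltW.
    have : tau * tau <= 1 * tau by rewrite ler_wpM2r// ltW.
    rewrite !expr2; lra.
  have h2 : cmod v ^+ 2 * (s - e) <= cmod v ^+ 2 * s.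
    by rewrite ler_wpM2l ?exprn_ge0 ?cmod_ge0//; lra.
  have h3 : cmod v ^+ 2 * s <= (cmod l ^+ 2 + 3 * tau) * s by rewrite ler_wpM2r// ltW.
  lra.
exists (s - e); first by apply/andP; split; lra.
exists v; split=> //; last by rewrite -hl.
rewrite ltNge; apply/negP => v1.
have h1 : 1 <= cmod v ^+ 2 by rewrite exprn_ege1.
(* when s - e = 1, [vs] does not exclude |v| = 1, but |v| <= |l| + tau does *)
have h2 : (cmod l + tau) ^+ 2 * s <= 1.
  have l0 := cmod_ge0 l.
  have h3 : (cmod l + tau) ^+ 2 <= cmod l ^+ 2 + 3 * tau.
    have : cmod l * tau <= 1 * tau by rewrite ler_wpM2r// ltW.
    have : tau * tau <= 1 * tau by rewrite ler_wpM2r// ltW.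
    rewrite !expr2; lra.
  have h4 : (cmod l + tau) ^+ 2 * s <= (cmod l ^+ 2 + 3 * tau) * s by rewrite ler_wpM2r// ltW.
  lra.
have h5 : cmod v ^+ 2 <= (cmod l + tau) ^+ 2.
  rewrite lerXn2r ?nnegrE ?cmod_ge0// addr_ge0 ?cmod_ge0// ltW//.
have h6 : 1 * s <= (cmod l + tau) ^+ 2 * s by rewrite ler_wpM2r ?(ltW s0)//; lra.
lra.
Qed.

(** Let [t] be the first time at which [Sol w t v] has a solution [v] or a limit of
    solutions. By [Sol_backward], [v] lies on the moving circle if [t > 1]; if
    [t = 1] it lies in the closed disc, where [F] is [fbar]. *)
Lemma F_surj w : exists z, F z = w.
Proof.
pose S := [set s : R | 1 <= s /\ exists v, Sol w s v].
have [s00 s01 hs0] := Sol_exists_large w.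
have S0 : S !=set0 by exists s00.
have lbS : has_lbound S by exists 1 => s [].
have hinf : has_inf S by split.
set t := inf S; have t1 : 1 <= t by apply: lb_le_inf => // s [].
have hn (n : nat) : exists x : R * R[i], [/\ 1 <= x.1, x.1 < t + n.+1%:R^-1 & Sol w x.1 x.2].
  have n0 : 0 < n.+1%:R^-1 :> R by rewrite invr_gt0.
  by have [s [s1 [v hv]] st] := inf_adherent n0 hinf; exists (s, v).
have [x hx] := choice hn.
have xt n : t <= (x n).1.
  by apply: (ge_inf lbS); have [h1 _ h2] := hx n; split=> //; exists (x n).2.
have hs : tends (fun n => ((x n).1)%:C) t%:C.
  move=> e e0; have [N hN] := rn_close e0; exists N => n /hN.
  rewrite /rn opprB addrCA subrr addr0 => h; have [_ h2 _] := hx n.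
  rewrite -rmorphB cmod_real ger0_norm ?subr_ge0//; move: h2 h.
  set q := n.+1%:R^-1 => h2 h; lra.
have [|phi hphi [l hl]] := @bounded_subseq R (fun n => (x n).2) 1.
  by move=> n; have [_ _ [h _ _]] := hx n; exact: ltW.
have {}hs := tends_sub hphi hs.
have lt : cmod l ^+ 2 * t <= 1.
  apply: (tends_sqr_le hs hl) => [|n|n] /=; first by lra.
    by have [h _ _] := hx (phi n); lra.
  by have [_ _ []] := hx (phi n).
have l1 : cmod l <= 1 by apply: tends_mod_le hl _ => n; have [_ _ [h _ _]] := hx (phi n); exact: ltW.
have [t1' | t1'] := eqVneq t 1.
  exists l; rewrite /F l1; rewrite t1' in hs.
  have h1 : tends (fun n => fbar ((x (phi n)).2)) (fbar l).
    apply: fbar_tends => // n.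
    by have [_ _ [h _ _]] := hx (phi n); exact: ltW.
  apply: tends_unique h1 _ => e e0.
  have cc : 0 < cmod (1 + c) by rewrite cmod_gt0 c1_neq0.
  have e4 : 0 < e / (4 / cmod (1 + c)) by rewrite !divr_gt0.
  have [d d0 hd] := powR_small al_gt0 e4.
  have dm : 0 < Num.min d 1 by rewrite lt_min d0 ltr01.
  have [N hN] := hs _ dm; exists N => n Nn.
  have : cmod (((x (phi n)).1)%:C - 1%:C) < Num.min d 1 := hN n Nn.
  have [x1 _ [v1 v2 v3]] := hx (phi n).
  rewrite -rmorphB cmod_real ger0_norm ?subr_ge0// lt_min => /andP[h2 h3].
  have := hd ((x (phi n)).1 - 1); rewrite subr_ge0 x1 => /(_ isT h2).
  rewrite ltr_pdivlMr ?divr_gt0// mulrC => h4.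
  rewrite fbar_in// cmodC -{1}v3; apply: le_lt_trans h4; apply: lG_boundary => //.
  by rewrite x1/=; lra.
have {t1'}t1' : 1 < t by rewrite lt_neqAle eq_sym t1'.
have l1' : cmod l < 1.
  rewrite ltNge; apply/negP => h; have h1 : 1 <= cmod l ^+ 2 by rewrite exprn_ege1.
  have : 1 * t <= cmod l ^+ 2 * t by rewrite ler_wpM2r//; lra.
  lra.
have wl : lG t l = w.
  apply: tends_unique (lG_tends l1' hs hl) _.
  by apply: tends_eq (tends_cst w) => n /=; have [_ _ [_ _ ->]] := hx (phi n).
have sl : Sol w t l by [].
have ltE : cmod l ^+ 2 * t = 1.
  apply/eqP; rewrite eq_le lt /= leNgt; apply/negP => h.
  have [s' /andP[s1 s2] hs'] := Sol_backward t1' sl h.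
  by have : t <= s' by [apply: (ge_inf lbS)]; rewrite leNgt s2.
have t0 : 0 < t by lra.
have l0 : l != 0 by apply: contra_eq_neq ltE => ->; rewrite cmod0 expr0n mul0r eq_sym oner_neq0.
have cl : 0 < cmod l by rewrite cmod_gt0.
have z1 : 1 < cmod ((l^*)^-1) by rewrite cmodV cmodJ invf_gt1.
exists ((l^*)^-1); rewrite F_out// sz_out// /vz leNgt z1 /= conj_inv_involutive.
rewrite cmodV cmodJ exprVn (_ : (cmod l ^+ 2)^-1 = t)//.
by rewrite -[LHS]mulr1 -ltE mulKf// expf_neq0// gt_eqF.
Qed.

(** By [large_strict], [|lG s v|] is at least of order [s |v|] for large [s], which
    is [|z|] at the point of the moving circle that corresponds to [z]. *)
Lemma F_proper (M : R) : exists B : R, forall z, cmod (F z) <= M -> cmod z <= B.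
Proof.
have [rho /andP[r0 r1] [S S2 hS]] := large_strict.
exists (S + rho^-1 + 8 * `|M|) => z FM.
have ir : 0 < rho^-1 by rewrite invr_gt0.
have aM := normr_ge0 M.
rewrite leNgt; apply/negP => zB.
have zS : S < cmod z by lra.
have zr : rho^-1 < cmod z by lra.
have zM : 8 * `|M| < cmod z by lra.
have z1 : 1 < cmod z by lra.
have z0 : 0 < cmod z by lra.
have zz : cmod z * 2 <= cmod z ^+ 2 by rewrite expr2 ler_wpM2l ?ltW//; lra.
have [[v1 v2 v3] _] := Sol_out z1.
have sE := sz_out z1.
have ss : S <= sz z by rewrite sE; lra.
have s1 : 1 < sz z by rewrite sE; lra.
have vr : cmod (vz z) < rho.
  by rewrite cmod_vz_out// -[ltRHS]invrK ltf_pV2 ?posrE.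
have := hS _ (vz z) 0 ss vr; rewrite cmod0 => /(_ r0).
rewrite f0 {2}/lpsi mul0r mulr0 addr0 !subr0 mul1r cmod1 mulr1 => h1.
have h2 : cmod (vz z) / 2 <= cmod (lpsi (vz z) + (lsg (sz z))^-1 * f (vz z)).
  have := cmod_subl (vz z) (lpsi (vz z) + (lsg (sz z))^-1 * f (vz z)).
  by rewrite cmodC; lra.
have cc : 0 < cmod (1 + c) by rewrite cmod_gt0 c1_neq0.
have cc2 : cmod (1 + c) <= 2 by have := cmodD 1 c; rewrite cmod1; klra.
have sg : (sz z - 1) / 2 <= cmod (lsg (sz z)).
  rewrite /lsg cmodM cmodV cmod_real ger0_norm; last by lra.
  by rewrite ler_wpM2l ?lef_pV2 ?posrE//; lra.
have h3 : (sz z - 1) / 2 * (cmod (vz z) / 2) <= cmod (F z).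
  rewrite -v3 lGE// cmodM; apply: ler_pM => //; first by lra.
  by rewrite divr_ge0// cmod_ge0.
have h4 : sz z * cmod (vz z) = cmod z.
  by rewrite sE cmod_vz_out// expr2 mulfK// gt_eqF.
have h5 : cmod (vz z) <= 1 by rewrite ltW.
have h6 := ler_norm M.
have h7 : 2 * cmod (vz z) <= cmod z.
  by rewrite -h4 ler_wpM2r ?cmod_ge0//; lra.
lra.
Qed.

Lemma tends_eps (g : R[i] -> R[i]) z :
  (forall u : nat -> R[i], tends u z -> tends (fun n => g (u n)) (g z)) ->
  forall e : R, 0 < e -> exists2 d : R, 0 < d &
    forall w, cmod (w - z) < d -> cmod (g w - g z) < e.
Proof.
move=> hg e e0; apply: contrapT => H.
have hn (n : nat) : exists w, cmod (w - z) < n.+1%:R^-1 /\ e <= cmod (g w - g z).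
  apply: contrapT => H2; apply: H.
  exists n.+1%:R^-1 => [|w wz]; first by rewrite invr_gt0.
  by rewrite ltNge; apply/negP => h; apply: H2; exists w.
have [u hu] := choice hn.
have tu : tends u z.
  move=> d d0; have [N hN] := rn_close d0; exists N => n /hN.
  rewrite /rn opprB addrCA subrr addr0 => h.
  by apply: lt_trans h; have [] := hu n.
have [N /(_ N (leqnn _))] := hg u tu _ e0.
by rewrite ltNge; have [_ ->] := hu N.
Qed.

Lemma continuous_tends (g : R[i]^o -> R[i]^o) :
  (forall (u : nat -> R[i]) l, tends u l -> tends (fun n => g (u n)) (g l)) ->
  continuous g.
Proof.
move=> hg z; have FF : Filter (nbhs (z : R[i]^o)) by exact: nbhs_filter.
apply: (iffRL (@cvgrPdist_lt R[i] R[i]^o _ (nbhs (z : R[i]^o)) FF g (g z))).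
move=> e /cpos_real[e0 ->].
have [d d0 hd] := tends_eps (hg ^~ z) e0.
exists d%:C; first by rewrite /= ltcR.
move=> w /=; rewrite normcmod ltcR => wz; rewrite normcmod ltcR cmodC.
by apply: hd; rewrite cmodC.
Qed.

(** The inverse is continuous by compactness: [F] is continuous, injective and
    proper. *)
Lemma F_homeomorphism : homeomorphism F.
Proof.
split; first by apply: continuous_tends => u l; exact: F_tends.
have [H hH] := choice F_surj.
have HK : cancel F H by move=> z; apply: F_inj; rewrite hH.
exists H; split=> //; apply: continuous_tends => u l hu.
move=> e e0; apply: contrapT => hno.
have hn (n : nat) : exists m, (n <= m)%N /\ e <= cmod (H (u m) - H l).
  apply: contrapT => h; apply: hno; exists n => m nm; rewrite ltNge; apply/negP => h2.
  by apply: h; exists m.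
have [phi hphi] := choice hn.
have [M hM] := tends_bounded hu; have [B hB] := F_proper M.
have [|psi hpsi [x hx]] := @bounded_subseq R (fun n => H (u (phi n))) B.
  by move=> n; apply: hB; rewrite hH.
have h1 := F_tends hx.
have h2 : tends (fun n => F (H (u (phi (psi n))))) l.
  have hpp n : (n <= phi (psi n))%N by apply: leq_trans (hpsi n) _; exact: (hphi _).1.
  by apply: tends_eq (tends_sub hpp hu) => n /=; rewrite hH.
have Fx : F x = l := tends_unique h1 h2.
have [N /(_ N (leqnn _)) /=] := hx _ e0.
by rewrite -[x]HK Fx ltNge; have [_ ->] := hphi (psi N).
Qed.

(** * The differential of the extension *)

Lemma realcB (x y : R) : (x - y)%:C = x%:C - y%:C :> R[i].
Proof. exact: rmorphB. Qed.

Lemma sder_scale a z : sder (fun x => a * x) z a.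
Proof. by have := sderM (sder_cst a z) (sder_id z); rewrite mul0r add0r mulr1. Qed.

Lemma F_rder_in z : cmod z < 1 -> rder F z (f1 z) 0.
Proof.
move=> z1; apply: (rder_near (d := 1 - cmod z) (f := f)).
- by rewrite subr_gt0.
- by move=> x hx; rewrite F_in//; have := cmod_subl x z; lra.
- exact/rder_sder/fd.
Qed.

(** With [v = 1 / z^*] and [dv = - v^2 dz^*], the Wirtinger derivatives of
    [f v + (z - v) f1 v / (1 + c)] are [A = f1 v / (1 + c)] and
    [B = - v^2 (c f1 v + (z - v) f2 v) / (1 + c)]; as [z - v = (|z|^2 - 1) v], the
    bound for [B] is Ahlfors' condition on the circle [|v|^2 s = 1]. *)
Lemma F_rder_out z : 1 < cmod z -> exists2 B,
  rder F z (f1 (vz z) / (1 + c)) B & cmod B <= k * cmod (f1 (vz z) / (1 + c)).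
Proof.
move=> z1; have [[v1 vs _] ve] := Sol_out z1.
have z0 : z^* != 0 by rewrite conjc_eq0 -cmod_gt0 (lt_trans ltr01).
have c0 := c1_neq0.
pose V w : R[i] := (w^*)^-1.
have VE : V z = vz z by rewrite /V /vz leNgt z1.
rewrite -VE in v1 vs ve *; set v := V z in v1 vs ve *.
have hV : rder V z 0 (- v ^+ 2).
  have := rder_comp (rder_conj z) (sder_inv z0); rewrite mulr0 mulr1.
  by rewrite /v /V exprVn.
have hf := rder_comp hV (fd v1).
have hg := rder_comp (rder_comp hV (f1d v1)) (sder_scale (1 + c)^-1 _).
have hw := rderD (rder_sder (sder_id z)) (rder_comp hV (sder_scale (-1) _)).
have H := rderD hf (rderM hw hg).
pose B := - v ^+ 2 / (1 + c) * (c * f1 v + (z - v) * f2 v).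
have BE : cmod B <= k * cmod (f1 v / (1 + c)).
  have zv : z - v = (sz z - 1)%:C * v.
    rewrite realcB mulrBl mul1r sz_out//; congr (_ - _).
    have -> : (cmod z ^+ 2)%:C = z * z^* by rewrite -sqr_normc normcmod rmorphXn.
    by rewrite /v /V mulfK.
  have cc : 0 < cmod (1 + c) by rewrite cmod_gt0.
  have -> : cmod B = cmod v ^+ 2 / cmod (1 + c) * cmod (c * f1 v + (z - v) * f2 v).
    by rewrite !(cmodM, cmodV, cmodN, cmodX).
  have -> : cmod (f1 v / (1 + c)) = cmod (f1 v) / cmod (1 + c) by rewrite cmodM cmodV.
  have := ahlfors v1 (sz_ge1 z) vs.
  rewrite (_ : _ * (v * f2 v) = (z - v) * f2 v); last by rewrite zv mulrA.
  move=> /(ler_wpM2l (mulr_ge0 (exprn_ge0 2 (cmod_ge0 v)) (ltW (_ : 0 < (cmod (1 + c))^-1)))).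
  rewrite invr_gt0 => /(_ cc) h; apply: le_trans h _.
  rewrite le_eqVlt; apply/orP; left; apply/eqP.
  transitivity (cmod v ^+ 2 * sz z * (k * (cmod (f1 v) / cmod (1 + c)))); first by ring.
  by rewrite ve mul1r.
have H' : rder (fun w => f (V w) + (w + -1 * V w) * ((1 + c)^-1 * f1 (V w))) z
    (f1 v / (1 + c)) B.
  have := H; rewrite -/v.
  rewrite (_ : f1 v * 0 + _ = f1 v / (1 + c)); last by field.
  by rewrite (_ : f1 v * - v ^+ 2 + _ = B)//; rewrite /B; field.
exists B => //; apply: (rder_near (d := cmod z - 1) _ _ H') => [|x hx].
  by rewrite subr_gt0.
have x1 : 1 < cmod x by have := cmod_subl z x; rewrite cmodC; lra.
have x0 : x^* != 0 by rewrite conjc_eq0 -cmod_gt0 (lt_trans ltr01).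
rewrite F_out// sz_out//.
have -> : vz x = V x by rewrite /V /vz leNgt x1.
rewrite /lG /lpsi /lsg realcB.
have -> : (cmod x ^+ 2)%:C = x * x^* by rewrite -sqr_normc normcmod rmorphXn.
rewrite /V; set a := f _; set b := f1 _.
by field; rewrite c0 x0.
Qed.

Lemma powR_comparison (x y m : R) : 0 < x -> 1 <= m -> x <= m * y ->
  y `^ (- k) <= m * x `^ (- k).
Proof.
move=> x0 m1 xy; have m0 : 0 < m by lra.
have y0 : 0 < y by rewrite -(pmulr_rgt0 _ m0); exact: lt_le_trans xy.
rewrite !powRN ler_pdivlMr ?powR_gt0// mulrC ler_pdivrMr ?powR_gt0//.
apply: (@le_trans _ _ ((m * y) `^ k)).
  by apply: ge0_ler_powR; rewrite ?nnegrE ?k0// ltW// mulr_gt0.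
rewrite powRM ?(ltW m0) ?(ltW y0)// ler_wpM2r ?powR_ge0//.
by apply: ler1_powR => //; exact: ltW.
Qed.

Definition dbound (rho : R) : R := 2 + rho * (rho + 1) / cmod (1 + c).

Lemma f1_growthN u : cmod u < 1 -> cmod (f1 u) <= (1 - cmod u) `^ (- k).
Proof.
move=> u1; rewrite powRN -[leRHS]mul1r ler_pdivlMr ?powR_gt0 ?subr_gt0//.
exact: f1_growth.
Qed.

(** The modulus of [A] is of the order of [(1 - |v|)^(- k)], where [1 - |v|] is
    [1 - |z|] inside and [1 - |z|^-1] outside the unit circle. *)
Lemma F_differential z (rho : R) : 1 <= rho -> cmod z <= rho -> cmod z != 1 ->
  exists A B, [/\ rder F z A B, A != 0, cmod B <= k * cmod A &
    cmod A <= dbound rho * `|cmod z ^+ 2 - 1| `^ (- k)].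
Proof.
move=> rho1 zr zn1; have z0 := cmod_ge0 z.
have cc : 0 < cmod (1 + c) by rewrite cmod_gt0 c1_neq0.
have rr : 0 <= rho * (rho + 1) / cmod (1 + c).
  by rewrite divr_ge0 ?mulr_ge0 ?ltW//; lra.
have [z1|z1|z1] := ltgtP (cmod z) 1; last by rewrite z1 eqxx in zn1.
  exists (f1 z), 0; split.
  - exact: F_rder_in.
  - exact: f1n.
  - by rewrite cmod0 mulr_ge0 ?cmod_ge0// k0.
  apply: le_trans (f1_growthN z1) _.
  have q0 : 0 < 1 - cmod z ^+ 2 by rewrite subr_gt0 exprn_ilt1.
  rewrite distrC gtr0_norm//.
  apply: (@le_trans _ _ (2 * (1 - cmod z ^+ 2) `^ (- k))).
    apply: powR_comparison => //; first by rewrite ler1n.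
    rewrite (_ : 1 - cmod z ^+ 2 = (1 + cmod z) * (1 - cmod z)); last by ring.
    by rewrite ler_wpM2r//; lra.
  by rewrite ler_wpM2r ?powR_ge0// lerDl.
have [B hB BA] := F_rder_out z1.
have [[v1 _ _] _] := Sol_out z1.
exists (f1 (vz z) / (1 + c)), B; split=> //.
  by rewrite mulf_neq0 ?f1n// invr_eq0 c1_neq0.
have zp : 0 < cmod z by lra.
have q0 : 0 < cmod z ^+ 2 - 1 by rewrite subr_gt0 exprn_egt1.
rewrite gtr0_norm// cmodM cmodV ler_pdivrMr//.
apply: le_trans (f1_growthN v1) _; rewrite cmod_vz_out//.
apply: (@le_trans _ _ (rho * (rho + 1) * (cmod z ^+ 2 - 1) `^ (- k))).
  apply: powR_comparison => //.
    by have := mulr_ge0 (ltW (lt_le_trans ltr01 rho1)) (ltW (lt_le_trans ltr01 rho1)); lra.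
  have -> : cmod z ^+ 2 - 1 = cmod z * (cmod z + 1) * (1 - (cmod z)^-1).
    by field; rewrite gt_eqF.
  apply: ler_wpM2r; first by rewrite subr_ge0 invf_le1//; exact: ltW.
  by apply: ler_pM; lra.
rewrite [leRHS]mulrAC; apply: ler_wpM2r; first exact: powR_ge0.
rewrite /dbound mulrDl divfK ?gt_eqF// lerDr.
by rewrite mulr_ge0// ltW.
Qed.

(** * Absolute continuity on lines *)

(** On a horizontal or vertical line at distance [|y|] from the origin,
    [|z|^2 - 1 = t^2 - (1 - y^2)], so that [F_differential] bounds the derivative by
    the function of [abs_continuous_majorant]; the two lines tangent to the unit
    circle are excluded. *)
Lemma F_line_abs_continuous (z0 e : R[i]) (y a b : R) : cmod e = 1 ->
  (forall t : R, cmod (z0 + t%:C * e) ^+ 2 = t ^+ 2 + y ^+ 2) ->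
  y ^+ 2 != 1 -> a <= b ->
  abs_continuous a b (fun t => Re (F (z0 + t%:C * e))) /\
  abs_continuous a b (fun t => Im (F (z0 + t%:C * e))).
Proof.
move=> e1 hp y1 ab; set p : R -> R[i] := fun t => z0 + t%:C * e.
pose rho := 1 + `|a| + `|b| + `|y|.
have rho1 : 1 <= rho by rewrite /rho -!addrA lerDl !addr_ge0.
have pr t : a <= t -> t <= b -> cmod (p t) <= rho.
  move=> at_ tb; rewrite -(@ler_pXn2r _ 2) ?nnegrE ?cmod_ge0//; last by lra.
  rewrite hp -(real_normK (num_real t)) -(real_normK (num_real y)).
  have t0 := normr_ge0 t; have y0 := normr_ge0 y.
  have tr : `|t| + `|y| <= rho.
    rewrite /rho lerD2r; have := ler_norm a; have := ler_norm (- a); have := ler_norm b.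
    have := normr_ge0 a; have := normr_ge0 b; rewrite normrN => *.
    by rewrite ler_norml; apply/andP; split; lra.
  have : (`|t| + `|y|) ^+ 2 <= rho ^+ 2 by rewrite ler_pXn2r// nnegrE; lra.
  have : 0 <= `|t| * `|y| by rewrite mulr_ge0.
  by rewrite sqrrD; lra.
have m0 : 1 - y ^+ 2 != 0 by rewrite subr_eq0 eq_sym.
have rr : 0 <= rho * (rho + 1) / cmod (1 + c).
  by rewrite divr_ge0 ?cmod_ge0// mulr_ge0; lra.
have D0 : 0 <= 2 * dbound rho by rewrite mulr_ge0// /dbound addr_ge0.
have al1 : al <= 1 by rewrite /al; klra.
have [M [dM [l [cM aM hM]]]] := abs_continuous_majorant al_gt0 al1 m0 D0 ab.
have der t : a < t < b -> t \notin l -> exists A B, [/\ rder F (p t) A B,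
    is_derive t 1 M (dM t) & cmod (A * e + B * e^*) <= dM t].
  move=> /andP[at_ tb] tl; have [tm dMt le] := hM t tl.
  have pE : cmod (p t) ^+ 2 - 1 = t ^+ 2 - (1 - y ^+ 2) by rewrite hp; ring.
  have pn : cmod (p t) != 1.
    apply: contra_neq tm => h; move: pE; rewrite h expr1n subrr => /esym/eqP.
    by rewrite subr_eq0 => /eqP.
  have [A [B [h1 _ h2 h3]]] := F_differential rho1 (pr t (ltW at_) (ltW tb)) pn.
  exists A, B; split=> //; apply: le_trans le.
  rewrite pE (_ : - k = al - 1) in h3; last by rewrite /al; ring.
  apply: le_trans (cmodD _ _) _; rewrite !cmodM cmodJ e1 !mulr1 -mulrA.
  have := cmod_ge0 A; have : 0 <= (1 - k) * cmod A by rewrite mulr_ge0 ?cmod_ge0//; klra.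
  by lra.
have cont (part : R[i] -> R) : (forall z w, part (z - w) = part z - part w) ->
    (forall z, `|part z| <= cmod z) -> continuous (fun t => part (F (p t))).
  move=> pB pn; apply: continuous_eps => t eps eps0.
  have [d d0 hd] := tends_eps (fun u : nat -> R[i] => @F_tends u (p t)) eps0.
  exists d => // s st; rewrite -pB; apply: le_lt_trans (pn _) (hd _ _).
  by rewrite /p opprD addrACA subrr add0r -mulrBl -realcB cmodM e1 mulr1 cmod_real.
have ac (part : R[i] -> R) : (forall z w, part (z - w) = part z - part w) ->
    (forall z, `|part z| <= cmod z) ->
    (forall t A B, rder F (p t) A B ->
       is_derive t 1 (fun s => part (F (p s))) (part (A * e + B * e^*))) ->
    abs_continuous a b (fun t => part (F (p t))).
  move=> pB pn pd; apply: abs_continuous_dominated aM => s t as_ st tb.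
  have cF := cont part pB pn.
  pose h (r : R) := part (F (p r)).
  apply: (@derivable_le_except R h M (derive1 h) dM l s t) => //.
  move=> r /andP[sr rt] rl.
  have [|A [B [h1 h2 h3]]] := der r _ rl.
    by rewrite (le_lt_trans as_ sr) (lt_le_trans rt tb).
  have h4 := pd _ _ _ h1; split=> //.
    by rewrite derive1E (@derive_val _ _ _ _ _ _ _ h4).
  by rewrite derive1E (@derive_val _ _ _ _ _ _ _ h4); apply: le_trans (pn _) h3.
split; apply: ac.
- exact: re_sub.
- exact: Re_cmod.
- by move=> t A B h; exact: rder_line_Re.
- exact: im_sub.
- exact: Im_cmod.
- by move=> t A B h; exact: rder_line_Im.
Qed.

Lemma F_ACL : ACL F.
Proof.
move=> a b a' b' ab ab'; split; apply: ae_sqr_neq1 => y y1 _.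
- have E t : t +i* y = (0 +i* y) + t%:C * 1.
    by rewrite mulr1; apply/eqP; rewrite eq_complex /= add0r addr0 !eqxx.
  under eq_fun do rewrite E; under [X in _ /\ abs_continuous _ _ X]eq_fun do rewrite E.
  apply: (@F_line_abs_continuous _ _ y); rewrite ?cmod1//; last exact: ltW.
  by move=> t; rewrite -E cmod_sqr.
- have E t : y +i* t = y%:C + t%:C * 'i%C.
    by apply/eqP; rewrite eq_complex /= !mulr0 !mul0r mulr1 subr0 !addr0 !add0r !eqxx.
  under eq_fun do rewrite E; under [X in _ /\ abs_continuous _ _ X]eq_fun do rewrite E.
  apply: (@F_line_abs_continuous _ _ y); last exact: ltW.
  + by rewrite /cmod /= expr0n expr1n add0r sqrtr1.
  + by move=> t; rewrite -E cmod_sqr addrC.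
  + by [].
Qed.

(** * The extension criterion *)

Lemma unit_circleE (x y : R) : x ^+ 2 + y ^+ 2 != 1 -> cmod (x +i* y) != 1.
Proof. by apply: contra_neq => h; have := cmod_sqr (x +i* y); rewrite h expr1n /= => <-. Qed.

Lemma F_dilatation (x y : R) : x ^+ 2 + y ^+ 2 != 1 ->
  cmod (dzbar F x y) <= k * cmod (dz F x y) /\ dz F x y != 0.
Proof.
move=> /unit_circleE z1; set z := x +i* y in z1.
have [||A [B [h1 A0 h2 _]]] := @F_differential z (1 + cmod z) _ _ z1.
- by rewrite lerDl cmod_ge0.
- by rewrite lerDr.
by rewrite (dzbar_rder h1) (dz_rder h1).
Qed.

Lemma F_qc : qc_automorphism F.
Proof.
split; [exact: F_homeomorphism|exact: F_ACL|].
exists k; first by rewrite k0.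
apply: plane_ae_off_circle => x y /F_dilatation[h _].
by rewrite !normcmod -rmorphM lecR.
Qed.

(** Ahlfors' criterion for quasiconformal extension. *)
Theorem ahlfors_extension : {in unit_disc R &, injective f} /\
  exists g : R[i]^o -> R[i]^o,
    [/\ qc_automorphism g, (forall z : R[i], unit_disc R z -> g z = f z) &
        plane_ae (fun x y : R => `|dilatation g x y| <= k%:C)].
Proof.
have Ff z : unit_disc R z -> F z = f z by move=> /unit_discE; exact: F_in.
split; first by move=> z w /set_mem/Ff zF /set_mem/Ff wF fzw; apply: F_inj; rewrite zF wF.
exists F; split=> //; first exact: F_qc.
apply: plane_ae_off_circle => x y /F_dilatation[h d0].
by rewrite /dilatation normcmod lecR cmodM cmodV ler_pdivrMr ?cmod_gt0.
Qed.

End Chain.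

(** * Robertson functions *)

Section Robertson.
Variable R : realType.
Implicit Types (z u X h : R[i]).

(** Off the origin [|z g| <= |h|] only gives [|g / h| <= |z|^-1]; the Schwarz lemma
    improves this to [1]. *)
Lemma schwarz_quotient (g h : R[i] -> R[i]) :
  (forall z, cmod z < 1 -> [/\ ana g z, ana h z & h z != 0]) ->
  (forall z, cmod z < 1 -> cmod (z * g z) <= cmod (h z)) ->
  forall z, cmod z < 1 -> cmod (g z) <= cmod (h z).
Proof.
move=> gh le z z1; have [_ _ hz] := gh z z1.
suff : cmod (g z / h z) <= 1.
  by rewrite cmodM cmodV ler_pdivrMr ?cmod_gt0// mul1r.
apply: (schwarz (f := fun z => g z / h z)) z1 => w w1; have [aw bw hw] := gh w w1.
  exists g, h; split=> //; exists (1 - cmod w); first by rewrite subr_gt0.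
  move=> x xw; have [|_ _ hx] := gh x; first by have := cmod_subl x w; lra.
  by rewrite mulrC divfK.
rewrite cmodM cmodV mulrA ler_pdivrMr ?cmod_gt0// mul1r.
apply: le_trans (le w w1); rewrite cmodM expr2 -mulrA ler_piMl ?mulr_ge0 ?cmod_ge0//.
exact: ltW.
Qed.

(** As [g] vanishes at [0], the Schwarz lemma applies to [g / (z h)], whose value at
    [0] is obtained by dividing the power series of [g] by [z]. *)
Lemma schwarz_quotient0 (g h : R[i] -> R[i]) : g 0 = 0 ->
  (forall z, cmod z < 1 -> [/\ ana g z, ana h z & h z != 0]) ->
  (forall z, cmod z < 1 -> cmod (z * g z) <= cmod (h z)) ->
  forall z, cmod z < 1 -> cmod (g z) <= cmod z * cmod (h z).
Proof.
move=> g0 gh le z z1; have [_ _ hz] := gh z z1.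
have [|[r [a [r0 ga]]] ah0 h0] := gh 0; first by rewrite cmod0.
have [|q qa gq] := psum_factor (m := 1) r0 ga.
  by move=> [|//] _; rewrite -(psum_center r0 ga).
pose Q w := if w == 0 then q 0 / h 0 else g w / (w * h w).
have gQ w : cmod w < 1 -> h w != 0 -> g w = w * h w * Q w.
  move=> w1 hw; rewrite /Q; case: eqVneq => [->|w0]; first by rewrite g0 !mul0r.
  by rewrite mulrC divfK ?mulf_neq0.
rewrite (gQ z z1 hz) !cmodM ler_piMr ?mulr_ge0 ?cmod_ge0//.
apply: (schwarz (f := Q)) z1 => w w1; have [aw bw hw] := gh w w1; last first.
  have [->|w0] := eqVneq w 0; first by rewrite cmod0 expr0n mul0r.
  have := le w w1; rewrite {1}(gQ w w1 hw) !cmodM => h1.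
  rewrite -(ler_pM2r (_ : 0 < cmod (h w))) ?cmod_gt0// mul1r; apply: le_trans h1.
  by rewrite le_eqVlt; apply/orP; left; apply/eqP; ring.
have [->|w0] := eqVneq w 0.
  exists q, h; split=> //; first by exists r; eexists; split; [exact: r0|exact: qa].
  exists (Num.min 1 r); first by rewrite lt_min ltr01.
  move=> x; rewrite subr0 lt_min => /andP[x1 xr]; have [_ _ hx] := gh x x1.
  rewrite /Q; case: eqVneq => [->|x0]; first by rewrite mulrC divfK.
  rewrite gq ?subr0// expr1; field; by rewrite hx.
exists g, (fun x => x * h x); split=> //; [exact: ana_mulX|by rewrite mulf_neq0|].
exists (1 - cmod w); first by rewrite subr_gt0.
move=> x xw; have x1 : cmod x < 1 by have := cmod_subl x w; lra.
by have [_ _ hx] := gh x x1; rewrite -gQ.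
Qed.

(** The number [e^(i lam) cos lam = (1 + e^(2 i lam)) / 2]. *)
Definition rotE (lam : R) : R[i] := cos lam ^+ 2 +i* (cos lam * sin lam).

Lemma cmod_rotE lam : 0 < cos lam -> cmod (rotE lam) = cos lam.
Proof.
move=> c0; apply/eqP; rewrite -(@eqrXn2 _ 2) ?cmod_ge0//; last exact: ltW.
rewrite cmod_sqr /=; apply/eqP.
transitivity (cos lam ^+ 2 * (cos lam ^+ 2 + sin lam ^+ 2)); first by ring.
by rewrite cos2Dsin2 mulr1.
Qed.

(** The map [z |-> z / (z + 2 e^(i lam) cos lam)] sends the half plane
    [Re (e^(- i lam) (1 + z)) > 0] to the unit disc and [0] to [0]; the difference
    of the squared moduli is [4 cos lam] times the real part in question. *)
Lemma half_plane_disc lam z : 0 < cos lam -> 0 < Re (expi (- lam) * (1 + z)) ->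
  cmod z < cmod (z + 2 * rotE lam).
Proof.
move=> c0; rewrite re_mul re_add im_add /expi /= cosN sinN => pos.
rewrite -(@ltr_pXn2r _ 2) ?nnegrE ?cmod_ge0// !cmod_sqr.
have -> : Re (z + 2 * rotE lam) = Re z + 2 * cos lam ^+ 2.
  by rewrite re_add /rotE re_mul /=; ring.
have -> : Im (z + 2 * rotE lam) = Im z + 2 * (cos lam * sin lam).
  by rewrite im_add /rotE im_mul /=; ring.
rewrite -subr_gt0.
have := mulr_gt0 c0 pos; have := cos2Dsin2 lam.
set C := cos lam; set S := sin lam; set x := Re z; set y := Im z => CS h.
rewrite (_ : _ - _ = 4 * (C * (C * (1 + x) - - S * (0 + y)))).
  by rewrite mulr_gt0.
transitivity (4 * C ^+ 2 * (C ^+ 2 + S ^+ 2) + 4 * C * (C * x + S * y)); first by ring.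
by rewrite CS; ring.
Qed.

(** The difference of the squares is [(s - 1) ((s + 1) |h|^2 - 2 s <X, h>)], and
    [2 s <X, h> <= s^2 |X|^2 + |h|^2 <= (s + 1) |h|^2]. *)
Lemma scaled_difference_le X h (s : R) : 1 <= s -> s * cmod X ^+ 2 <= cmod h ^+ 2 ->
  cmod (s%:C * X - h) <= s * cmod (h - X).
Proof.
move=> s1 Xh; have s0 : 0 <= s by lra.
rewrite -(@ler_pXn2r _ 2) ?nnegrE ?cmod_ge0 ?mulr_ge0 ?cmod_ge0// exprMn.
move: Xh; rewrite !cmod_sqr !re_sub !im_sub re_mul im_mul /=.
set a := Re X; set b := Im X; set p := Re h; set q := Im h => Xh.
rewrite -subr_ge0 (_ : _ - _ = (s - 1) * ((s + 1) * (p ^+ 2 + q ^+ 2) -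
  2 * s * (a * p + b * q))); last by ring.
apply: mulr_ge0; first by lra.
have h1 := sqr_ge0 (s * a - p); have h2 := sqr_ge0 (s * b - q).
have h3 := ler_wpM2l s0 Xh.
have -> : 2 * s * (a * p + b * q) = s * (s * (a ^+ 2 + b ^+ 2)) + (p ^+ 2 + q ^+ 2) -
  ((s * a - p) ^+ 2 + (s * b - q) ^+ 2) by ring.
lra.
Qed.

(** Again the difference of the squares has a factor [s - 1]; by the bounds
    [s |X| <= |h|] and [s <X, h> <= |h|^2] the other factor is at least
    [(s - 1)^2 (s + 1) |h|^2 / s^2]. *)
Lemma scaled_difference_le2 X h (s : R) : 1 <= s -> s * cmod X <= cmod h ->
  cmod ((2 * s - 1)%:C * X - h) <= s * cmod (h - X).
Proof.
move=> s1 Xh0; have s0 : 0 < s by lra.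
have Xh : s ^+ 2 * cmod X ^+ 2 <= cmod h ^+ 2.
  by rewrite -exprMn lerXn2r ?nnegrE ?cmod_ge0// mulr_ge0 ?cmod_ge0// ltW.
rewrite -(@ler_pXn2r _ 2) ?nnegrE ?cmod_ge0 ?mulr_ge0 ?cmod_ge0 ?(ltW s0)// exprMn.
move: Xh; rewrite !cmod_sqr !re_sub !im_sub re_mul im_mul /=.
set a := Re X; set b := Im X; set p := Re h; set q := Im h => Xh.
rewrite -subr_ge0 (_ : _ - _ = (s - 1) * ((s + 1) * (p ^+ 2 + q ^+ 2) -
  (3 * s - 1) * (a ^+ 2 + b ^+ 2) - 2 * (s - 1) * (a * p + b * q))); last by ring.
apply: mulr_ge0; first by lra.
rewrite -(pmulr_rge0 _ (exprn_gt0 2 s0)).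
have h1 := sqr_ge0 (s * a - p); have h2 := sqr_ge0 (s * b - q).
set T := s ^+ 2 * (a ^+ 2 + b ^+ 2) in Xh; set H := p ^+ 2 + q ^+ 2 in Xh *.
have H0 : 0 <= H by rewrite addr_ge0// sqr_ge0.
have -> : s ^+ 2 * ((s + 1) * H - (3 * s - 1) * (a ^+ 2 + b ^+ 2) -
    2 * (s - 1) * (a * p + b * q)) =
  (s - 1) ^+ 2 * (s + 1) * H + (3 * s - 1) * (H - T) + s * (s - 1) * (H - T) +
  s * (s - 1) * ((s * a - p) ^+ 2 + (s * b - q) ^+ 2) by rewrite /T /H; ring.
have HT : 0 <= H - T by rewrite subr_ge0.
have s10 : 0 <= s - 1 by lra.
have ss : 0 <= s * (s - 1) by rewrite mulr_ge0// ltW.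
have S0 : 0 <= (s * a - p) ^+ 2 + (s * b - q) ^+ 2 by exact: addr_ge0.
have c1 : 0 <= (s - 1) ^+ 2 * (s + 1) by rewrite mulr_ge0 ?sqr_ge0//; lra.
have c2 : 0 <= 3 * s - 1 by lra.
have := mulr_ge0 c1 H0; have := mulr_ge0 c2 HT; have := mulr_ge0 ss HT.
have := mulr_ge0 ss S0; lra.
Qed.

Variables (lam k : R) (f f1 f2 : R[i] -> R[i]).
Hypothesis k0 : 0 <= k.
Hypothesis k1 : k < 1.
Hypothesis f_ana : forall z, cmod z < 1 -> ana f z.
Hypothesis f1E : forall z, f1 z = (f : R[i]^o -> R[i]^o)^`()%classic z.
Hypothesis f2E : forall z, f2 z = (f1 : R[i]^o -> R[i]^o)^`()%classic z.
Hypothesis f0 : f 0 = 0.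
Hypothesis f10 : f1 0 = 1.
Hypothesis f1_neq0 : forall z, cmod z < 1 -> f1 z != 0.
Hypothesis coslam : 0 < cos lam.
Hypothesis half_plane : forall z, cmod z < 1 ->
  0 < Re (expi (- lam) * (1 + z * f2 z / f1 z)).

(** By [half_plane_disc], [z f2 / h] is an analytic function from the disc to the
    disc that vanishes at [0]. *)
Let h z := z * f2 z + 2 * rotE lam * f1 z.

Lemma ana_sder_at g z : ana g z -> sder g z ((g : R[i]^o -> R[i]^o)^`()%classic z).
Proof. by move=> /ana_sder[d d0 hd]; apply: hd; rewrite subrr cmod0. Qed.

Lemma ana_f1 z : cmod z < 1 -> ana f1 z.
Proof. by rewrite (funext f1E) => /f_ana/ana_derive. Qed.

Lemma ana_f2 z : cmod z < 1 -> ana f2 z.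
Proof. by rewrite (funext f2E) => /ana_f1/ana_derive. Qed.

Lemma f_sder z : cmod z < 1 -> sder f z (f1 z).
Proof. by rewrite f1E => /f_ana/ana_sder_at. Qed.

Lemma f1_sder z : cmod z < 1 -> sder f1 z (f2 z).
Proof. by rewrite f2E => /ana_f1/ana_sder_at. Qed.

Lemma robertson_subordination z : cmod z < 1 -> cmod (z * f2 z) < cmod (h z).
Proof.
move=> z1; have f1z := f1_neq0 z1; have := half_plane_disc coslam (half_plane z1).
have -> : z * f2 z / f1 z + 2 * rotE lam = h z / f1 z by rewrite /h; field.
by rewrite cmodM (cmodM (h z)) cmodV ltr_pM2r// invr_gt0 cmod_gt0.
Qed.

Lemma robertson_quotient z : cmod z < 1 -> [/\ ana f2 z, ana h z & h z != 0].
Proof.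
move=> z1; split.
- exact: ana_f2.
- by apply: anaD; [exact/ana_mulX/ana_f2|exact/anaZ/ana_f1].
- by rewrite -cmod_gt0; apply: le_lt_trans (robertson_subordination z1); exact: cmod_ge0.
Qed.

Lemma cmod_2rotE : cmod (2 * rotE lam) = 2 * cos lam.
Proof.
rewrite cmodM cmod_rotE//; congr (_ * _).
by rewrite -(rmorph_nat (real_complex R)) cmod_real ger0_norm.
Qed.

Lemma cmod_h z : cmod (h z) <= cmod z * cmod (f2 z) + 2 * cos lam * cmod (f1 z).
Proof. by apply: le_trans (cmodD _ _) _; rewrite cmodM (cmodM (2 * _)) cmod_2rotE. Qed.

Definition extendable := {in unit_disc R &, injective f} /\
  exists g : R[i]^o -> R[i]^o,
    [/\ qc_automorphism g, (forall z : R[i], unit_disc R z -> g z = f z) &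
        plane_ae (fun x y => `|dilatation g x y| <= k%:C)].

(** Ahlfors' criterion with [c = - 2 e^(i lam) cos lam]: then
    [c f1 + (s - 1) X = s X - h] with [X = u f2], and [h - X] has modulus
    [2 cos lam |f1|]. *)
Lemma extendable_half : cos lam <= k / 2 -> extendable.
Proof.
move=> ck; have f2h z : cmod z < 1 -> cmod (f2 z) <= cmod (h z).
  apply: (schwarz_quotient robertson_quotient) => w /robertson_subordination.
  exact: ltW.
apply: (@ahlfors_extension R f f1 f2 (- (2 * rotE lam)) k) => //.
- exact: f_sder.
- exact: f1_sder.
- by rewrite cmodN cmod_2rotE; lra.
- move=> u s u1 s1 us; set X := u * f2 u.
  rewrite (_ : _ + _ = s%:C * X - h u); last by rewrite realcB /h -/X; ring.
  apply: le_trans (scaled_difference_le s1 _) _.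
    rewrite /X cmodM exprMn mulrA (mulrC s).
    apply: (@le_trans _ _ (1 * cmod (f2 u) ^+ 2)).
      by rewrite ler_wpM2r// exprn_ge0// cmod_ge0.
    by rewrite mul1r lerXn2r ?nnegrE ?cmod_ge0// f2h.
  rewrite (_ : h u - X = 2 * rotE lam * f1 u); last by rewrite /h /X; ring.
  rewrite cmodM cmod_2rotE (mulrC k) -[leRHS]mulrA; apply: ler_wpM2l; first by lra.
  by apply: ler_wpM2r; [exact: cmod_ge0|lra].
- move=> u u1; have := f2h u u1; have := cmod_h u.
  have : 2 * cos lam * cmod (f1 u) <= k * cmod (f1 u).
    by apply: ler_wpM2r; [exact: cmod_ge0|lra].
  lra.
Qed.

(** Ahlfors' criterion with [c = - e^(i lam) cos lam]: then
    [2 (c f1 + (s - 1) X) = (2 s - 1) X - h] with [X = u f2]. The additional zero of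
    [f2] gives [|X| <= |u|^2 |h|] instead of [|X| <= |u| |h|], which allows a [c] half
    as large. *)
Lemma extendable_full : f2 0 = 0 -> cos lam <= k -> extendable.
Proof.
move=> f20 ck; have f2h z : cmod z < 1 -> cmod (f2 z) <= cmod z * cmod (h z).
  apply: (schwarz_quotient0 f20 robertson_quotient) => w /robertson_subordination.
  exact: ltW.
have cr : cmod (rotE lam) = cos lam by exact: cmod_rotE.
apply: (@ahlfors_extension R f f1 f2 (- rotE lam) k) => //.
- exact: f_sder.
- exact: f1_sder.
- by rewrite cmodN cr.
- move=> u s u1 s1 us; set X := u * f2 u.
  have c2 : cmod (2 : R[i]) = 2.
    by rewrite -(rmorph_nat (real_complex R)) cmod_real ger0_norm.
  set W := _ + _; have WE : 2 * W = (2 * s - 1)%:C * X - h u.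
    by rewrite /W /h -/X !realcB rmorphM; ring.
  have : cmod (2 * W) <= s * cmod (h u - X).
    rewrite WE; apply: scaled_difference_le2 => //.
    rewrite /X cmodM; apply: (@le_trans _ _ (s * (cmod u * (cmod u * cmod (h u))))).
      by apply: ler_wpM2l; [lra|apply: ler_wpM2l; [exact: cmod_ge0|exact: f2h]].
    rewrite (_ : s * _ = cmod u ^+ 2 * s * cmod (h u)); last by ring.
    by rewrite ler_piMl// cmod_ge0.
  rewrite (_ : h u - X = 2 * rotE lam * f1 u); last by rewrite /h /X; ring.
  rewrite (cmodM 2 W) c2 cmodM cmod_2rotE => h1.
  have h2 : s * (cos lam * cmod (f1 u)) <= s * (k * cmod (f1 u)).
    apply: ler_wpM2l; first by lra.
    by apply: ler_wpM2r; [exact: cmod_ge0|].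
  lra.
- move=> u u1; have h1 := f2h u u1; have h2 := cmod_h u.
  have u0 := cmod_ge0 u; have v0 := cmod_ge0 (f1 u).
  have h3 := ler_wpM2l u0 h2.
  have h4 : cos lam * cmod (f1 u) <= k * cmod (f1 u) by rewrite ler_wpM2r.
  have h5 : (1 + cmod u) * (cos lam * cmod (f1 u)) <= (1 + cmod u) * (k * cmod (f1 u)).
    by apply: ler_wpM2l => //; lra.
  have h6 : 0 <= (1 - cmod u) * (cos lam * cmod (f1 u)).
    by rewrite mulr_ge0 ?(mulr_ge0 (ltW coslam))// subr_ge0 ltW.
  rewrite -(@ler_pM2l _ (1 + cmod u)); last by lra.
  lra.
Qed.

End Robertson.

Theorem corollary4 (R : realType) (k lam : R) (f : R[i]^o -> R[i]^o)
    (hk : 0 <= k < 1)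
    (hlam : - (pi / 2) < lam < pi / 2)
    (hf : robertson lam f) :
  (0 < cos lam <= k / 2 -> classSk k f) /\
  (f^`(2) 0 = 0 -> 0 < cos lam <= k -> classSk k f).
Proof.
have /andP[k0 k1] := hk; have [cA hR] := hf; have [af f0 f10] := cA.
have fana z : cmod z < 1 -> ana f z.
  move=> /unit_discE/af[r [a [r0 ra]]].
  by exists r, a; split=> // w wz; apply/tendsP; apply: ra; rewrite ltc_cmod.
have f1n z : cmod z < 1 -> f^`()%classic z != 0 by move=> /unit_discE/hR[].
have hp z : cmod z < 1 ->
    0 < Re (expi (- lam) * (1 + z * f^`(2)%classic z / f^`()%classic z)).
  by move=> /unit_discE/hR[].
split=> [/andP[c0 ck]|f20 /andP[c0 ck]].
- have [inj [g hg]] := extendable_half k0 k1 fana (fun=> erefl) (fun=> erefl) f0 f10 f1n c0 hp ck.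
  by split; [split|exists g].
- have [inj [g hg]] := extendable_full k0 k1 fana (fun=> erefl) (fun=> erefl) f0 f10 f1n c0 hp f20 ck.
  by split; [split|exists g].
Qed.
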